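(* Let $n,d,T\ge1$ be integers, $\alpha,L,\bar L,\sigma,G,\mathcal K>0$. Let $\Theta\subset\mathbb R^d$ be a nonempty convex compact set with $\mathrm{diam}(\Theta)\le\mathcal K$. Let $f_1,\dots,f_n:\mathbb R^d\to\mathbb R$ belong to $\mathcal F_2(L)$ and be 2-smooth with constant $\bar L$, with $\max_{x\in\Theta}\|\nabla f_i(x)\|\le G$ for $1\le i\le n$, and suppose that $f=\frac1n\sum_{i=1}^nf_i$ is $\alpha$-strongly convex. Let $W\in\mathbb R^{n\times n}$ be symmetric and doubly stochastic with $\rho:=\|W-n^{-1}\mathbb 1\mathbb 1^\top\|_*<1$. Let $x^i(t)$ be the iterates of the distributed zero-order gradient algorithm with the 2-point gradient estimators (both defined in the context), under the noise assumption of the context, with $$\eta_t=\frac1{\alpha t},\qquad h_t=\Big(\frac{3d^2\sigma^2}{2L\alpha t+9L^2d^2}\Big)^{1/4},$$ and let $\bar x(t)=\frac1n\sum_{i=1}^nx^i(t)$. Let $x^*$ be the minimizer of $f$ over $\Theta$. Then the estimator $\tilde x(T)=\frac1{T-\lfloor T/2\rfloor}\sum_{t=\lfloor T/2\rfloor+1}^T\bar x(t)$ satisfies $$\mathbb E[f(\tilde x(T))-f(x^* )]\le\frac{\mathcal B}{1-\rho}\left(\frac d{\sqrt{\alpha T}}+\frac{d^2}{\alpha T}\right),$$ where $\mathcal B>0$ is a constant independent of $T,d,\alpha,n,\rho$.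
   Context: Notation. $\|\cdot\|$ is the Euclidean norm, $\|\cdot\|_*$ the spectral norm of a matrix, $\mathbb 1\in\mathbb R^n$ the all-ones vector, $\mathrm{Proj}_\Theta$ the Euclidean projection onto $\Theta$, $\mathrm{diam}$ the Euclidean diameter. $\lfloor x\rfloor$ denotes the maximal integer (strictly) less than $x$. Function classes. $\mathcal F_2(L)$ is the set of differentiable functions $F:\mathbb R^d\to\mathbb R$ with $|F(z)-F(x)-\langle\nabla F(x),z-x\rangle|\le L\|z-x\|^2$ for all $x,z\in\mathbb R^d$. $F$ is 2-smooth with constant $\bar L$ if it is differentiable and $\|\nabla F(x)-\nabla F(x')\|\le\bar L\|x-x'\|$ for all $x,x'\in\mathbb R^d$. $F$ is $\alpha$-strongly convex if it is differentiable on $\mathbb R^d$ and $F(x)-F(x')\ge\langle\nabla F(x'),x-x'\rangle+\frac\alpha2\|x-x'\|^2$ for all $x,x'\in\mathbb R^d$. Algorithm. Start from $x^1(1)=\dots=x^n(1)\in\Theta$. At each step $t=1,2,\dots$, each agent $i$ draws $\zeta_i(t)$, observes $y_i(t)=f_i(x^i(t)+h_t\zeta_i(t))+\xi_i(t)$ and $y_i'(t)=f_i(x^i(t)-h_t\zeta_i(t))+\xi_i'(t)$, and forms $g^i(t)=\frac d{2h_t}(y_i(t)-y_i'(t))\zeta_i(t)$. Then $x^i(t+1)=\sum_{k=1}^nW_{ik}\,\mathrm{Proj}_\Theta\big(x^k(t)-\eta_tg^k(t)\big)$, $i=1,\dots,n$. The random vectors $\zeta_i(t)$, $1\le i\le n$,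 $1\le t\le T$, are i.i.d. uniformly distributed on the unit Euclidean sphere of $\mathbb R^d$. Noise assumption. Let $\mathcal F_t$ be the $\sigma$-algebra generated by $x^1(t),\dots,x^n(t)$. For all $t$ and $i$: (i) $\zeta_i(t)$ is independent of $\xi_i(t),\xi_i'(t)$ and of $\mathcal F_t$; (ii) $\mathbb E[(\xi_i(t))^2]\le\sigma^2$ and $\mathbb E[(\xi_i'(t))^2]\le\sigma^2$. The noises need not have zero mean nor be independent of each other. Constants: ''independent of $T,d,\alpha,n,\rho$'' means that the constant may depend only on the remaining parameters $L,\bar L,\sigma,G,\mathcal K$. *)

(* Defs.v *)
From HB Require Import structures.
From mathcomp Require Import all_boot all_order all_algebra.
From mathcomp Require Import all_classical all_reals all_analysis.
Set Implicit Arguments.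
Unset Strict Implicit.
Unset Printing Implicit Defensive.
Import Order.TTheory GRing.Theory Num.Theory.
Import numFieldNormedType.Exports.
Local Open Scope classical_set_scope.
Local Open Scope ring_scope.

(* Vectors of R^d are row vectors 'rV[R]_d. The library norm `|x| on 'rV[R]_d is
   the sup norm, hence [enorm] below; the topology (so [open], [compact],
   [differentiable], 'D_v) is the same for both norms. *)

HB.instance Definition _ (R : realType) (d : nat) :=
  @isMeasurable.Build (sigma_display (@open 'rV[R]_d)) 'rV[R]_d
    <<s @open 'rV[R]_d >> (@sigma_algebra0 _ setT _) (@sigma_algebraC _ _)
    (@sigma_algebra_bigcup _ setT _).

Section Euclidean.
Context {R : realType} {d : nat}.
Implicit Types (x y z : 'rV[R]_d) (A : set 'rV[R]_d) (F : 'rV[R]_d -> R).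

Definition dotp x y : R := \sum_j x 0 j * y 0 j.

Definition enorm x : R := Num.sqrt (dotp x x).

Definition diam A : \bar R :=
  ereal_sup [set (enorm (p.1 - p.2))%:E | p in A `*` A].

(* The value is the chosen nearest point, or 0 if there is none; for A nonempty,
   closed and convex there is exactly one. *)
Definition proj A x : 'rV[R]_d :=
  xget 0 [set p | A p /\ forall q, A q -> enorm (x - p) <= enorm (x - q)].

Definition grad F x : 'rV[R]_d := \row_j 'D_(delta_mx 0 j) F x.

Definition is_minimizer F A x : Prop := A x /\ forall y, A y -> F x <= F y.

Definition class_F2 (L : R) F : Prop :=
  (forall x, differentiable F x) /\
  (forall x z, `|F z - F x - dotp (grad F x) (z - x)| <= L * enorm (z - x) ^+ 2).

Definition smooth2 (Lbar : R) F : Prop :=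
  (forall x, differentiable F x) /\
  (forall x x', enorm (grad F x - grad F x') <= Lbar * enorm (x - x')).

Definition strongly_convex (alpha : R) F : Prop :=
  (forall x, differentiable F x) /\
  (forall x x', F x - F x' >=
     dotp (grad F x') (x - x') + alpha / 2 * enorm (x - x') ^+ 2).

(* The uniform distribution on the sphere, as the (unique) Borel probability
   measure carried by the unit sphere and invariant under all orthogonal
   transformations. *)
Definition uniform_on_sphere (mu : probability 'rV[R]_d R) : Prop :=
  mu [set u | enorm u = 1] = 1%E /\
  forall Q : 'M[R]_d, Q *m Q^T = 1%:M ->
    forall A, measurable A -> mu ((fun u => u *m Q) @^-1` A) = mu A.

End Euclidean.

Section Matrices.
Context {R : realType} {n : nat}.

(* The operator norm induced by the Euclidean norm: x *m A^T is the row vector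
   (A x^T)^T. *)
Definition spectral_norm (A : 'M[R]_n) : R :=
  sup [set enorm (x *m A^T) | x in [set x | enorm x <= 1]].

Definition doubly_stochastic (W : 'M[R]_n) : Prop :=
  [/\ forall i j, 0 <= W i j,
      forall i, \sum_j W i j = 1 &
      forall j, \sum_i W i j = 1].

Definition ones : 'cV[R]_n := const_mx 1.

Definition mixing_rate (W : 'M[R]_n) : R :=
  spectral_norm (W - n%:R^-1 *: (ones *m ones^T)).

End Matrices.

Section Probability.
Context {disp : measure_display} {Omega : measurableType disp} {R : realType}.
Variable P : probability Omega R.

Definition sigma_of {disp' : measure_display} {T : measurableType disp'}
    (X : Omega -> T) : set_system Omega :=
  preimage_set_system setT X measurable.

Definition independent_sigma (G H : set_system Omega) : Prop :=
  forall A B, G A -> H B -> P (A `&` B) = (P A * P B)%E.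

Definition iid {disp' : measure_display} {T : measurableType disp'}
    {I : finType} (mu : probability T R) (X : I -> {RV P >-> T}) : Prop :=
  (forall i A, measurable A -> distribution P (X i) A = mu A) /\
  (forall (J : {set I}) (A : I -> set T), (forall i, measurable (A i)) ->
     P (\bigcap_(i in [set i | i \in J]) (X i @^-1` A i)) =
     (\prod_(i in J) P (X i @^-1` A i))%E).

End Probability.

Section Algorithm.
Context {R : realType} {n d : nat}.

Definition average (F : 'I_n -> 'rV[R]_d -> R) (x : 'rV[R]_d) : R :=
  n%:R^-1 * \sum_i F i x.

Definition step_size (alpha : R) (t : nat) : R := (alpha * t%:R)^-1.

Definition perturbation (L sigma alpha : R) (t : nat) : R :=
  ((3 * d%:R ^+ 2 * sigma ^+ 2) /
   (2 * L * alpha * t%:R + 9 * L ^+ 2 * d%:R ^+ 2)) `^ 4^-1.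

Definition grad_estimator (F : 'rV[R]_d -> R) (h : R) (x zeta : 'rV[R]_d)
    (xi xi' : R) : 'rV[R]_d :=
  let y := F (x + h *: zeta) + xi in
  let y' := F (x - h *: zeta) + xi' in
  (d%:R / (2 * h) * (y - y')) *: zeta.

(* Rounds are numbered from 1; [x i t] for t = 0 or t > T.+1 is unconstrained. *)
Definition dzo_iterates {Omega : Type} (T : nat) (Theta : set 'rV[R]_d)
    (W : 'M[R]_n) (F : 'I_n -> 'rV[R]_d -> R) (eta h : nat -> R)
    (zeta : 'I_n -> nat -> Omega -> 'rV[R]_d)
    (xi xi' : 'I_n -> nat -> Omega -> R)
    (x : 'I_n -> nat -> Omega -> 'rV[R]_d) : Prop :=
  [/\ forall i w, Theta (x i 1%N w),
      forall i j w, x i 1%N w = x j 1%N w &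
      forall t, (1 <= t <= T)%N -> forall i w,
        x i t.+1 w = \sum_k W i k *:
          proj Theta (x k t w - eta t *:
            grad_estimator (F k) (h t) (x k t w) (zeta k t w)
              (xi k t w) (xi' k t w))].

Definition agent_mean {Omega : Type} (x : 'I_n -> nat -> Omega -> 'rV[R]_d)
    (t : nat) (w : Omega) : 'rV[R]_d := n%:R^-1 *: \sum_i x i t w.

End Algorithm.

(* The largest integer strictly less than x; see [strict_floorP]. *)
Definition strict_floor {R : realType} (x : R) : int := Num.ceil x - 1.

Lemma strict_floorP (R : realType) (x : R) (m : int) :
  (m%:~R < x) = (m <= strict_floor x).
Proof. by rewrite /strict_floor lerBrDr -ltzD1 ltrD2r -ceil_gt_int. Qed.

Definition tail_average {R : realType} {d : nat} {Omega : Type} (T : nat)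
    (y : nat -> Omega -> 'rV[R]_d) (w : Omega) : 'rV[R]_d :=
  let m := `|strict_floor (T%:R / 2 : R)|%N in
  (T%:R - m%:R)^-1 *: \sum_(m.+1 <= t < T.+1) y t w.

(* Main.v *)
(** Conditionally on the past, the two-point estimator has mean
    (d/h) E[f_i(x + h z) z] for z uniform on the sphere, which by the divergence
    theorem is the gradient of f_i averaged over a ball of radius h.  Only a lower
    bound for the inner products with x - x^* is needed, and it is obtained without
    any volume integral: differentiating E[F(z) z_j] along the rotations of the
    coordinate planes, which leave the law of z invariant, gives an integration by
    parts formula on the sphere, hence a first-order differential inequality in the
    radius for r |-> E[F(r z) <z, v>].

    With V_t the mean squared distance of the agents to x^*, a_t their mean
    deviation from the average, and Q = d^2 + d sqrt(alpha T), this yields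
      a_(t+1) <= rho (a_t + O(Q / (alpha t))),
      2/(alpha t) E[f(xbar_t) - f(x^* )] <= (1 - 1/t) V_t - V_(t+1)
          + O(a_t / (alpha t)) + O(Q / (alpha t)^2).
    The first recursion gives a_t = O(Q / (alpha (1 - rho) t)); strong convexity
    then gives t V_(t+1) = O(Q / (alpha^2 (1 - rho))), and the second inequality
    telescopes over the last half of the rounds, where 1/t <= 2/T. *)

From HB Require Import structures.
Require Import Defs.
From mathcomp Require Import all_boot all_order all_algebra.
From mathcomp Require Import all_classical all_reals all_analysis.
From mathcomp Require Import measurable_realfun ring lra.
Set Implicit Arguments.
Unset Strict Implicit.
Unset Printing Implicit Defensive.
Import Order.TTheory GRing.Theory Num.Theory.
Import numFieldNormedType.Exports.
Local Open Scope classical_set_scope.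
Local Open Scope ring_scope.

(** Strong convexity is assumed for the average only: a single [f i] need not be convex, and each
    agent evaluates its own [f i] at its own point. The radial inequality is therefore run for the
    sum over all agents at once, each with its own test vector. Expectations see only the law of
    each direction separately, so one common direction can serve all agents in that sum. The noise
    enters as (d / 2h) (xi - xi') zeta and is averaged out by [zeta], which is symmetric in law and
    independent of noise and past jointly. The perturbation h balances the bias alpha t h^2 against
    the variance d^2 / h^2: both are O(Q) for every t <= T, and Q / (alpha T) is the announced rate.
    The factor 1 - 1/t alone would give t V_(t+1) <= (t - 1) V_t + O(1/t), hence a logarithm after
    summation. The quadratic growth of the gap improves t - 1 to t - 3/2, which removes it. *)

Section EuclideanFacts.
Context {R : realType} {d : nat}.
Implicit Types (x y z : 'rV[R]_d) (a : R).

(** * Inner product and Euclidean norm *)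

Lemma dotpC x y : dotp x y = dotp y x.
Proof. by apply: eq_bigr => j _; rewrite mulrC. Qed.

Lemma dotpDl x y z : dotp (x + y) z = dotp x z + dotp y z.
Proof. by rewrite /dotp -big_split; apply: eq_bigr => j _; rewrite mxE mulrDl. Qed.

Lemma dotpDr x y z : dotp z (x + y) = dotp z x + dotp z y.
Proof. by rewrite dotpC dotpDl !(dotpC z). Qed.

Lemma dotpZl a x y : dotp (a *: x) y = a * dotp x y.
Proof. by rewrite /dotp mulr_sumr; apply: eq_bigr => j _; rewrite mxE mulrA. Qed.

Lemma dotpZr a x y : dotp x (a *: y) = a * dotp x y.
Proof. by rewrite dotpC dotpZl dotpC. Qed.

Lemma dotpNl x y : dotp (- x) y = - dotp x y.
Proof. by rewrite -scaleN1r dotpZl mulN1r. Qed.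

Lemma dotpNr x y : dotp x (- y) = - dotp x y.
Proof. by rewrite dotpC dotpNl dotpC. Qed.

Lemma dotpBl x y z : dotp (x - y) z = dotp x z - dotp y z.
Proof. by rewrite dotpDl dotpNl. Qed.

Lemma dotpBr x y z : dotp z (x - y) = dotp z x - dotp z y.
Proof. by rewrite dotpDr dotpNr. Qed.

Lemma dotp0l x : dotp 0 x = 0.
Proof. by rewrite -(scale0r 0) dotpZl mul0r. Qed.

Lemma dotp0r x : dotp x 0 = 0.
Proof. by rewrite dotpC dotp0l. Qed.

Lemma dotp_suml (I : Type) (r : seq I) (p : pred I) (v : I -> 'rV[R]_d) x :
  dotp (\sum_(i <- r | p i) v i) x = \sum_(i <- r | p i) dotp (v i) x.
Proof. by apply: (big_morph (dotp^~ x)) => [u v'|]; rewrite ?dotpDl ?dotp0l. Qed.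

Lemma dotp_ge0 x : 0 <= dotp x x.
Proof. by apply: sumr_ge0 => j _; rewrite -expr2 sqr_ge0. Qed.

Lemma enorm_ge0 x : 0 <= enorm x.
Proof. exact: sqrtr_ge0. Qed.

Lemma sqr_enorm x : enorm x ^+ 2 = dotp x x.
Proof. by rewrite sqr_sqrtr // dotp_ge0. Qed.

Lemma enorm_eq0 x : enorm x = 0 -> x = 0.
Proof.
move=> x0; have : dotp x x = 0 by rewrite -sqr_enorm x0 expr0n.
move/eqP; rewrite psumr_eq0 => [/allP h|j _]; last by rewrite -expr2 sqr_ge0.
apply/rowP => j; rewrite mxE; apply/eqP.
by have := h j (mem_index_enum j); rewrite mulf_eq0 orbb.
Qed.

Lemma enorm0 : enorm (0 : 'rV[R]_d) = 0.
Proof. by rewrite /enorm dotp0l sqrtr0. Qed.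

Lemma enormN x : enorm (- x) = enorm x.
Proof. by rewrite /enorm dotpNl dotpNr opprK. Qed.

Lemma enormBC x y : enorm (x - y) = enorm (y - x).
Proof. by rewrite -enormN opprB. Qed.

Lemma enormZ a x : enorm (a *: x) = `|a| * enorm x.
Proof. by rewrite /enorm dotpZl dotpZr mulrA -expr2 sqrtrM ?sqr_ge0// sqrtr_sqr. Qed.

Lemma sqr_enormD x y :
  enorm (x + y) ^+ 2 = enorm x ^+ 2 + 2 * dotp x y + enorm y ^+ 2.
Proof. by rewrite !sqr_enorm dotpDl !dotpDr (dotpC y x); ring. Qed.

Lemma sqr_enormB x y :
  enorm (x - y) ^+ 2 = enorm x ^+ 2 - 2 * dotp x y + enorm y ^+ 2.
Proof. by rewrite sqr_enormD dotpNr enormN; ring. Qed.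

(** Expand the square of [enorm y *: x - enorm x *: y] and divide by 2 |x| |y|; the degenerate cases
    are set aside to allow the division. *)
Lemma dotp_le x y : dotp x y <= enorm x * enorm y.
Proof.
have [x0|x0] := eqVneq (enorm x) 0; first by rewrite (enorm_eq0 x0) dotp0l enorm0 mul0r.
have [y0|y0] := eqVneq (enorm y) 0; first by rewrite (enorm_eq0 y0) dotp0r enorm0 mulr0.
have xp : 0 < enorm x by rewrite lt_neqAle eq_sym x0 enorm_ge0.
have yp : 0 < enorm y by rewrite lt_neqAle eq_sym y0 enorm_ge0.
have := sqr_ge0 (enorm (enorm y *: x - enorm x *: y)).
rewrite sqr_enormB dotpZl dotpZr !enormZ !ger0_norm ?enorm_ge0// => h.
have {h} : 0 <= 2 * (enorm x * enorm y) * (enorm x * enorm y - dotp x y).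
  by apply: le_trans h _; rewrite le_eqVlt; apply/orP; left; apply/eqP; ring.
by rewrite pmulr_rge0 ?subr_ge0// !mulr_gt0.
Qed.

Lemma norm_dotp_le x y : `|dotp x y| <= enorm x * enorm y.
Proof. by rewrite ler_norml dotp_le lerNl -dotpNl -(enormN x) dotp_le. Qed.

Lemma enormD x y : enorm (x + y) <= enorm x + enorm y.
Proof.
rewrite -(ler_pXn2r (n := 2)) ?nnegrE ?addr_ge0 ?enorm_ge0//.
by rewrite sqr_enormD; have := dotp_le x y; nra.
Qed.

Lemma enormB x y : enorm (x - y) <= enorm x + enorm y.
Proof. by rewrite -(enormN y) enormD. Qed.

Lemma enormB_trans x y z : enorm (x - z) <= enorm (x - y) + enorm (y - z).
Proof. by have := enormD (x - y) (y - z); rewrite addrA subrK. Qed.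

Lemma norm_coord_le x j : `|x 0 j| <= enorm x.
Proof.
rewrite -sqrtr_sqr ler_sqrt ?dotp_ge0// /dotp (bigD1 j)//= -expr2 lerDl.
by apply: sumr_ge0 => k _; rewrite -expr2 sqr_ge0.
Qed.

Lemma dotp_delta x j : dotp x (delta_mx 0 j) = x 0 j.
Proof.
rewrite /dotp (bigD1 j)//= mxE !eqxx mulr1 big1 ?addr0// => k kj.
by rewrite mxE eqxx (negbTE kj) mulr0.
Qed.

Lemma enorm_delta (j : 'I_d) : enorm (delta_mx 0 j : 'rV[R]_d) = 1.
Proof. by rewrite /enorm dotp_delta mxE !eqxx sqrtr1. Qed.

Lemma enorm_le_sum x : enorm x <= \sum_j `|x 0 j|.
Proof.
rewrite -(ler_pXn2r (n := 2)) ?nnegrE ?enorm_ge0 ?sumr_ge0// sqr_enorm.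
rewrite expr2 mulr_suml; apply: ler_sum => j _.
rewrite -expr2 -real_normK ?num_real// expr2 ler_wpM2l//.
by rewrite (bigD1 j)//= lerDl sumr_ge0.
Qed.

End EuclideanFacts.

(** * Borel measurability of vector-valued functions *)

Section RowVectorMeasurability.
Context {R : realType} {d : nat}.

Lemma open_measurable_rV (A : set 'rV[R]_d) : open A -> measurable A.
Proof. by move=> oA; exact: sub_sigma_algebra. Qed.

Lemma continuous_measurable_rV (F : 'rV[R]_d -> R) :
  continuous F -> measurable_fun setT F.
Proof.
move=> cF; apply: (measurability _ (RGenOpens.measurableE R)).
move=> _ [_ [a [b ->] <-]]; rewrite setTI; apply: open_measurable_rV.
by move/continuousP: cF; apply; exact: interval_open.
Qed.

Lemma coord_measurable (j : 'I_d) : measurable_fun setT (fun x : 'rV[R]_d => x 0 j).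
Proof. by apply: continuous_measurable_rV; exact: coord_continuous. Qed.

(** Cubes with rational centre and half-side 1/(k+1) form a countable base of the topology.
    Countability is what turns measurability of all coordinates into measurability for the
    sigma-algebra generated by the open sets. *)
Let cube (c : 'rV[rat]_d) (k : nat) : set 'rV[R]_d :=
  [set y | forall j, `|y 0 j - ratr (c 0 j)| < k.+1%:R^-1].

Lemma open_bigcup_cube (A : set 'rV[R]_d) : open A ->
  A = \bigcup_p (if `[< cube p.1 p.2 `<=` A >] then cube p.1 p.2 else set0).
Proof.
move=> oA; apply/seteqP; split; last first.
  by move=> x [[c k] _] /=; case: asboolP => // s /s.
move=> x Ax; have : nbhs x A by apply: open_nbhs_nbhs.
move=> /nbhs_ballP[e /= e0 eA].
have e20 : 0 < e / 2 by rewrite divr_gt0.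
have [k hk] : exists k : nat, k.+1%:R^-1 < e / 2.
  by have := near_infty_natSinv_lt (PosNum e20) => -[N _ /(_ N (leqnn N))] /= ?; exists N.
have hc j : exists q : rat, `|x 0 j - ratr q| < k.+1%:R^-1.
  have k0 : 0 < k.+1%:R^-1 :> R by rewrite invr_gt0 ltr0n.
  have [q] := rat_in_itvoo (ltr_pwDr k0 (lexx (x 0 j))).
  by rewrite in_itv/= => /andP[q1 q2]; exists q; rewrite ltr_distl ltrBlDr q2 ltr_wpDr ?ltW.
have /choice[c {}hc] := hc.
exists (\row_j c j, k) => //=.
rewrite ifT; first by move=> j; rewrite mxE.
apply/asboolP => y hy; apply: eA; split=> // i j; rewrite ord1 -ball_normE /=.
have := hy j; have := hc j; rewrite mxE.
have -> : x 0 j - y 0 j = (x 0 j - ratr (c j)) - (y 0 j - ratr (c j)) by ring.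
move=> h1 h2; apply: le_lt_trans (ler_normB _ _) _.
by apply: lt_trans (ltrD h1 h2) _; rewrite [ltRHS]splitr ltrD.
Qed.

Context {disp : measure_display} {S : measurableType disp}.

Lemma measurable_fun_rV (g : S -> 'rV[R]_d) :
  (forall j, measurable_fun setT (fun w => g w 0 j)) -> measurable_fun setT g.
Proof.
move=> mg; have gen : @measurable _ 'rV[R]_d = <<s @open 'rV[R]_d >> by [].
apply: (measurability _ gen) => _ [A oA <-]; rewrite setTI (open_bigcup_cube oA) preimage_bigcup.
apply: countable_bigcupT_measurable => [|[c k]]; first exact: countableP.
case: asboolP => _ /=; last by rewrite preimage_set0.
rewrite (_ : _ @^-1` _ =
    \bigcap_(j in [set: 'I_d]) ((fun w => g w 0 j) @^-1` [set r | `|r - ratr (c 0 j)| < k.+1%:R^-1])).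
  apply: fin_bigcap_measurable => // j _.
  rewrite -[X in measurable X]setTI; apply: mg => //.
  apply: open_measurable; rewrite (_ : [set r | _] = ball (ratr (c 0 j) : R) (k.+1%:R^-1)).
    exact: ball_open.
  by apply/seteqP; split=> r /=; rewrite -ball_normE /= distrC.
by apply/seteqP; split=> [w h j _ |w h j]; [exact: h|exact: (h j)].
Qed.

Lemma measurable_coord (g : S -> 'rV[R]_d) j :
  measurable_fun setT g -> measurable_fun setT (fun w => g w 0 j).
Proof. by move=> mg; exact: (measurableT_comp (coord_measurable j) mg). Qed.

Lemma measurable_comp_continuous (F : 'rV[R]_d -> R) (g : S -> 'rV[R]_d) :
  continuous F -> measurable_fun setT g -> measurable_fun setT (fun w => F (g w)).
Proof. by move=> cF mg; exact: (measurableT_comp (continuous_measurable_rV cF) mg). Qed.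

Lemma measurable_addv (g h : S -> 'rV[R]_d) : measurable_fun setT g ->
  measurable_fun setT h -> measurable_fun setT (fun w => g w + h w).
Proof.
move=> mg mh; apply: measurable_fun_rV => j.
under eq_fun do rewrite mxE.
by apply: measurable_funD; exact: measurable_coord.
Qed.

Lemma measurable_scalev (a : S -> R) (g : S -> 'rV[R]_d) : measurable_fun setT a ->
  measurable_fun setT g -> measurable_fun setT (fun w => a w *: g w).
Proof.
move=> ma mg; apply: measurable_fun_rV => j.
under eq_fun do rewrite mxE.
by apply: measurable_funM => //; exact: measurable_coord.
Qed.

Lemma measurable_subv (g h : S -> 'rV[R]_d) : measurable_fun setT g ->
  measurable_fun setT h -> measurable_fun setT (fun w => g w - h w).
Proof.
move=> mg mh; apply: measurable_fun_rV => j.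
under eq_fun do rewrite !mxE.
by apply: measurable_funB; exact: measurable_coord.
Qed.

Lemma measurable_sumv (I : Type) (r : seq I) (g : I -> S -> 'rV[R]_d) :
  (forall i, measurable_fun setT (g i)) ->
  measurable_fun setT (fun w => \sum_(i <- r) g i w).
Proof.
move=> mg; apply: measurable_fun_rV => j.
under eq_fun do rewrite summxE.
by apply: measurable_sum => i; exact: measurable_coord.
Qed.

Lemma measurable_dotp (g h : S -> 'rV[R]_d) : measurable_fun setT g ->
  measurable_fun setT h -> measurable_fun setT (fun w => dotp (g w) (h w)).
Proof.
move=> mg mh; apply: measurable_sum => j.
by apply: measurable_funM; exact: measurable_coord.
Qed.

Lemma measurable_enorm (g : S -> 'rV[R]_d) : measurable_fun setT g ->
  measurable_fun setT (fun w => enorm (g w)).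
Proof.
move=> mg; apply: (measurableT_comp (f := @Num.sqrt R)); last exact: measurable_dotp.
by apply: continuous_measurable_fun; exact: sqrt_continuous.
Qed.

End RowVectorMeasurability.

Lemma measurable_comp_continuousv {R : realType} {d : nat} {disp : measure_display}
    {S : measurableType disp} (p : 'rV[R]_d -> 'rV[R]_d) (g : S -> 'rV[R]_d) :
  (forall j, continuous (fun x => p x 0 j)) -> measurable_fun setT g ->
  measurable_fun setT (fun w => p (g w)).
Proof.
by move=> cp mg; apply: measurable_fun_rV => j; exact: (measurable_comp_continuous (cp j) mg).
Qed.

(** The hypothesis is Euclidean while neighbourhoods come from the sup norm. The Euclidean norm is
    at most d times the sup norm, hence the radius [m / (d + 1)], which also makes sense for d =
    0. *)
Lemma locally_lipschitz_continuous {R : realType} {d : nat} (F : 'rV[R]_d -> R) :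
  (forall x, exists C : R, forall z, enorm (z - x) <= 1 -> `|F z - F x| <= C * enorm (z - x)) ->
  continuous F.
Proof.
move=> lF x; have [C hC] := lF x.
apply: (@cvgrPdist_le _ _ _ (nbhs x) _ F (F x)).2 => e e0; apply/nbhs_ballP.
have C0 : 0 < `|C| + 1 by rewrite ltr_wpDl.
set m := Num.min 1 (e / (`|C| + 1)).
have m0 : 0 < m by rewrite lt_min ltr01 divr_gt0.
have d0 : 0 < d%:R + 1 :> R by rewrite ltr_wpDl.
exists (m / (d%:R + 1)) => /=; first by rewrite divr_gt0.
move=> z [_ hz].
have hn : enorm (z - x) <= m.
  apply: le_trans (enorm_le_sum _) _.
  apply: (@le_trans _ _ (\sum_(j < d) m / (d%:R + 1))).
    apply: ler_sum => j _; rewrite !mxE distrC.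
    by have := hz 0 j; rewrite -ball_normE /= => /ltW.
  rewrite sumr_const card_ord -[leLHS]mulr_natl mulrCA ger_pMr// ler_pdivrMr// mul1r lerDl.
  exact: ler01.
rewrite distrC (le_trans (hC z _))// ?(le_trans hn) ?ge_min ?lexx//.
apply: (@le_trans _ _ ((`|C| + 1) * enorm (z - x))).
  by rewrite ler_wpM2r ?enorm_ge0// ler_wpDr// ler_norm.
by rewrite mulrC -ler_pdivlMr// (le_trans hn)// ge_min lexx orbT.
Qed.

(** * Real-valued integrals against a probability *)

Section RealIntegrals.
Context {disp : measure_display} {T : measurableType disp} {R : realType}.
Variable P : probability T R.
Implicit Types (f g : T -> R) (D : set T).

(** Side condition of the linearity and monotonicity rules below: the real-valued integral is the
    [fine] part of the extended one, which sends an infinite value to 0. *)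
Definition has_mean f : Prop := P.-integrable setT (EFin \o f).

Lemma has_mean_measurable f : has_mean f -> measurable_fun setT f.
Proof. by move=> /measurable_int mf; exact: (measurable_EFinP _ _).1 mf. Qed.

Lemma has_mean_cst (c : R) : has_mean (fun=> c).
Proof. exact: finite_measure_integrable_cst. Qed.

Lemma has_mean_le f g : measurable_fun setT f -> has_mean g ->
  (forall w, `|f w| <= g w) -> has_mean f.
Proof.
move=> mf ig fg; apply: (le_integrable measurableT _ _ ig) => /=.
  exact: (measurable_EFinP _ _).2 mf.
by move=> w _; rewrite lee_fin (le_trans (fg w))// ler_norm.
Qed.

Lemma has_mean_bounded f (M : R) : measurable_fun setT f ->
  (forall w, `|f w| <= M) -> has_mean f.
Proof. by move=> mf fM; apply: (has_mean_le mf (has_mean_cst M)). Qed.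

Lemma has_meanD f g : has_mean f -> has_mean g -> has_mean (fun w => f w + g w).
Proof. by move=> ff gg; exact: (integrableD measurableT ff gg). Qed.

Lemma has_meanZ (c : R) f : has_mean f -> has_mean (fun w => c * f w).
Proof. by move=> ff; exact: (integrableZl measurableT c ff). Qed.

Lemma has_meanN f : has_mean f -> has_mean (fun w => - f w).
Proof.
by move=> /(has_meanZ (-1)); congr has_mean; apply/funext => w; rewrite mulN1r.
Qed.

Lemma has_meanB f g : has_mean f -> has_mean g -> has_mean (fun w => f w - g w).
Proof. by move=> ff /has_meanN; exact: has_meanD. Qed.

Lemma has_mean_sum (I : Type) (r : seq I) (F : I -> T -> R) :
  (forall i, has_mean (F i)) -> has_mean (fun w => \sum_(i <- r) F i w).
Proof.
move=> sF; elim: r => [|i r IH].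
  by under eq_fun do rewrite big_nil; exact: has_mean_cst.
by under eq_fun do rewrite big_cons; exact: has_meanD.
Qed.

Lemma RintD f g : has_mean f -> has_mean g ->
  \int[P]_w (f w + g w) = \int[P]_w f w + \int[P]_w g w.
Proof. by move=> ff gg; exact: RintegralD. Qed.

Lemma RintZ (c : R) f : has_mean f -> \int[P]_w (c * f w) = c * \int[P]_w f w.
Proof. by move=> ff; exact: RintegralZl. Qed.

Lemma RintB f g : has_mean f -> has_mean g ->
  \int[P]_w (f w - g w) = \int[P]_w f w - \int[P]_w g w.
Proof. by move=> ff gg; exact: RintegralB. Qed.

Lemma Rint_cst (c : R) : \int[P]_w c = c.
Proof.
have PT : fine (P setT) = 1 by rewrite probability_setT.
by rewrite Rintegral_cst// -[RHS]mulr1; congr (_ * _).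
Qed.

Lemma Rint_sum (I : Type) (r : seq I) (F : I -> T -> R) :
  (forall i, has_mean (F i)) ->
  \int[P]_w (\sum_(i <- r) F i w) = \sum_(i <- r) \int[P]_w F i w.
Proof.
move=> sF; elim: r => [|i r IH].
  by rewrite big_nil; under eq_Rintegral do rewrite big_nil; exact: Rint_cst.
rewrite big_cons -IH -RintD//; last exact: has_mean_sum.
by under eq_Rintegral do rewrite big_cons.
Qed.

(** That sampled directions have norm 1 is known only on an event of probability one; naming that
    event [D] keeps almost-everywhere quantifiers out of the later statements. *)
Lemma Rint_eq_full D f g : measurable D -> P D = 1%E ->
  measurable_fun setT f -> measurable_fun setT g ->
  (forall w, D w -> f w = g w) -> \int[P]_w f w = \int[P]_w g w.
Proof.
move=> mD PD mf mg fg; have PDC : P (~` D) = 0%E by rewrite probability_setC// PD subee.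
congr fine; apply: ae_eq_integral => //.
- exact: (measurable_EFinP _ _).2 mf.
- exact: (measurable_EFinP _ _).2 mg.
- exists (~` D); split => //; first exact: measurableC.
  by move=> w /= h Dw; apply: h => _; rewrite /= fg.
Qed.

Lemma Rint_ge0_full D f : measurable D -> P D = 1%E -> has_mean f ->
  (forall w, D w -> 0 <= f w) -> 0 <= \int[P]_w f w.
Proof.
move=> mD PD sf f0; have mf := has_mean_measurable sf.
rewrite (@Rint_eq_full D f (fun w => Num.max 0 (f w)))//.
- by apply: Rintegral_ge0 => w _; rewrite le_max lexx.
- by apply: measurable_maxr => //; exact: measurable_cst.
- by move=> w /f0 ?; apply/esym/max_idPr.
Qed.

Lemma Rint_le_full D f g : measurable D -> P D = 1%E -> has_mean f -> has_mean g ->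
  (forall w, D w -> f w <= g w) -> \int[P]_w f w <= \int[P]_w g w.
Proof.
move=> mD PD sf sg fg; rewrite -subr_ge0 -RintB//.
by apply: (Rint_ge0_full mD PD) => [|w /fg]; [exact: has_meanB|rewrite subr_ge0].
Qed.

Lemma Rint_le f g : has_mean f -> has_mean g ->
  (forall w, f w <= g w) -> \int[P]_w f w <= \int[P]_w g w.
Proof.
by move=> sf sg fg; apply: (Rint_le_full measurableT) => //; exact: probability_setT.
Qed.

Lemma norm_Rint_le f (M : R) : measurable_fun setT f -> (forall w, `|f w| <= M) ->
  `|\int[P]_w f w| <= M.
Proof.
move=> mf fM; have sf := has_mean_bounded mf fM; rewrite ler_norml; apply/andP; split.
  rewrite -[leLHS]Rint_cst; apply: Rint_le => // [|w]; first exact: has_mean_cst.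
  by have := fM w; rewrite ler_norml => /andP[].
rewrite -[leRHS]Rint_cst; apply: Rint_le => // [|w]; first exact: has_mean_cst.
by have := fM w; rewrite ler_norml => /andP[].
Qed.

Lemma EFin_Rint f : has_mean f -> (\int[P]_w (f w)%:E)%E = (\int[P]_w f w)%:E.
Proof. by move=> sf; rewrite /Rintegral fineK//; exact: integrable_fin_num sf. Qed.

End RealIntegrals.

(** * Integrating out a variable that is independent of a sigma-algebra *)

Section Independence.
Context {disp : measure_display} {T : measurableType disp} {R : realType}.
Context {disp' : measure_display} {U : measurableType disp'}.
Variables (P : probability T R) (mu : probability U R) (zeta : {RV P >-> U}).
Variable C : set_system T.
Hypothesis Cmeas : forall A, C A -> measurable A.
Hypothesis zeta_law : forall A, measurable A -> P (zeta @^-1` A) = mu A.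
Hypothesis indep : independent_sigma P (sigma_of zeta) <<s C >>.

(** The same carrier as [T] with the smaller sigma-algebra generated by [C]. Independence says that
    w |-> (zeta w, w), with values in [U * S], has the product law, so that Fubini applies without
    listing the variables through which [H] depends on w. *)
Let S := g_sigma_algebraType C.
Let toS : T -> S := id.

Let measurable_toS : measurable_fun setT toS.
Proof.
move=> _ A mA; rewrite setTI.
have : <<s C >> `<=` @measurable _ T.
  by apply: smallest_sub => //; exact: sigma_algebra_measurable.
by apply; exact: mA.
Qed.

Lemma g_sigma_measurable_fun (disp2 : measure_display) (V : measurableType disp2) (f : T -> V) :
  measurable_fun setT (f : S -> V) -> measurable_fun setT f.
Proof. by move=> mf; exact: (measurableT_comp mf measurable_toS). Qed.

Let pairS (w : T) : U * S := (zeta w, toS w).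

Let measurable_pairS : measurable_fun setT pairS.
Proof. by apply: measurable_fun_pair => //; exact: measurable_funPT. Qed.

HB.instance Definition _ := isMeasurableFun.Build _ _ _ _ toS measurable_toS.
HB.instance Definition _ := isMeasurableFun.Build _ _ _ _ pairS measurable_pairS.

Let Q : probability S R := distribution P (toS : {RV P >-> S}).
Let joint : probability (U * S)%type R := distribution P (pairS : {RV P >-> (U * S)%type}).

Let jointE (X : set (U * S)) : measurable X -> (mu \x Q)%E X = joint X.
Proof.
move=> mX; apply: product_measure_unique => // A B mA mB.
have : P ((zeta @^-1` A) `&` B) = (mu A * P B)%E.
  rewrite indep; first by rewrite zeta_law.
    by exists A => //; rewrite setTI.
  exact: mB.
exact.
Qed.

Variables (H : U -> T -> R) (B : T -> R).
Hypothesis measurable_H : measurable_fun setT (fun p : U * S => H p.1 p.2).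
Hypothesis H_le : forall z w, `|H z w| <= B w.
Hypothesis B_mean : has_mean P B.

Lemma independent_has_mean : has_mean P (fun w => H (zeta w) w).
Proof.
apply: (has_mean_le _ B_mean) => [|w]; last exact: H_le.
exact: (measurableT_comp measurable_H measurable_pairS).
Qed.

Let measurable_section w : measurable_fun setT (fun z => H z w).
Proof.
have mp : measurable_fun setT (fun z : U => (z, w : S)).
  by apply: measurable_fun_pair => //; exact: measurable_cst.
exact: (measurableT_comp measurable_H mp).
Qed.

Let sectionE w : (\int[mu]_z (H z w)%:E)%E = (\int[mu]_z H z w)%:E.
Proof.
have sm : has_mean mu (fun z => H z w).
  by apply: (@has_mean_bounded _ _ _ _ _ (B w)) => [|z]; [exact: measurable_section|exact: H_le].
exact: (EFin_Rint sm).
Qed.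

Let integrable_joint : (mu \x Q)%E.-integrable setT (fun p : U * S => (H p.1 p.2)%:E).
Proof.
have mE : measurable_fun setT (fun p : U * S => (H p.1 p.2)%:E).
  exact: (measurable_EFinP _ _).2 measurable_H.
have : joint.-integrable setT (fun p : U * S => (H p.1 p.2)%:E).
  apply: integrable_pushforward => //; exact: independent_has_mean.
move=> /integrableP[_ h]; apply/integrableP; split => //.
by rewrite (eq_measure_integral joint)// => A mA _; exact: jointE.
Qed.

Let measurable_mean : measurable_fun setT (fun w : S => (\int[mu]_z H z w)%:E).
Proof.
have := measurable_fubini_G integrable_joint.
by congr (measurable_fun setT _); apply/funext => w; exact: sectionE.
Qed.

Lemma independent_mean_has_mean : has_mean P (fun w => \int[mu]_z H z w).
Proof.
apply: (has_mean_le _ B_mean) => [|w].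
  by apply: g_sigma_measurable_fun; exact: (measurable_EFinP _ _).1 measurable_mean.
have h z : `|H z w| <= B w by exact: H_le.
exact: (@norm_Rint_le _ _ _ mu (fun z => H z w) (B w) (measurable_section w) h).
Qed.

(** Both sides are the integral of [H] under the joint law, by change of variables on the left and
    Fubini on the right. Since [B] does not involve z, every section of [H] is bounded, so the inner
    integral is finite for every w and not just almost every w. *)
Lemma Rint_independent :
  \int[P]_w H (zeta w) w = \int[P]_w (\int[mu]_z H z w).
Proof.
congr fine.
have -> : (\int[P]_w (H (zeta w) w)%:E)%E = (\int[joint]_p (H p.1 p.2)%:E)%E.
  rewrite integral_pushforward//; last exact: independent_has_mean.
  exact: (measurable_EFinP _ _).2 measurable_H.
rewrite -(eq_measure_integral joint (m1 := (mu \x Q)%E)); last by move=> A mA _; exact: jointE.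
rewrite -(integral21_prod_meas1 integrable_joint) /fubini_G.
transitivity (\int[Q]_w (\int[mu]_z H z w)%:E)%E.
  by apply: eq_integral => w _; exact: sectionE.
rewrite integral_pushforward//; exact: independent_mean_has_mean.
Qed.

End Independence.

(** * Orthogonal maps and plane rotations acting on the sphere *)

Section Sphere.
Context {R : realType} {d : nat}.
Implicit Types (x y z v : 'rV[R]_d).

(* The uniform law is carried by the unit sphere only almost surely; precomposing
   with [on_sphere] keeps all integrands bounded everywhere. *)
Definition on_sphere z : 'rV[R]_d := if enorm z == 1 then z else 0.

Lemma on_sphereE z : enorm z = 1 -> on_sphere z = z.
Proof. by rewrite /on_sphere => ->; rewrite eqxx. Qed.

Lemma enorm_on_sphere_le z : enorm (on_sphere z) <= 1.
Proof. by rewrite /on_sphere; case: eqP => [->|_]; rewrite ?enorm0 ?lexx ?ler01. Qed.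

Lemma dotp_mul (Q : 'M[R]_d) x y : Q *m Q^T = 1%:M -> dotp (x *m Q) (y *m Q) = dotp x y.
Proof.
have dE u w : dotp u w = (u *m w^T) 0 0.
  by rewrite mxE; apply: eq_bigr => j _; rewrite mxE.
by move=> h; rewrite !dE trmx_mul mulmxA -(mulmxA x) h mulmx1.
Qed.

Lemma enorm_mul (Q : 'M[R]_d) x : Q *m Q^T = 1%:M -> enorm (x *m Q) = enorm x.
Proof. by move=> h; rewrite /enorm dotp_mul. Qed.

Lemma on_sphere_mul (Q : 'M[R]_d) z : Q *m Q^T = 1%:M -> on_sphere (z *m Q) = on_sphere z *m Q.
Proof. by move=> h; rewrite /on_sphere enorm_mul//; case: ifP => // _; rewrite mul0mx. Qed.

Lemma measurable_eq1_enorm : measurable [set z : 'rV[R]_d | enorm z = 1].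
Proof.
have := measurable_enorm (@measurable_id _ 'rV[R]_d setT) measurableT (measurable_set1 1).
by rewrite setTI.
Qed.

Lemma measurable_on_sphere : measurable_fun setT on_sphere.
Proof.
apply: measurable_fun_ifT; last 2 first.
- exact: measurable_id.
- exact: measurable_cst.
apply: measurable_fun_eqr; last exact: measurable_cst.
by apply: measurable_enorm; exact: measurable_id.
Qed.

Lemma measurable_mulmxr (Q : 'M[R]_d) : measurable_fun setT (fun z : 'rV[R]_d => z *m Q).
Proof.
apply: measurable_fun_rV => j; under eq_fun do rewrite mxE.
by apply: measurable_sum => k; apply: measurable_funM; [exact: coord_measurable|exact: measurable_cst].
Qed.

(** Written as a perturbation of the identity: with c^2 + s^2 = 1 and s small, the [s] term is the
    infinitesimal rotation and the [c - 1] term is of second order. *)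
Definition plane_rotation (i j : 'I_d) (c s : R) : 'M[R]_d :=
  1%:M + (c - 1) *: (delta_mx i i + delta_mx j j) + s *: (delta_mx i j - delta_mx j i).

Lemma dotp_deltal x i : dotp (delta_mx 0 i) x = x 0 i.
Proof. by rewrite dotpC dotp_delta. Qed.

Lemma mul_rV_delta x i j : x *m delta_mx i j = x 0 i *: (delta_mx 0 j : 'rV[R]_d).
Proof.
apply/rowP => k; rewrite !mxE (bigD1 i)//= big1 ?addr0 => [|l li].
  by rewrite !mxE eqxx.
by rewrite mxE (negbTE li) mulr0.
Qed.

Lemma mul_plane_rotation x i j c s : x *m plane_rotation i j c s =
  x + s *: (x 0 i *: delta_mx 0 j - x 0 j *: delta_mx 0 i)
    + (c - 1) *: (x 0 i *: delta_mx 0 i + x 0 j *: delta_mx 0 j).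
Proof.
rewrite /plane_rotation !mulmxDr mulmx1 -!scalemxAr mulmxDr mulmxBr !mul_rV_delta.
by rewrite addrAC.
Qed.

(** Expanding the inner product of two images leaves [dotp x y] plus a multiple of s^2 + c^2 - 1;
    evaluating on basis vectors then gives the matrix identity. *)
Lemma plane_rotation_orthogonal i j c s : i != j -> c ^+ 2 + s ^+ 2 = 1 ->
  plane_rotation i j c s *m (plane_rotation i j c s)^T = 1%:M.
Proof.
move=> ij cs.
have iso x y : dotp (x *m plane_rotation i j c s) (y *m plane_rotation i j c s) = dotp x y.
  rewrite !mul_plane_rotation !(dotpDl, dotpDr, dotpZl, dotpZr, dotpNl, dotpNr).
  rewrite !dotp_delta !dotp_deltal !mxE !eqxx !(eq_sym j i) (negbTE ij) /=.
  move: (dotp x y) (x 0 i) (x 0 j) (y 0 i) (y 0 j) => p a b a' b'.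
  have hs : s ^+ 2 = 1 - c ^+ 2 by rewrite -cs; ring.
  transitivity (p + (a * a' + b * b') * (s ^+ 2 + c ^+ 2 - 1)); first by ring.
  by rewrite hs; ring.
apply/matrixP => k l.
rewrite mxE; transitivity (dotp (delta_mx 0 k : 'rV[R]_d) (delta_mx 0 l)).
  by rewrite -iso /dotp; apply: eq_bigr => m _; rewrite -!rowE !mxE.
by rewrite dotp_delta !mxE eqxx eq_sym.
Qed.

End Sphere.

(** * First-order expansions with quadratic remainder *)

Section SmoothPair.
Context {R : realType} {d : nat}.
Implicit Types (F : 'rV[R]_d -> R) (G : 'rV[R]_d -> 'rV[R]_d).

(** A function together with a candidate gradient, related by inequalities only. Affine
    substitutions and averages preserve the relation by algebra, without differentiation rules. *)
Definition smooth_pair (L Lb : R) F G : Prop :=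
  [/\ 0 <= L, 0 <= Lb,
      forall x z, `|F z - F x - dotp (G x) (z - x)| <= L * enorm (z - x) ^+ 2 &
      forall x z, enorm (G z - G x) <= Lb * enorm (z - x)].

Lemma smooth_pair_affine L Lb F G x (h : R) : smooth_pair L Lb F G ->
  smooth_pair (L * h ^+ 2) (Lb * h ^+ 2)
    (fun u => F (x + h *: u)) (fun u => h *: G (x + h *: u)).
Proof.
case=> L0 Lb0 FG GG.
have e u w : x + h *: w - (x + h *: u) = h *: (w - u).
  by rewrite opprD addrACA subrr add0r scalerBr.
split=> [||u w|u w].
- by rewrite mulr_ge0 ?sqr_ge0.
- by rewrite mulr_ge0 ?sqr_ge0.
- have := FG (x + h *: u) (x + h *: w).
  rewrite e enormZ exprMn real_normK ?num_real//.
  by rewrite dotpZl dotpZr -mulrA.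
- rewrite -scalerBr enormZ.
  have := GG (x + h *: u) (x + h *: w).
  rewrite e enormZ => hh.
  apply: le_trans (ler_wpM2l (normr_ge0 _) hh) _.
  by rewrite -[in leRHS](real_normK (num_real h)) !mulrA (mulrC _ Lb) -mulrA.
Qed.

Lemma smooth_pair_continuous L Lb F G : smooth_pair L Lb F G -> continuous F.
Proof.
case=> L0 Lb0 FG GG; apply: locally_lipschitz_continuous => x.
exists (L + enorm (G x)) => z zx.
have -> : F z - F x = (F z - F x - dotp (G x) (z - x)) + dotp (G x) (z - x) by rewrite subrK.
apply: le_trans (ler_normD _ _) _; rewrite mulrDl.
apply: lerD; last exact: norm_dotp_le.
apply: le_trans (FG _ _) _; rewrite ler_wpM2l// expr2.
by rewrite -[leRHS]mul1r ler_wpM2r ?enorm_ge0.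
Qed.

Lemma smooth_pair_grad_continuous L Lb F G j :
  smooth_pair L Lb F G -> continuous (fun x => G x 0 j).
Proof.
case=> L0 Lb0 FG GG; apply: locally_lipschitz_continuous => x.
exists Lb => z _; apply: le_trans (GG x z).
by have := norm_coord_le (G z - G x) j; rewrite !mxE.
Qed.

Lemma smooth_pair_bound L Lb F G : smooth_pair L Lb F G ->
  exists M : R, 0 <= M /\ forall y, enorm y <= 1 -> `|F y| <= M /\ enorm (G y) <= M.
Proof.
case=> L0 Lb0 FG GG.
exists (`|F 0| + enorm (G 0) + L + Lb); split; first by rewrite !addr_ge0 ?enorm_ge0.
move=> y y1; have := FG 0 y; have := GG 0 y; rewrite !subr0 => hG hF.
have y0 := enorm_ge0 y.
have h1 : L * enorm y ^+ 2 <= L by rewrite ler_piMr// exprn_ile1.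
have h2 : Lb * enorm y <= Lb by rewrite ler_piMr.
have h3 : enorm (G 0) * enorm y <= enorm (G 0) by rewrite ler_piMr// enorm_ge0.
split.
  have -> : F y = (F y - F 0 - dotp (G 0) y) + F 0 + dotp (G 0) y by ring.
  have := norm_dotp_le (G 0) y; have := ler_normD (F y - F 0 - dotp (G 0) y + F 0) (dotp (G 0) y).
  have := ler_normD (F y - F 0 - dotp (G 0) y) (F 0); lra.
have := enormD (G y - G 0) (G 0); rewrite subrK.
have := normr_ge0 (F 0); lra.
Qed.

End SmoothPair.

(** First-order expansion of a product p q where p = u + s a and q = v + s b up to O(s^2). The
    constant depends only on the uniform bounds, so the estimate survives integration over the
    sphere. *)
Lemma product_expansion {R : realType} (u v a b p q s Cp Cq M : R) :
  `|u| <= M -> `|v| <= M -> `|a| <= M -> `|b| <= M -> `|s| <= 1 ->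
  0 <= Cp -> 0 <= Cq ->
  `|p - u - s * a| <= Cp * s ^+ 2 -> `|q - v - s * b| <= Cq * s ^+ 2 ->
  `|p * q - u * v - s * (a * v + u * b)| <=
    (M ^+ 2 + Cp * (2 * M + Cq) + 2 * M * Cq) * s ^+ 2.
Proof.
move=> hu hv ha hb hs Cp0 Cq0 hp hq.
have M0 : 0 <= M := le_trans (normr_ge0 _) hu.
have s2 : s ^+ 2 <= 1 by rewrite -real_normK ?num_real// exprn_ile1.
set e1 := p - u - s * a in hp; set e2 := q - v - s * b in hq.
have -> : p * q - u * v - s * (a * v + u * b) = s ^+ 2 * (a * b) + e1 * q + (u + s * a) * e2.
  by rewrite /e1 /e2; ring.
have hsx (y : R) : `|y| <= M -> `|s * y| <= M.
  by move=> hy; rewrite normrM -[leRHS]mul1r ler_pM.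
have hq' : `|q| <= 2 * M + Cq.
  have -> : q = e2 + v + s * b by rewrite /e2; ring.
  have := ler_normD (e2 + v) (s * b); have := ler_normD e2 v; have := hsx b hb.
  have : Cq * s ^+ 2 <= Cq by rewrite ler_piMr.
  lra.
have hua : `|u + s * a| <= 2 * M by have := ler_normD u (s * a); have := hsx a ha; lra.
have -> : (M ^+ 2 + Cp * (2 * M + Cq) + 2 * M * Cq) * s ^+ 2 =
    s ^+ 2 * (M * M) + (Cp * s ^+ 2) * (2 * M + Cq) + (2 * M) * (Cq * s ^+ 2) by ring.
apply: le_trans (ler_normD _ _) _; apply: lerD; last by rewrite normrM ler_pM.
apply: le_trans (ler_normD _ _) _; apply: lerD; last by rewrite normrM ler_pM.
by rewrite normrM (ger0_norm (sqr_ge0 s)) ler_wpM2l ?sqr_ge0// normrM ler_pM.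
Qed.

(** Taking s = min(1, |e| / (2C)) would give |e| <= |e| / 2. This extracts a first-order coefficient
    without differentiating an integral. *)
Lemma quadratic_small_eq0 {R : realType} (e C : R) :
  (forall s : R, 0 < s <= 1 -> `|s * e| <= C * s ^+ 2) -> e = 0.
Proof.
move=> h; apply/eqP; apply: contraT => e0.
have ep : 0 < `|e| by rewrite normr_gt0.
have C0 : 0 < C.
  have := h 1; rewrite ltr01 lexx mul1r expr1n mulr1 => /(_ isT); exact: lt_le_trans.
set s := Num.min 1 (`|e| / (2 * C)).
have s0 : 0 < s by rewrite lt_min ltr01 divr_gt0// mulr_gt0.
have := h s; rewrite s0 ge_min lexx => /(_ isT).
rewrite normrM (gtr0_norm s0) mulrC expr2 mulrA ler_pM2r// => h1.
have : C * s <= `|e| / 2.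
  have -> : `|e| / 2 = C * (`|e| / (2 * C)) by field; rewrite gt_eqF.
  by rewrite ler_pM2l// ge_min lexx orbT.
lra.
Qed.

(** * Invariance of spherical means, and its infinitesimal form *)

Section SphereMean.
Context {R : realType} {d : nat}.
Variable mu : probability 'rV[R]_d R.
Hypothesis mu_uniform : uniform_on_sphere mu.

Local Notation smean phi := (\int[mu]_z phi (on_sphere z)).

Lemma has_mean_sphere (phi : 'rV[R]_d -> R) (M : R) : measurable_fun setT phi ->
  (forall y, enorm y <= 1 -> `|phi y| <= M) -> has_mean mu (fun z => phi (on_sphere z)).
Proof.
move=> mphi phiM; apply: (@has_mean_bounded _ _ _ _ _ M) => [|z].
  exact: (measurableT_comp mphi measurable_on_sphere).
by apply: phiM; exact: enorm_on_sphere_le.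
Qed.

Lemma sphere_mean_rotation (phi : 'rV[R]_d -> R) (M : R) (Q : 'M[R]_d) :
  Q *m Q^T = 1%:M -> measurable_fun setT phi ->
  (forall y, enorm y <= 1 -> `|phi y| <= M) ->
  smean (fun y => phi (y *m Q)) = smean phi.
Proof.
move=> hQ mphi phiM.
have mQ := measurable_mulmxr Q.
congr fine.
have mp : measurable_fun setT (fun z : 'rV[R]_d => (phi (on_sphere z))%:E).
  by apply: (measurable_EFinP _ _).2; exact: (measurableT_comp mphi measurable_on_sphere).
have im : has_mean mu (fun z => phi (on_sphere (z *m Q))).
  apply: (@has_mean_bounded _ _ _ _ _ M) => [|z]; last exact/phiM/enorm_on_sphere_le.
  exact: (measurableT_comp (measurableT_comp mphi measurable_on_sphere) mQ).
rewrite [RHS](eq_measure_integral (pushforward mu (fun z : 'rV[R]_d => z *m Q))).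
  rewrite integral_pushforward//=.
  by apply: eq_integral => z _; rewrite on_sphere_mul.
by move=> A mA _; rewrite /pushforward; apply/esym; exact: mu_uniform.2.
Qed.

(** The antipodal map is the orthogonal matrix [- 1%:M], so the mean equals its own opposite. *)
Lemma sphere_mean_odd (phi : 'rV[R]_d -> R) (M : R) : measurable_fun setT phi ->
  (forall y, enorm y <= 1 -> `|phi y| <= M) ->
  (forall y, phi (- y) = - phi y) -> smean phi = 0.
Proof.
move=> mphi phiM podd.
have := @sphere_mean_rotation phi M (- 1%:M).
rewrite linearN/= trmx1 mulNmx mulmxN opprK mulmx1 => /(_ erefl mphi phiM).
under eq_Rintegral do rewrite mulmxN mulmx1 podd -mulN1r.
rewrite RintZ; last exact: has_mean_sphere phiM.
lra.
Qed.

Lemma sphere_mean_full (phi psi : 'rV[R]_d -> R) : measurable_fun setT phi ->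
  measurable_fun setT psi -> (forall y, enorm y = 1 -> phi y = psi y) ->
  smean phi = smean psi.
Proof.
move=> mphi mpsi e.
apply: (Rint_eq_full measurable_eq1_enorm) => [| | |z /= z1].
- exact: mu_uniform.1.
- exact: (measurableT_comp mphi measurable_on_sphere).
- exact: (measurableT_comp mpsi measurable_on_sphere).
- by rewrite on_sphereE// e.
Qed.

Section Green.
Variables (L Lb : R) (F : 'rV[R]_d -> R) (G : 'rV[R]_d -> 'rV[R]_d).
Hypothesis FG : smooth_pair L Lb F G.

Let mF : measurable_fun setT F.
Proof. exact: (continuous_measurable_rV (smooth_pair_continuous FG)). Qed.

Let mG (j : 'I_d) : measurable_fun setT (fun x : 'rV[R]_d => G x 0 j).
Proof. exact: (continuous_measurable_rV (smooth_pair_grad_continuous (j := j) FG)). Qed.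

Let mC (j : 'I_d) : measurable_fun setT (fun x : 'rV[R]_d => x 0 j).
Proof. exact: coord_measurable. Qed.

(* First-order term of the invariance of [F(z) z_j] under the rotations of the
   plane spanned by the i-th and j-th coordinate axes. *)
Lemma sphere_rotation_derivative (i j : 'I_d) : i != j ->
  smean (fun z => (G z 0 j * z 0 i - G z 0 i * z 0 j) * z 0 j + F z * z 0 i) = 0.
Proof.
move=> ij; have [M [M0 FM]] := smooth_pair_bound FG.
have [L0 Lb0 FGq _] := FG.
set a := fun z : 'rV[R]_d => G z 0 j * z 0 i - G z 0 i * z 0 j.
set g := fun z : 'rV[R]_d => a z * z 0 j + F z * z 0 i.
have crd (z : 'rV[R]_d) k : enorm z <= 1 -> `|z 0 k| <= 1 by move=> z1; apply: le_trans (norm_coord_le _ _) z1.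
have Gcrd (z : 'rV[R]_d) k : enorm z <= 1 -> `|G z 0 k| <= M.
  by move=> /FM[_ h]; apply: le_trans (norm_coord_le _ _) h.
have aM z : enorm z <= 1 -> `|a z| <= 2 * M.
  move=> z1; apply: le_trans (ler_normB _ _) _; rewrite !normrM.
  have h k l : `|G z 0 k| * `|z 0 l| <= M * 1 by rewrite ler_pM ?Gcrd ?crd.
  by have := h j i; have := h i j; lra.
set M' := 2 * M + 1.
have mg : measurable_fun setT g.
  apply: measurable_funD; apply: measurable_funM => //.
  by apply: measurable_funB; apply: measurable_funM.
have gM z : enorm z <= 1 -> `|g z| <= 3 * M.
  move=> z1; apply: le_trans (ler_normD _ _) _; rewrite !normrM.
  have h1 : `|a z| * `|z 0 j| <= 2 * M * 1 by rewrite ler_pM ?aM ?crd.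
  have h2 : `|F z| * `|z 0 i| <= M * 1 by rewrite ler_pM ?(FM z _).1 ?crd.
  lra.
have mp : measurable_fun setT (fun z => F z * z 0 j) by apply: measurable_funM.
have pM z : enorm z <= 1 -> `|F z * z 0 j| <= M.
  by move=> z1; rewrite normrM -[leRHS]mulr1 ler_pM ?(FM z _).1 ?crd.
(* The rotation moves z by at most 4 s, which gives the remainder 16 L s^2; the second-order
   displacement [(c - 1) *: v2] contributes 2 M s^2. *)
set Cp := L * 16 + M * 2.
have Cp0 : 0 <= Cp by rewrite addr_ge0 ?mulr_ge0.
set C := M' ^+ 2 + Cp * (2 * M' + 1) + 2 * M' * 1.
apply: (@quadratic_small_eq0 _ _ C) => s /andP[s0 s1].
have ns : `|s| <= 1 by rewrite gtr0_norm.
have s2 : s ^+ 2 <= 1 by rewrite exprn_ile1// ltW.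
set c := Num.sqrt (1 - s ^+ 2).
have c0 : 0 <= c := sqrtr_ge0 _.
have c2 : c ^+ 2 = 1 - s ^+ 2 by rewrite sqr_sqrtr// subr_ge0.
have c1 : `|c - 1| <= s ^+ 2.
  by rewrite ler_norml; apply/andP; split; nra.
set Q := plane_rotation i j c s.
have QQ : Q *m Q^T = 1%:M by apply: plane_rotation_orthogonal => //; rewrite c2 subrK.
have key z : enorm z <= 1 ->
    `|F (z *m Q) * (z *m Q) 0 j - F z * z 0 j - s * g z| <= C * s ^+ 2.
  move=> z1; have [hF hG] := FM z z1.
  set v1 := z 0 i *: delta_mx 0 j - z 0 j *: (delta_mx 0 i : 'rV[R]_d).
  set v2 := z 0 i *: delta_mx 0 i + z 0 j *: (delta_mx 0 j : 'rV[R]_d).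
  have zQ : z *m Q = z + (s *: v1 + (c - 1) *: v2) by rewrite mul_plane_rotation addrA.
  have n1 : enorm v1 <= 2.
    apply: le_trans (enormB _ _) _; rewrite !enormZ !enorm_delta !mulr1.
    by have := crd z i z1; have := crd z j z1; lra.
  have n2 : enorm v2 <= 2.
    apply: le_trans (enormD _ _) _; rewrite !enormZ !enorm_delta !mulr1.
    by have := crd z i z1; have := crd z j z1; lra.
  have nd : enorm (s *: v1 + (c - 1) *: v2) <= 4 * s.
    apply: le_trans (enormD _ _) _; rewrite !enormZ (gtr0_norm s0).
    have h1 : s * enorm v1 <= s * 2 by rewrite ler_pM2l.
    have h2 : `|c - 1| * enorm v2 <= s ^+ 2 * 2 by rewrite ler_pM ?enorm_ge0.
    by nra.
  apply: product_expansion => //.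
  - by rewrite /M'; lra.
  - by apply: le_trans (crd z j z1) _; rewrite /M'; lra.
  - by apply: le_trans (aM z z1) _; rewrite /M'; lra.
  - by apply: le_trans (crd z i z1) _; rewrite /M'; lra.
  - have := FGq z (z *m Q); rewrite zQ (addrAC z) subrr add0r => h.
    have dG : dotp (G z) (s *: v1 + (c - 1) *: v2) = s * a z + (c - 1) * dotp (G z) v2.
      rewrite dotpDr !dotpZr dotpBr !dotpZr !dotp_delta /a; ring.
    have h2 : `|(c - 1) * dotp (G z) v2| <= s ^+ 2 * (M * 2).
      rewrite normrM ler_pM// (le_trans (norm_dotp_le _ _))// ler_pM ?enorm_ge0//.
    have -> : F (z + (s *: v1 + (c - 1) *: v2)) - F z - s * a z =
      (F (z + (s *: v1 + (c - 1) *: v2)) - F z - dotp (G z) (s *: v1 + (c - 1) *: v2))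
      + (c - 1) * dotp (G z) v2 by rewrite dG; ring.
    apply: le_trans (ler_normD _ _) _.
    have h3 : L * enorm (s *: v1 + (c - 1) *: v2) ^+ 2 <= L * (4 * s) ^+ 2.
      by rewrite ler_wpM2l// ler_pXn2r ?nnegrE ?enorm_ge0// mulr_ge0// ltW.
    by rewrite /Cp; nra.
  - have -> : (z *m Q) 0 j - z 0 j - s * z 0 i = (c - 1) * z 0 j.
      rewrite zQ !mxE !eqxx (eq_sym j i) (negbTE ij) /=; ring.
    rewrite normrM mul1r -[leRHS]mulr1 ler_pM// crd//.
rewrite -(RintZ s (has_mean_sphere mg gM)).
have rot := sphere_mean_rotation QQ mp pM.
have m1 : has_mean mu (fun z => F (on_sphere z) * on_sphere z 0 j) := has_mean_sphere mp pM.
have mpQ : measurable_fun setT (fun z => F (z *m Q) * (z *m Q) 0 j).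
  exact: (measurableT_comp mp (measurable_mulmxr Q)).
have m2 : has_mean mu (fun z => F (on_sphere z *m Q) * (on_sphere z *m Q) 0 j).
  apply: (has_mean_sphere (phi := fun y => F (y *m Q) * (y *m Q) 0 j)) => [//|y y1].
  by apply: pM; rewrite enorm_mul.
have m3 := has_meanZ s (has_mean_sphere mg gM).
(* By invariance the two means of [F z * z 0 j] cancel, so only the integrated Taylor error is
   left. *)
have -> : \int[mu]_z (s * g (on_sphere z)) = - \int[mu]_z
    (F (on_sphere z *m Q) * (on_sphere z *m Q) 0 j - F (on_sphere z) * on_sphere z 0 j - s * g (on_sphere z)).
  by rewrite RintB ?RintB//; [rewrite rot; ring|exact: has_meanB].
rewrite normrN; apply: norm_Rint_le => [|z]; last exact/key/enorm_on_sphere_le.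
exact: (has_mean_measurable (has_meanB (has_meanB m2 m1) m3)).
Qed.

End Green.
End SphereMean.

(** Replaces differentiation under the integral sign: the quadratic remainder of the integrand is
    integrated first, and the derivative is read off the result. *)
Lemma quadratic_is_derive {R : realType} (f : R -> R) (r l C : R) : 0 <= C ->
  (forall s : R, `|f (r + s) - f r - s * l| <= C * s ^+ 2) -> is_derive r (1 : R) f l.
Proof.
move=> C0 h.
have cv : (h^-1 *: ((f \o shift r) (h *: (1 : R)) - f r))%R @[h --> (0%R : R)^'] --> l.
  apply: (@cvgrPdist_le _ _ _ _ _ _ l).2 => e e0.
  have C1 : 0 < C + 1 by rewrite ltr_wpDl.
  have : \forall s \near (0%R : R)^', `|s| < e / (C + 1) by apply: dnbhs0_lt; rewrite divr_gt0.
  have : \forall s \near (0%R : R)^', s != 0 by exact: nbhs_dnbhs_neq.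
  apply: filterS2 => s s0 hs.
  rewrite /= /GRing.scale /= mulr1 (addrC s r).
  have -> : l - s^-1 * (f (r + s) - f r) = - (s^-1 * (f (r + s) - f r - s * l)) by field.
  rewrite normrN normrM normfV ler_pdivrMl ?normr_gt0//.
  apply: le_trans (h s) _; rewrite -real_normK ?num_real// expr2 mulrCA ler_wpM2l//.
  have : `|s| * (C + 1) <= e by rewrite -ler_pdivlMr// ltW.
  by have := normr_ge0 s; nra.
by apply: DeriveDef; [apply: cvgP cv|apply: cvg_lim cv].
Qed.

(* Multiplying by the integrating factor [r ^+ n] turns the differential
   inequality into monotonicity. *)
Lemma radial_inequality {R : realType} (n : nat) (Phi dPhi : R -> R) (c : R) :
  (forall r, is_derive r (1 : R) Phi (dPhi r)) -> Phi 0 = 0 ->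
  (forall r, 0 <= r <= 1 -> c * r <= r * dPhi r + n%:R * Phi r) ->
  c <= n.+1%:R * Phi 1.
Proof.
move=> dP P0 h.
have n1 : n.+1%:R != 0 :> R by rewrite pnatr_eq0.
(* [c / n.+1%:R * r] is the solution of the equality case vanishing at 0; subtracting it makes the
   inequality homogeneous. *)
pose psi : R -> R := Phi - (c / n.+1%:R) *: (id : R -> R).
have dpsi (r : R) : is_derive r (1 : R) psi (dPhi r - c / n.+1%:R).
  apply: (is_derive_eq (is_deriveB (dP r) (is_deriveZ (c / n.+1%:R) (is_derive_id r (1 : R))))).
  by rewrite /GRing.scale /= mulr1.
pose g : R -> R := (id : R -> R) ^+ n * psi.
have dg (r : R) : is_derive r (1 : R) g (r ^+ n * (dPhi r - c / n.+1%:R) + psi r * (n%:R * r ^+ n.-1)).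
  apply: (is_derive_eq (is_deriveM (is_deriveX n (is_derive_id r (1 : R))) (dpsi r))).
  by rewrite /GRing.scale /= mulr1 fctE.
have [|xi] := MVT (@ltr01 R) (fun r _ => dg r).
  by apply: derivable_within_continuous => r _; have [] := dg r.
rewrite in_itv/= => /andP[xi0 xi1].
have psiE r : psi r = Phi r - c / n.+1%:R * r by [].
have gE r : g r = r ^+ n * psi r by rewrite /g mulrfctE exprfctE.
(* [g 0 = 0] rests on [psi 0 = 0]: the factor [r ^+ n] does not vanish at 0 when n = 0, which is the
   case d = 1. *)
rewrite !gE !psiE P0 expr1n mul1r !mulr0 !subr0 !mulr0 !mulr1 subr0 -psiE => e.
suff : 0 <= Phi 1 - c / n.+1%:R by rewrite subr_ge0 ler_pdivrMr ?ltr0n// mulrC.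
rewrite e -(pmulr_rge0 _ xi0).
have -> : xi * (xi ^+ n * (dPhi xi - c / n.+1%:R) + psi xi * (n%:R * xi ^+ n.-1))
   = xi ^+ n * (xi * dPhi xi + n%:R * Phi xi - c * xi).
  have cE : c = c / n.+1%:R * (n%:R + 1) by rewrite natr1 divfK.
  rewrite psiE [in RHS]cE; move: (c / n.+1%:R) (dPhi xi) (Phi xi) => q p p'.
  by case: (n) => [|m] /=; rewrite ?exprS; ring.
apply: mulr_ge0; first by rewrite exprn_ge0// ltW.
by rewrite subr_ge0 h// (ltW xi0) (ltW xi1).
Qed.

(** * Integration by parts on the sphere and the resulting mean-value inequality *)

Section BallLemma.
Context {R : realType} {d : nat}.
Variable mu : probability 'rV[R]_d R.
Hypothesis mu_uniform : uniform_on_sphere mu.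
Implicit Types (F : 'rV[R]_d -> R) (G : 'rV[R]_d -> 'rV[R]_d).

Local Notation smean phi := (\int[mu]_z phi (on_sphere z)).

Lemma coord_sphere_le (z : 'rV[R]_d) j : enorm z <= 1 -> `|z 0 j| <= 1.
Proof. exact/le_trans/norm_coord_le. Qed.

Lemma smooth_pair_measurable (L Lb : R) F G : smooth_pair L Lb F G ->
  measurable_fun setT F /\ measurable_fun setT G.
Proof.
move=> FG; split; first exact: (continuous_measurable_rV (smooth_pair_continuous FG)).
apply: measurable_fun_rV => j.
exact: (continuous_measurable_rV (smooth_pair_grad_continuous (j := j) FG)).
Qed.

Lemma dotp_sphere_le (x v : 'rV[R]_d) (M : R) : enorm x <= M -> `|dotp x v| <= M * enorm v.
Proof. by move=> h; apply: le_trans (norm_dotp_le _ _) _; rewrite ler_wpM2r ?enorm_ge0. Qed.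

(* Integration by parts on the sphere, obtained by summing the infinitesimal
   rotation identity over all planes containing a given coordinate axis. *)
Lemma sphere_green (L Lb : R) F G (v : 'rV[R]_d) : smooth_pair L Lb F G -> (0 < d)%N ->
  smean (fun z => dotp (G z) v) =
  smean (fun z => dotp (G z) z * dotp z v) + d.-1%:R * smean (fun z => F z * dotp z v).
Proof.
move=> FG d0; have [M [M0 FM]] := smooth_pair_bound FG.
have [mF mG] := smooth_pair_measurable FG.
have mI := @measurable_id _ 'rV[R]_d setT.
have mGj j : measurable_fun setT (fun z : 'rV[R]_d => G z 0 j) := measurable_coord j mG.
have mC (j : 'I_d) := @coord_measurable R d j.
have Gj z j : enorm z <= 1 -> `|G z 0 j| <= M.
  by move=> /FM[_ h]; apply: le_trans (norm_coord_le _ _) h.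
have hGzz i j k : has_mean mu (fun z => G (on_sphere z) 0 i * on_sphere z 0 j * on_sphere z 0 k).
  apply: (@has_mean_sphere _ _ mu (fun y => G y 0 i * y 0 j * y 0 k) (M * 1 * 1)) => [|y y1].
    by do 2![apply: measurable_funM => //].
  by rewrite !normrM !ler_pM ?mulr_ge0 ?Gj ?coord_sphere_le.
have hFz i : has_mean mu (fun z => F (on_sphere z) * on_sphere z 0 i).
  apply: (@has_mean_sphere _ _ mu (fun y => F y * y 0 i) (M * 1)) => [|y y1].
    exact: measurable_funM.
  by rewrite normrM ler_pM ?(FM y y1).1 ?coord_sphere_le.
have hG i : has_mean mu (fun z => G (on_sphere z) 0 i).
  by apply: (@has_mean_sphere _ _ mu (fun y => G y 0 i) (M)) => // y; exact: Gj.
have coordwise i : smean (fun z => G z 0 i) =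
    smean (fun z => dotp (G z) z * z 0 i) + d.-1%:R * smean (fun z => F z * z 0 i).
  (* On the sphere the squares of the coordinates sum to 1. *)
  transitivity (\sum_j smean (fun z => G z 0 i * z 0 j * z 0 j)).
    rewrite -Rint_sum//; apply: (@sphere_mean_full _ _ _ mu_uniform
      (fun y => G y 0 i) (fun y => \sum_j G y 0 i * y 0 j * y 0 j)) => //.
      by apply: measurable_sum => j; do 2![apply: measurable_funM => //].
    move=> y y1; under eq_bigr do rewrite -mulrA; rewrite -mulr_sumr.
    by have := sqr_enorm y; rewrite y1 expr1n /dotp => <-; rewrite mulr1.
  have -> : smean (fun z => dotp (G z) z * z 0 i) =
      \sum_j smean (fun z => G z 0 j * z 0 j * z 0 i).
    by rewrite -Rint_sum//; apply: eq_Rintegral => z _; rewrite mulr_suml.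
  (* The j = i terms agree; each of the d - 1 other planes through the i-th axis contributes one
     copy of the mean of [F z * z 0 i]. *)
  rewrite [LHS](bigD1 i)//= [X in _ = X + _](bigD1 i)//= -addrA; congr (_ + _).
  have -> : d.-1%:R * smean (fun z => F z * z 0 i) = \sum_(j | j != i) smean (fun z => F z * z 0 i).
    by rewrite sumr_const cardC1 card_ord mulr_natl.
  rewrite -big_split; apply: eq_bigr => j; rewrite eq_sym => ij.
  have := sphere_rotation_derivative mu_uniform FG ij.
  have -> : \int[mu]_z ((G (on_sphere z) 0 j * on_sphere z 0 i - G (on_sphere z) 0 i * on_sphere z 0 j)
       * on_sphere z 0 j + F (on_sphere z) * on_sphere z 0 i) =
     smean (fun z => G z 0 j * z 0 j * z 0 i) - smean (fun z => G z 0 i * z 0 j * z 0 j)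
     + smean (fun z => F z * z 0 i).
    rewrite -RintB// -RintD//; last exact: has_meanB.
    by apply: eq_Rintegral => z _; ring.
  by move/eqP; rewrite addrAC subr_eq0 => /eqP/esym.
have hGz i : has_mean mu (fun z => dotp (G (on_sphere z)) (on_sphere z) * on_sphere z 0 i).
  apply: (@has_mean_sphere _ _ mu (fun y => dotp (G y) y * y 0 i) (M * 1 * 1)) => [|y y1].
    by apply: measurable_funM => //; exact: measurable_dotp.
  rewrite normrM ler_pM ?coord_sphere_le// (le_trans (norm_dotp_le _ _))// ler_pM ?enorm_ge0//.
  exact: (FM y y1).2.
have expand (phi : 'rV[R]_d -> R) : (forall i, has_mean mu (fun z => phi (on_sphere z) * on_sphere z 0 i)) ->
    smean (fun z => phi z * dotp z v) = \sum_i v 0 i * smean (fun z => phi z * z 0 i).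
  move=> hp; under eq_bigr do rewrite -RintZ//.
  rewrite -Rint_sum//; last by move=> i; exact: has_meanZ.
  apply: eq_Rintegral => z _; rewrite mulr_sumr; apply: eq_bigr => i _; ring.
rewrite (expand (fun z => dotp (G z) z))// (expand F)// mulr_sumr; apply: etrans; last exact: big_split.
transitivity (\sum_i v 0 i * smean (fun z => G z 0 i)).
  under eq_bigr do rewrite -RintZ//.
  rewrite -Rint_sum//; last by move=> i; exact: has_meanZ.
  by apply: eq_Rintegral => z _; apply: eq_bigr => i _; ring.
by apply: eq_bigr => i _; rewrite coordwise mulrDr; congr (_ + _); rewrite mulrCA.
Qed.

End BallLemma.

Section BallInequality.
Context {R : realType} {d : nat}.
Variable mu : probability 'rV[R]_d R.
Hypothesis mu_uniform : uniform_on_sphere mu.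
Implicit Types (F : 'rV[R]_d -> R) (G : 'rV[R]_d -> 'rV[R]_d).

Local Notation smean phi := (\int[mu]_z phi (on_sphere z)).

Lemma smooth_pair_scale (L Lb : R) F G (r : R) : smooth_pair L Lb F G ->
  smooth_pair (L * r ^+ 2) (Lb * r ^+ 2) (fun u => F (r *: u)) (fun u => r *: G (r *: u)).
Proof.
move=> /(smooth_pair_affine 0 r); congr smooth_pair; apply/funext => u; by rewrite add0r.
Qed.

Lemma sphere_mean_has_mean (L Lb : R) F G (v : 'rV[R]_d) : smooth_pair L Lb F G ->
  [/\ has_mean mu (fun z => F (on_sphere z) * dotp (on_sphere z) v),
      has_mean mu (fun z => dotp (G (on_sphere z)) v) &
      has_mean mu (fun z => dotp (G (on_sphere z)) (on_sphere z) * dotp (on_sphere z) v)].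
Proof.
move=> FG; have [M [M0 FM]] := smooth_pair_bound FG.
have [mF mG] := smooth_pair_measurable FG.
have mI := @measurable_id _ 'rV[R]_d setT.
have mz : measurable_fun setT (fun z : 'rV[R]_d => dotp z v).
  by apply: measurable_dotp => //; exact: measurable_cst.
have zv (y : 'rV[R]_d) : enorm y <= 1 -> `|dotp y v| <= enorm v.
  by move=> y1; rewrite -[leRHS]mul1r dotp_sphere_le.
split.
- apply: (@has_mean_sphere _ _ mu (fun y => F y * dotp y v) (M * enorm v)) => [|y y1].
    exact: measurable_funM.
  by rewrite normrM ler_pM ?zv ?(FM y y1).1.
- apply: (@has_mean_sphere _ _ mu (fun y => dotp (G y) v) (M * enorm v)) => [|y y1].
    by apply: measurable_dotp => //; exact: measurable_cst.
  by apply: dotp_sphere_le; exact: (FM y y1).2.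
- apply: (@has_mean_sphere _ _ mu (fun y => dotp (G y) y * dotp y v) (M * 1 * enorm v)) => [|y y1].
    by apply: measurable_funM => //; exact: measurable_dotp.
  rewrite normrM ler_pM ?zv// (le_trans (norm_dotp_le _ _))// ler_pM ?enorm_ge0//.
  exact: (FM y y1).2.
Qed.

(* [r |-> sum_k E[F_k(r z) <z, v_k>]] satisfies the differential inequality of
   [radial_inequality]: this is the divergence theorem for the ball, in disguise. *)
Lemma sphere_ball_le (n : nat) (L Lb c : R) (F : 'I_n -> 'rV[R]_d -> R)
    (G : 'I_n -> 'rV[R]_d -> 'rV[R]_d) (v : 'I_n -> 'rV[R]_d) :
  (0 < d)%N -> (forall k, smooth_pair L Lb (F k) (G k)) ->
  (forall r : R, 0 <= r <= 1 -> c <= \sum_k smean (fun z => dotp (G k (r *: z)) (v k))) ->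
  c <= d%:R * \sum_k smean (fun z => F k z * dotp z (v k)).
Proof.
move=> d0 FG hc.
pose Phi (r : R) := \sum_k smean (fun z => F k (r *: z) * dotp z (v k)).
pose dPhi (r : R) := \sum_k smean (fun z => dotp (G k (r *: z)) z * dotp z (v k)).
have hm1 k r : has_mean mu (fun z => F k (r *: on_sphere z) * dotp (on_sphere z) (v k)).
  by have [] := sphere_mean_has_mean (v k) (smooth_pair_scale r (FG k)).
have mI : measurable_fun setT (fun z : 'rV[R]_d => on_sphere z) := measurable_on_sphere.
have mGr k r : measurable_fun setT (fun z => G k (r *: on_sphere z)).
  have [_ mG] := smooth_pair_measurable (FG k).
  apply: (measurableT_comp mG); apply: measurable_scalev => //; exact: measurable_cst.
have mFr k r : measurable_fun setT (fun z => F k (r *: on_sphere z)).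
  have [mF _] := smooth_pair_measurable (FG k).
  apply: (measurableT_comp mF); apply: measurable_scalev => //; exact: measurable_cst.
have mzv k : measurable_fun setT (fun z => dotp (on_sphere z) (v k)).
  by apply: measurable_dotp => //; exact: measurable_cst.
have Gbound k r : exists M : R, forall y : 'rV[R]_d, enorm y <= 1 -> enorm (G k (r *: y)) <= M.
  have [L0 Lb0 _ hG] := FG k.
  exists (enorm (G k 0) + Lb * `|r|) => y y1.
  have := hG 0 (r *: y); rewrite subr0 enormZ => h.
  have := enormD (G k (r *: y) - G k 0) (G k 0); rewrite subrK => h1.
  apply: le_trans h1 _; rewrite addrC lerD2l (le_trans h)// ler_wpM2l//.
  by rewrite ler_piMr.
have hm2 k r : has_mean mu (fun z => dotp (G k (r *: on_sphere z)) (on_sphere z) * dotp (on_sphere z) (v k)).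
  have [M hM] := Gbound k r.
  apply: (@has_mean_bounded _ _ _ _ _ (M * 1 * enorm (v k))) => [|z].
    by apply: measurable_funM => //; exact: measurable_dotp.
  have z1 := enorm_on_sphere_le z.
  rewrite normrM ler_pM// (le_trans (norm_dotp_le _ _))// ?ler_pM ?enorm_ge0 ?hM//.
  by rewrite ler_piMl ?enorm_ge0.
have hm3 k r : has_mean mu (fun z => dotp (G k (r *: on_sphere z)) (v k)).
  have [M hM] := Gbound k r.
  apply: (@has_mean_bounded _ _ _ _ _ (M * enorm (v k))) => [|z].
    by apply: measurable_dotp => //; exact: measurable_cst.
  by apply: dotp_sphere_le; exact/hM/enorm_on_sphere_le.
have L0 : 0 <= \sum_k L * enorm (v k).
  by apply: sumr_ge0 => k _; have [? _ _ _] := FG k; rewrite mulr_ge0 ?enorm_ge0.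
have dP r : is_derive r (1 : R) Phi (dPhi r).
  apply: (quadratic_is_derive L0) => s.
  rewrite /Phi /dPhi -sumrB mulr_sumr -sumrB mulr_suml.
  apply: le_trans (ler_norm_sum _ _ _) _; apply: ler_sum => k _.
  have [Lk0 _ hF _] := FG k.
  rewrite -RintZ// -RintB// -RintB//; [|exact: has_meanB|exact: has_meanZ].
  apply: norm_Rint_le => [|z].
    exact: (has_mean_measurable (has_meanB (has_meanB (hm1 k (r + s)) (hm1 k r)) (has_meanZ s (hm2 k r)))).
  set y := on_sphere z; have y1 : enorm y <= 1 := enorm_on_sphere_le z.
  rewrite [s * (_ * _)]mulrA -mulrBl -mulrBl normrM mulrAC.
  apply: ler_pM => //; last by rewrite -[leRHS]mul1r dotp_sphere_le.
  have := hF (r *: y) ((r + s) *: y).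
  rewrite -scalerBl (addrAC r s) subrr add0r dotpZr enormZ => h; apply: le_trans h _.
  rewrite ler_wpM2l// exprMn real_normK ?num_real// ler_piMr ?sqr_ge0//.
  by rewrite exprn_ile1 ?enorm_ge0.
have P0 : Phi 0 = 0.
  apply: big1 => k _.
  apply: (@sphere_mean_odd _ _ _ mu_uniform (fun y => F k (0 *: y) * dotp y (v k)) (`|F k 0| * enorm (v k))).
  - apply: measurable_funM; first by under eq_fun do rewrite scale0r; exact: measurable_cst.
    by apply: measurable_dotp; [exact: measurable_id|exact: measurable_cst].
  - move=> y y1; rewrite scale0r normrM ler_wpM2l// -[leRHS]mul1r; exact: dotp_sphere_le.
  - by move=> y; rewrite !scale0r dotpNl mulrN.
have := @radial_inequality R d.-1 Phi dPhi c dP P0; rewrite prednK//.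
have -> : Phi 1 = \sum_k smean (fun z => F k z * dotp z (v k)).
  by apply: eq_bigr => k _; under eq_Rintegral do rewrite scale1r.
apply => r r01; apply: le_trans (ler_wpM2r _ (hc r r01)) _; first by case/andP: r01.
rewrite le_eqVlt; apply/orP; left; apply/eqP.
rewrite mulrC /dPhi /Phi !mulr_sumr; apply: etrans; last exact: big_split.
apply: eq_bigr => k _.
(* Applied to u |-> F (r u), whose gradient carries a factor r. This yields the differential
   inequality with n = d - 1, so the final factor n + 1 is the dimension. *)
have := sphere_green mu_uniform (v k) (smooth_pair_scale r (FG k)) d0.
under [X in X = _ -> _]eq_Rintegral do rewrite dotpZl.
under [X in _ = X + _ -> _]eq_Rintegral do rewrite dotpZl -mulrA.
by rewrite RintZ// RintZ// => ->.
Qed.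

End BallInequality.

(** * Convex combinations and projection onto a compact convex set *)

Section ConvexSets.
Context {R : realType} {d : nat}.
Variable Theta : set 'rV[R]_d.
Hypothesis Theta_convex : convex_set (Theta : set (convex_lmodType 'rV[R]_d)).

Lemma convex_setP (p q : 'rV[R]_d) (t : R) : 0 <= t <= 1 -> Theta p -> Theta q ->
  Theta (t *: p + (1 - t) *: q).
Proof.
move=> /andP[t0 t1] /mem_set tp /mem_set tq.
by have := Theta_convex (Itv01 t0 t1) tp tq; rewrite inE.
Qed.

Lemma convex_set_sum (I : Type) (r : seq I) (w : I -> R) (z : I -> 'rV[R]_d) :
  (forall i, 0 <= w i) -> (forall i, Theta (z i)) -> \sum_(i <- r) w i = 1 ->
  Theta (\sum_(i <- r) w i *: z i).
Proof.
move=> w0 tz.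
(* Renormalised form for the induction, since partial sums of the weights are not 1. *)
suff : 0 < \sum_(i <- r) w i -> Theta ((\sum_(i <- r) w i)^-1 *: \sum_(i <- r) w i *: z i).
  by move=> + r1; rewrite r1 invr1 scale1r; apply; exact: ltr01.
elim: r => [|i r IH]; first by rewrite big_nil ltxx.
rewrite !big_cons; set S := \sum_(j <- r) w j in IH *; set Z := \sum_(j <- r) _ in IH *.
move=> s0; have S0 : 0 <= S by apply: sumr_ge0.
have [SE|/eqP Sn] := eqVneq S 0.
  have r0 : Z = 0.
    rewrite /Z; move: SE; rewrite /S; elim: (r) => [|j l IHl]; first by rewrite !big_nil.
    rewrite !big_cons => h.
    have l0 : 0 <= \sum_(j <- l) w j by apply: sumr_ge0.
    have wj0 : w j = 0 by have := w0 j; lra.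
    by rewrite wj0 scale0r add0r IHl//; lra.
  rewrite r0 addr0 SE addr0 scalerA mulVf ?scale1r//.
  by move: s0; rewrite SE addr0 => /gt_eqF ->.
have Sp : 0 < S by rewrite lt_neqAle eq_sym S0 andbT; apply/eqP.
have nz : w i + S != 0 by rewrite gt_eqF.
have -> : (w i + S)^-1 *: (w i *: z i + Z) =
    (w i / (w i + S)) *: z i + (1 - w i / (w i + S)) *: (S^-1 *: Z).
  rewrite scalerDr !scalerA (mulrC _ (w i)); congr (_ + _ *: _).
  by field; rewrite nz gt_eqF.
apply: convex_setP => //; last exact: IH.
by apply/andP; split; [rewrite divr_ge0// ltW|rewrite ler_pdivrMr// mul1r lerDl].
Qed.

Hypothesis Theta_compact : compact Theta.
Hypothesis Theta_neq0 : Theta !=set0.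

Lemma enorm_continuous (x : 'rV[R]_d) : continuous (fun q : 'rV[R]_d => enorm (x - q)).
Proof.
apply: locally_lipschitz_continuous => y; exists 1 => z _; rewrite mul1r.
rewrite ler_distl; apply/andP; split.
  by rewrite lerBlDr; apply: le_trans (enormB_trans _ z _) _.
by apply: le_trans (enormB_trans _ y _) _; rewrite (enormBC y z).
Qed.

(** The continuous distance attains its minimum on the compact set, so the default value 0 of [xget]
    never occurs. *)
Lemma projP x : Theta (Defs.proj Theta x) /\
  forall q, Theta q -> enorm (x - Defs.proj Theta x) <= enorm (x - q).
Proof.
rewrite /Defs.proj; case: xgetP => [p _ []|none]//.
have [|p pT pmin] := @EVT_min_rV R d (fun q : 'rV[R]_d => enorm (x - q)) Theta Theta_neq0 Theta_compact.
  exact/continuous_subspaceT/enorm_continuous.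
exfalso; apply: (none p); split; first by move: pT; rewrite inE.
by move=> q qT; apply: pmin; rewrite inE.
Qed.

Lemma proj_in x : Theta (Defs.proj Theta x).
Proof. by have [] := projP x. Qed.

Lemma proj_id x : Theta x -> Defs.proj Theta x = x.
Proof.
move=> tx; have [_ /(_ x tx)] := projP x; rewrite subrr enorm0 => h.
have /enorm_eq0/eqP : enorm (x - Defs.proj Theta x) = 0.
  by apply/eqP; rewrite eq_le h enorm_ge0.
by rewrite subr_eq0 => /eqP.
Qed.

(** Moving from the projection p to p + t (q - p) stays in the set and cannot reduce the distance to
    x; expanding the square gives 2 a <= t b for all t in (0, 1]. *)
Lemma proj_variational x q : Theta q ->
  dotp (x - Defs.proj Theta x) (q - Defs.proj Theta x) <= 0.
Proof.
move=> tq; have [tp pmin] := projP x; set p := Defs.proj Theta x in tp pmin *.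
set a := dotp _ _; set b := enorm (q - p) ^+ 2.
have b0 : 0 <= b by rewrite sqr_ge0.
have key t : 0 < t <= 1 -> 2 * a <= t * b.
  move=> /andP[t0 t1].
  have th : Theta (p + t *: (q - p)).
    have -> : p + t *: (q - p) = t *: q + (1 - t) *: p.
      by rewrite scalerBr scalerBl scale1r addrC addrAC -addrA.
    by apply: convex_setP; rewrite ?(ltW t0).
  have := pmin _ th; rewrite opprD addrA => h.
  have : enorm (x - p) ^+ 2 <= enorm (x - p - t *: (q - p)) ^+ 2.
    by rewrite ler_pXn2r ?nnegrE ?enorm_ge0.
  rewrite (sqr_enormB (x - p)) dotpZr enormZ exprMn real_normK ?num_real// -/a -/b => h2.
  have : t * (2 * a) <= t * (t * b) by nra.
  by rewrite ler_pM2l.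
rewrite leNgt; apply/negP => a0.
(* If a > 0, this t gives 2 a <= t b <= a; the [+ 1] covers b = 0. *)
have := key (Num.min 1 (a / (b + 1))).
have t0 : 0 < a / (b + 1) by rewrite divr_gt0// ltr_wpDl.
rewrite lt_min ltr01 t0 ge_min lexx => /(_ isT) h.
have : Num.min 1 (a / (b + 1)) * b <= a / (b + 1) * b by rewrite ler_wpM2r// ge_min lexx orbT.
have : a / (b + 1) * b <= a.
  by rewrite mulrAC ler_pdivrMr ?ltr_wpDl//; nra.
lra.
Qed.

(** The variational inequalities at p and q add up to |p - q|^2 <= <x - y, p - q>; Cauchy-Schwarz
    finishes. *)
Lemma proj_nonexpansive x y :
  enorm (Defs.proj Theta x - Defs.proj Theta y) <= enorm (x - y).
Proof.
have h1 := proj_variational x (proj_in y); have h2 := proj_variational y (proj_in x).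
set p := Defs.proj Theta x in h1 h2 *; set q := Defs.proj Theta y in h1 h2 *.
have [->|pq] := eqVneq (enorm (p - q)) 0; first exact: enorm_ge0.
have pq0 : 0 < enorm (p - q) by rewrite lt_neqAle eq_sym pq enorm_ge0.
rewrite -(ler_pM2r pq0); apply: le_trans (dotp_le _ _).
rewrite -expr2 sqr_enorm.
move: h1 h2; rewrite !(dotpBl, dotpBr) !(dotpC q p) !(dotpC y) !(dotpC x); lra.
Qed.

Lemma proj_dist_le x q : Theta q -> enorm (Defs.proj Theta x - q) <= enorm (x - q).
Proof. by move=> tq; rewrite -{1}(proj_id tq) proj_nonexpansive. Qed.

Lemma measurable_proj (disp : measure_display) (S : measurableType disp) (g : S -> 'rV[R]_d) :
  measurable_fun setT g -> measurable_fun setT (fun w => Defs.proj Theta (g w)).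
Proof.
move=> mg; apply: measurable_comp_continuousv => // j.
apply: locally_lipschitz_continuous => x; exists 1 => z _; rewrite mul1r.
apply: le_trans (proj_nonexpansive z x).
by have := norm_coord_le (Defs.proj Theta z - Defs.proj Theta x) j; rewrite !mxE.
Qed.

Lemma diam_le (K : R) x y : (diam Theta <= K%:E)%E -> Theta x -> Theta y -> enorm (x - y) <= K.
Proof.
move=> hK tx ty; rewrite -lee_fin; apply: le_trans hK.
by apply: ereal_sup_ubound; exists (x, y).
Qed.

End ConvexSets.

(** * The spectral norm as an operator norm *)

Section SpectralNorm.
Context {R : realType} {n : nat}.

(** A crude bound by the sum of the row norms; it makes the [sup] that defines the spectral norm a
    genuine supremum. *)
Lemma enorm_mul_bounded (A : 'M[R]_n) : exists C : R, forall x : 'rV[R]_n,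
  enorm x <= 1 -> enorm (x *m A^T) <= C.
Proof.
exists (\sum_j enorm (\row_i A j i)) => x x1.
apply: le_trans (enorm_le_sum _) _; apply: ler_sum => j _.
have -> : (x *m A^T) 0 j = dotp x (\row_i A j i).
  by rewrite mxE; apply: eq_bigr => i _; rewrite !mxE.
by apply: le_trans (norm_dotp_le _ _) _; rewrite ler_piMl ?enorm_ge0.
Qed.

Lemma spectral_norm_ge0 (A : 'M[R]_n) : 0 <= spectral_norm A.
Proof.
have [C hC] := enorm_mul_bounded A.
apply: ub_le_sup.
  by exists C => _ [x /= x1 <-]; exact: hC.
by exists 0; rewrite /= ?enorm0 ?ler01// mul0mx enorm0.
Qed.

Lemma enorm_mul_le (A : 'M[R]_n) (x : 'rV[R]_n) :
  enorm (x *m A^T) <= spectral_norm A * enorm x.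
Proof.
have [x0|x0] := eqVneq (enorm x) 0.
  by rewrite (enorm_eq0 x0) mul0mx enorm0 mulr0.
have xp : 0 < enorm x by rewrite lt_neqAle eq_sym x0 enorm_ge0.
rewrite -ler_pdivrMr// mulrC -[X in X * _]gtr0_norm ?invr_gt0// -enormZ scalemxAl.
have [C hC] := enorm_mul_bounded A.
apply: ub_le_sup; first by exists C => _ [y /= y1 <-]; exact: hC.
by exists ((enorm x)^-1 *: x) => //=; rewrite enormZ gtr0_norm ?invr_gt0// mulVf.
Qed.

End SpectralNorm.

(** * Mean and spread of the agents, and their change under mixing *)

Section Agents.
Context {R : realType} {n d : nat}.
Hypothesis n0 : (0 < n)%N.
Implicit Types (a b x z : 'I_n -> 'rV[R]_d) (p : 'rV[R]_d).

Let nR0 : n%:R != 0 :> R. Proof. by rewrite pnatr_eq0 -lt0n. Qed.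
Let nV0 : 0 <= n%:R^-1 :> R. Proof. by rewrite invr_ge0. Qed.

Definition vmean x : 'rV[R]_d := n%:R^-1 *: \sum_i x i.

(** Root mean square over agents, phrased as the norm of the vector of norms so that the triangle
    inequality and Cauchy-Schwarz in R^n apply to it. *)
Definition rms a : R := Num.sqrt n%:R^-1 * enorm (\row_i enorm (a i)).

Lemma rms_ge0 a : 0 <= rms a.
Proof. by rewrite mulr_ge0 ?sqrtr_ge0 ?enorm_ge0. Qed.

Lemma sqr_rms a : rms a ^+ 2 = n%:R^-1 * \sum_i enorm (a i) ^+ 2.
Proof.
rewrite exprMn sqr_sqrtr// sqr_enorm; congr (_ * _).
by apply: eq_bigr => i _; rewrite !mxE -expr2.
Qed.

Lemma rms_le a b : (forall i, enorm (a i) <= enorm (b i)) -> rms a <= rms b.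
Proof.
move=> ab; rewrite -(ler_pXn2r (n := 2)) ?nnegrE ?rms_ge0// !sqr_rms.
by rewrite ler_wpM2l// ler_sum// => i _; rewrite ler_pXn2r ?nnegrE ?enorm_ge0.
Qed.

Lemma rms_const_le a (M : R) : 0 <= M -> (forall i, enorm (a i) <= M) -> rms a <= M.
Proof.
move=> M0 aM; rewrite -(ler_pXn2r (n := 2)) ?nnegrE ?rms_ge0// sqr_rms.
rewrite ler_pdivrMl ?ltr0n//; apply: (@le_trans _ _ (\sum_(i < n) M ^+ 2)).
  by apply: ler_sum => i _; rewrite ler_pXn2r ?nnegrE ?enorm_ge0.
by rewrite sumr_const card_ord mulr_natl.
Qed.

Lemma rmsD a b : rms (fun i => a i + b i) <= rms a + rms b.
Proof.
rewrite /rms -mulrDr ler_wpM2l ?sqrtr_ge0//.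
apply: le_trans (enormD _ _).
rewrite ler_sqrt ?dotp_ge0//; apply: ler_sum => i _; rewrite !mxE -!expr2.
by rewrite ler_pXn2r ?nnegrE ?addr_ge0 ?enorm_ge0// enormD.
Qed.

Lemma mean_le_rms a : n%:R^-1 * \sum_i enorm (a i) <= rms a.
Proof.
have s0 : 0 <= Num.sqrt n%:R^-1 :> R := sqrtr_ge0 _.
have -> : n%:R^-1 * \sum_i enorm (a i) =
    Num.sqrt n%:R^-1 * (Num.sqrt n%:R^-1 * dotp (\row_i enorm (a i)) (\row_i 1)).
  rewrite mulrA -expr2 sqr_sqrtr//; congr (_ * _).
  by apply: eq_bigr => i _; rewrite !mxE mulr1.
rewrite /rms ler_wpM2l//.
apply: le_trans (ler_wpM2l s0 (dotp_le _ _)) _.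
rewrite mulrCA ler_piMr ?enorm_ge0// /enorm -sqrtrM//.
have -> : dotp (\row_(i < n) 1) (\row_(i < n) (1 : R)) = n%:R.
  rewrite /dotp; under eq_bigr do rewrite !mxE mulr1.
  by rewrite sumr_const card_ord.
by rewrite mulVf// sqrtr1.
Qed.

Lemma sum_sub_vmean x : \sum_i (x i - vmean x) = 0.
Proof.
rewrite sumrB sumr_const card_ord -scaler_nat /vmean scalerA divff// scale1r.
exact: subrr.
Qed.

(** Pythagoras: the cross term vanishes because deviations from the mean sum to 0. *)
Lemma sqr_rms_sub x p :
  rms (fun i => x i - p) ^+ 2 = enorm (vmean x - p) ^+ 2 + rms (fun i => x i - vmean x) ^+ 2.
Proof.
rewrite !sqr_rms.
have e i : enorm (x i - p) ^+ 2 = enorm (x i - vmean x) ^+ 2 +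
    2 * dotp (x i - vmean x) (vmean x - p) + enorm (vmean x - p) ^+ 2.
  by rewrite -sqr_enormD addrA subrK.
under eq_bigr do rewrite e.
rewrite !big_split /= -mulr_sumr -dotp_suml sum_sub_vmean dotp0l mulr0 addr0.
by rewrite sumr_const card_ord mulrDr -[X in _ + n%:R^-1 * X]mulr_natl mulKf// addrC.
Qed.

Lemma rms_sub_vmean_le x p : rms (fun i => x i - vmean x) <= rms (fun i => x i - p).
Proof.
rewrite -(ler_pXn2r (n := 2)) ?nnegrE ?rms_ge0// (sqr_rms_sub x p) lerDr.
exact: sqr_ge0.
Qed.

Variable W : 'M[R]_n.
Hypothesis W_stochastic : doubly_stochastic W.

Definition gossip z (i : 'I_n) : 'rV[R]_d := \sum_k W i k *: z k.

Lemma vmean_gossip z : vmean (gossip z) = vmean z.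
Proof.
have [_ _ Wc] := W_stochastic.
rewrite /vmean /gossip exchange_big /=; congr (_ *: _).
by apply: eq_bigr => k _; rewrite -scaler_suml Wc scale1r.
Qed.

(** Rows summing to 1 give Jensen's inequality for each agent, obtained here from the nonnegativity
    of a weighted variance; columns summing to 1 then restore the total. *)
Lemma rms_gossip_sub_le z p : rms (fun i => gossip z i - p) <= rms (fun i => z i - p).
Proof.
have [W0 Wr Wc] := W_stochastic.
rewrite -(ler_pXn2r (n := 2)) ?nnegrE ?rms_ge0// !sqr_rms ler_wpM2l//.
have jensen i : enorm (gossip z i - p) ^+ 2 <= \sum_k W i k * enorm (z k - p) ^+ 2.
  have -> : gossip z i - p = \sum_k W i k *: (z k - p).
    rewrite /gossip; under [RHS]eq_bigr do rewrite scalerBr.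
    by rewrite sumrB -scaler_suml Wr scale1r.
  set y := fun k => z k - p; set m := \sum_k _.
  have : 0 <= \sum_k W i k * enorm (y k - m) ^+ 2.
    by apply: sumr_ge0 => k _; rewrite mulr_ge0 ?sqr_ge0.
  have e k : W i k * enorm (y k - m) ^+ 2 =
      (W i k * enorm (y k) ^+ 2 - 2 * dotp (W i k *: y k) m) + W i k * enorm m ^+ 2.
    by rewrite sqr_enormB dotpZl; ring.
  under eq_bigr do rewrite e.
  rewrite big_split sumrB /= -mulr_sumr -dotp_suml -mulr_suml Wr mul1r.
  rewrite -/m -sqr_enorm; lra.
apply: le_trans (ler_sum _ (fun i _ => jensen i)) _.
rewrite exchange_big /=; apply: ler_sum => k _.
by rewrite -mulr_suml Wc mul1r.
Qed.

(** Deviations sum to 0 over the agents, so W acts on them as W - 11^T/n. The spectral norm is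
    applied in R^n to each coordinate of R^d separately, after exchanging the sums over agents and
    coordinates. *)
Lemma rms_gossip_sub_vmean z :
  rms (fun i => gossip z i - vmean z) <= mixing_rate W * rms (fun i => z i - vmean z).
Proof.
have [W0 Wr Wc] := W_stochastic.
set rho := mixing_rate W.
have rho0 : 0 <= rho := spectral_norm_ge0 _.
rewrite -(ler_pXn2r (n := 2)) ?nnegrE ?(mulr_ge0 rho0 (rms_ge0 _)) ?rms_ge0// [(rho * _) ^+ 2]exprMn !sqr_rms.
rewrite [leRHS]mulrCA ler_wpM2l//.
pose y k := z k - vmean z.
pose A := W - n%:R^-1 *: (ones *m (@ones R n)^T).
have AE i k : A i k = W i k - n%:R^-1.
  by rewrite /A !mxE big_ord1 !mxE mulr1 mulr1.
pose c (j : 'I_d) : 'rV[R]_n := \row_k y k 0 j.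
have cA i j : (gossip z i - vmean z) 0 j = (c j *m A^T) 0 i.
  have -> : gossip z i - vmean z = \sum_k A i k *: y k.
    transitivity (\sum_k W i k *: y k).
      rewrite /gossip /y; under [RHS]eq_bigr do rewrite scalerBr.
      by rewrite sumrB -scaler_suml Wr scale1r.
    apply/eqP; rewrite -subr_eq0 -sumrB; apply/eqP.
    under eq_bigr do rewrite AE -scalerBl opprB addrC subrK.
    by rewrite -scaler_sumr sum_sub_vmean scaler0.
  by rewrite summxE !mxE; apply: eq_bigr => k _; rewrite !mxE mulrC.
have swap (u : 'I_n -> 'rV[R]_d) (w : 'I_d -> 'rV[R]_n) : (forall i j, u i 0 j = w j 0 i) ->
    \sum_i enorm (u i) ^+ 2 = \sum_j enorm (w j) ^+ 2.
  move=> uw; under eq_bigr do rewrite sqr_enorm; under [RHS]eq_bigr do rewrite sqr_enorm.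
  by rewrite exchange_big; do 2![apply: eq_bigr => ? _]; rewrite uw.
rewrite (swap _ (fun j => c j *m A^T))// (swap _ c); last by move=> i j; rewrite !mxE.
rewrite mulr_sumr; apply: ler_sum => j _.
by rewrite -exprMn ler_pXn2r ?nnegrE ?mulr_ge0 ?enorm_ge0// enorm_mul_le.
Qed.

End Agents.

(** * Strong convexity of the average and the cost of disagreement *)

Section Objectives.
Context {R : realType} {n d : nat}.
Hypothesis n0 : (0 < n)%N.
Implicit Types (x y z u p : 'rV[R]_d) (F : 'rV[R]_d -> R).

Let nR0 : n%:R != 0 :> R. Proof. by rewrite pnatr_eq0 -lt0n. Qed.
Let nV0 : 0 <= n%:R^-1 :> R. Proof. by rewrite invr_ge0. Qed.

Lemma class_F2_smooth_pair (L Lbar : R) F : 0 <= L -> 0 <= Lbar ->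
  class_F2 L F -> smooth2 Lbar F -> smooth_pair L Lbar F (grad F).
Proof. by move=> L0 Lb0 [_ h1] [_ h2]; split. Qed.

Lemma grad_average (f : 'I_n -> 'rV[R]_d -> R) x :
  (forall i y, differentiable (f i) y) ->
  grad (average f) x = vmean (fun i => grad (f i) x).
Proof.
move=> df; apply/rowP => j; rewrite !mxE summxE.
have der i : derivable (f i) x (delta_mx 0 j) by exact: diff_derivable.
have -> : average f = n%:R^-1 *: (\sum_(i < n) f i).
  by apply/funext => y; rewrite /average fctE /GRing.scale /= fct_sumE.
rewrite deriveZ; last exact: derivable_sum.
rewrite derive_sum// /GRing.scale /=; congr (_ * _).
by apply: eq_bigr => i _; rewrite mxE.
Qed.

Lemma vmean_enorm_le (a : 'I_n -> 'rV[R]_d) (M : R) :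
  (forall i, enorm (a i) <= M) -> enorm (vmean a) <= M.
Proof.
move=> aM; rewrite enormZ ger0_norm// ler_pdivrMl ?ltr0n//.
have tri (r : seq 'I_n) : enorm (\sum_(i <- r) a i) <= \sum_(i <- r) enorm (a i).
  elim: r => [|i r IH]; first by rewrite !big_nil enorm0.
  by rewrite !big_cons; apply: le_trans (enormD _ _) _; rewrite lerD2l.
apply: le_trans (tri _) _; apply: (@le_trans _ _ (\sum_(i < n) M)); first exact: ler_sum.
by rewrite sumr_const card_ord mulr_natl.
Qed.

Lemma vmeanB (a b : 'I_n -> 'rV[R]_d) : vmean (fun i => a i - b i) = vmean a - vmean b.
Proof. by rewrite /vmean sumrB scalerBr. Qed.

Lemma dotp_vmean (a : 'I_n -> 'rV[R]_d) p : dotp (vmean a) p = n%:R^-1 * \sum_i dotp (a i) p.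
Proof. by rewrite dotpZl dotp_suml. Qed.

Lemma smooth_pair_average (L Lb : R) (f : 'I_n -> 'rV[R]_d -> R) (G : 'I_n -> 'rV[R]_d -> 'rV[R]_d) :
  (forall i, smooth_pair L Lb (f i) (G i)) ->
  smooth_pair L Lb (average f) (fun x => vmean (fun i => G i x)).
Proof.
move=> fG; have [L0 Lb0 _ _] := fG (Ordinal n0).
split=> // x z; last first.
  rewrite -vmeanB; apply: vmean_enorm_le => i.
  by have [_ _ _] := fG i; apply.
rewrite dotp_vmean /average -mulrBr -mulrBr -!sumrB normrM ger0_norm//.
rewrite ler_pdivrMl ?ltr0n//; apply: le_trans (ler_norm_sum _ _ _) _.
apply: (@le_trans _ _ (\sum_(i < n) L * enorm (z - x) ^+ 2)).
  by apply: ler_sum => i _; have [_ _ h _] := fG i; exact: h.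
by rewrite sumr_const card_ord mulr_natl.
Qed.

Section StronglyConvex.
Variables (alpha L Lb : R) (F : 'rV[R]_d -> R).
Hypothesis alpha0 : 0 < alpha.
Hypothesis Fsc : strongly_convex alpha F.
Hypothesis FG : smooth_pair L Lb F (grad F).

(** A unit vector compares the quadratic lower and upper bounds. It turns [alpha * K] into
    [2 * L * K], which keeps the final constant free of alpha. *)
Lemma strongly_convex_le : (0 < d)%N -> alpha <= 2 * L.
Proof.
move=> d0; have [_ h] := Fsc; have [_ _ h2 _] := FG.
have := h (delta_mx 0 (Ordinal d0)) 0; have := h2 0 (delta_mx 0 (Ordinal d0)).
by rewrite !subr0 enorm_delta expr1n !mulr1 ler_norml => /andP[_]; lra.
Qed.

Lemma strongly_convex_jensen (I : Type) (r : seq I) (w : I -> R) (y : I -> 'rV[R]_d) :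
  (forall i, 0 <= w i) -> \sum_(i <- r) w i = 1 ->
  F (\sum_(i <- r) w i *: y i) <= \sum_(i <- r) w i * F (y i).
Proof.
move=> w0 w1; have [_ h] := Fsc; set m := \sum_(i <- r) _.
have : \sum_(i <- r) w i * (F m + dotp (grad F m) (y i - m)) <= \sum_(i <- r) w i * F (y i).
  apply: ler_sum => i _; rewrite ler_wpM2l//.
  by have := h (y i) m; have := mulr_ge0 (ltW alpha0) (sqr_ge0 (enorm (y i - m))); lra.
apply: le_trans.
have e i : w i * (F m + dotp (grad F m) (y i - m)) =
    w i * (F m - dotp m (grad F m)) + dotp (w i *: y i) (grad F m).
  by rewrite dotpZl dotpBr (dotpC (grad F m)) (dotpC (grad F m)); ring.
under eq_bigr do rewrite e.
by rewrite big_split /= -mulr_suml -dotp_suml w1 mul1r -/m subrK.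
Qed.

(** At the midpoint m of x and xstar, the strong convexity inequalities towards the two ends have
    opposite linear terms. Minimality then enters only as F xstar <= F m, with no first-order
    optimality condition; the price is alpha / 4 instead of alpha / 2. *)
Lemma strongly_convex_gap (Theta : set 'rV[R]_d) x xstar :
  convex_set (Theta : set (convex_lmodType 'rV[R]_d)) ->
  is_minimizer F Theta xstar -> Theta x ->
  alpha / 4 * enorm (x - xstar) ^+ 2 <= F x - F xstar.
Proof.
move=> cT [ts smin] tx; have [_ h] := Fsc.
set m := 2^-1 *: x + (1 - 2^-1) *: xstar.
have tm : Theta m by apply: (convex_setP cT) => //; apply/andP; split; lra.
have := smin _ tm; have := h x m; have := h xstar m.
have -> : x - m = 2^-1 *: (x - xstar).
  by apply/rowP => j; rewrite !mxE; lra.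
have -> : xstar - m = - (2^-1 *: (x - xstar)).
  by apply/rowP => j; rewrite !mxE; lra.
rewrite dotpNr enormN enormZ exprMn ger0_norm ?invr_ge0//.
set a := dotp _ _; set b := enorm _ ^+ 2; rewrite expr2; nra.
Qed.

(* Strong convexity is applied at the displaced point [x + u]; the first-order
   terms in [u] cancel up to [alpha <u, x - xstar>], which averages to 0. *)
Lemma displaced_grad_le x u xstar :
  F x - F xstar + alpha / 2 * enorm (x - xstar) ^+ 2 + alpha * dotp u (x - xstar)
    - (L + Lb) * enorm u ^+ 2 <= dotp (grad F (x + u)) (x - xstar).
Proof.
have [_ h] := Fsc; have [_ _ h2 h3] := FG.
have := h xstar (x + u).
have := h2 x (x + u); rewrite (addrAC x u) subrr add0r ler_norml => /andP[hq _].
have hg : dotp (grad F (x + u)) u <= dotp (grad F x) u + Lb * enorm u ^+ 2.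
  rewrite -lerBlDl -dotpBl; apply: le_trans (dotp_le _ _) _.
  rewrite expr2 mulrA ler_wpM2r ?enorm_ge0//.
  by have := h3 x (x + u); rewrite (addrAC x u) subrr add0r.
have e1 : enorm (xstar - (x + u)) ^+ 2 = enorm (x - xstar) ^+ 2 + 2 * dotp u (x - xstar) + enorm u ^+ 2.
  by rewrite enormBC (addrAC x u) (sqr_enormD (x - xstar)) (dotpC _ u).
have e2 : dotp (grad F (x + u)) (xstar - (x + u)) =
    - dotp (grad F (x + u)) (x - xstar) - dotp (grad F (x + u)) u.
  by rewrite !(dotpBr, dotpDr); ring.
rewrite e1 e2; have := mulr_ge0 (ltW alpha0) (sqr_ge0 (enorm u)); move: hq hg; lra.
Qed.

End StronglyConvex.

Section Consensus.
Variables (alpha L Lb G K : R) (f : 'I_n -> 'rV[R]_d -> R) (Theta : set 'rV[R]_d).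
Hypothesis alpha0 : 0 < alpha.
Hypothesis K0 : 0 <= K.
Hypothesis fdiff : forall i y, differentiable (f i) y.
Hypothesis fG : forall i, smooth_pair L Lb (f i) (grad (f i)).
Hypothesis fsc : strongly_convex alpha (average f).
Hypothesis Theta_diam : forall x y, Theta x -> Theta y -> enorm (x - y) <= K.
Hypothesis f_grad : forall i x, Theta x -> enorm (grad (f i) x) <= G.
Hypothesis Theta_convex : convex_set (Theta : set (convex_lmodType 'rV[R]_d)).

Lemma smooth_pair_objective : smooth_pair L Lb (average f) (grad (average f)).
Proof.
have := smooth_pair_average fG; congr smooth_pair; apply/funext => x.
by rewrite grad_average.
Qed.

Lemma vmean_in (x : 'I_n -> 'rV[R]_d) : (forall i, Theta (x i)) -> Theta (vmean x).
Proof.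
move=> tx; rewrite /vmean scaler_sumr; apply: (convex_set_sum Theta_convex) => //.
by rewrite sumr_const card_ord -[LHS]mulr_natr mulVf.
Qed.

(** All gradients are transported to the common point m + u, where strong convexity of the average
    applies. Moving the gradient costs Lb |x_k - m| K; moving the test vector from x_k - xstar to m
    - xstar costs (G + Lb |u|) |x_k - m|. *)
Lemma consensus_grad_le (x : 'I_n -> 'rV[R]_d) u xstar :
  (forall i, Theta (x i)) -> Theta xstar ->
  average f (vmean x) - average f xstar + alpha / 2 * enorm (vmean x - xstar) ^+ 2
    + alpha * dotp u (vmean x - xstar) - (L + Lb) * enorm u ^+ 2
    - (Lb * K + G + Lb * enorm u) * rms (fun i => x i - vmean x)
  <= n%:R^-1 * \sum_k dotp (grad (f k) (x k + u)) (x k - xstar).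
Proof.
move=> tx ts; have tm := vmean_in tx; set m := vmean x in tm *.
have [_ Lb0 _ _] := fG (Ordinal n0).
apply: (@le_trans _ _ (dotp (grad (average f) (m + u)) (m - xstar)
   - (Lb * K + G + Lb * enorm u) * rms (fun i => x i - m))).
  by rewrite lerD2r; apply: displaced_grad_le => //; exact: smooth_pair_objective.
rewrite lerBlDl -lerBlDr grad_average// dotp_vmean -mulrBr -sumrB.
apply: le_trans (ler_wpM2l _ (mean_le_rms n0 (fun i => x i - m))); last first.
  rewrite !addr_ge0 ?mulr_ge0 ?enorm_ge0//.
  exact: le_trans (enorm_ge0 _) (f_grad (Ordinal n0) tm).
rewrite mulrCA ler_wpM2l// mulr_sumr; apply: ler_sum => k _.
have [_ _ _ hk] := fG k.
have -> : dotp (grad (f k) (m + u)) (m - xstar) - dotp (grad (f k) (x k + u)) (x k - xstar)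
  = dotp (grad (f k) (m + u) - grad (f k) (x k + u)) (x k - xstar)
    + dotp (grad (f k) (m + u)) (m - x k).
  rewrite !(dotpBl, dotpBr); ring.
have h1 : enorm (grad (f k) (m + u) - grad (f k) (x k + u)) <= Lb * enorm (x k - m).
  by apply: le_trans (hk _ _) _; rewrite opprD addrACA subrr addr0 enormBC.
have h2 : enorm (grad (f k) (m + u)) <= G + Lb * enorm u.
  have := enormD (grad (f k) (m + u) - grad (f k) m) (grad (f k) m); rewrite subrK.
  have := hk m (m + u); rewrite (addrAC m u) subrr add0r.
  have := f_grad k tm; lra.
have h3 : dotp (grad (f k) (m + u) - grad (f k) (x k + u)) (x k - xstar) <= Lb * enorm (x k - m) * K.
  apply: le_trans (dotp_le _ _) _; rewrite ler_pM ?enorm_ge0//; exact: Theta_diam.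
have h4 : dotp (grad (f k) (m + u)) (m - x k) <= (G + Lb * enorm u) * enorm (x k - m).
  by apply: le_trans (dotp_le _ _) _; rewrite (enormBC m) ler_wpM2r ?enorm_ge0.
by apply: le_trans (lerD h3 h4) _; rewrite le_eqVlt; apply/orP; left; apply/eqP; ring.
Qed.

End Consensus.
End Objectives.

(** * Mean and second moment of the two-point estimator *)

Section EstimatorMean.
Context {R : realType} {n d : nat}.
Variable mu : probability 'rV[R]_d R.
Hypothesis mu_uniform : uniform_on_sphere mu.
Hypothesis n0 : (0 < n)%N.
Hypothesis d0 : (0 < d)%N.

Local Notation smean phi := (\int[mu]_z phi (on_sphere z)).

Lemma grad_estimator_noise (F : 'rV[R]_d -> R) (h : R) (x z v : 'rV[R]_d) (a b : R) :
  dotp (grad_estimator F h x z a b) v =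
  d%:R / (2 * h) * ((F (x + h *: z) - F (x + h *: (- z))) * dotp z v) +
  d%:R / (2 * h) * (a - b) * dotp z v.
Proof. by rewrite /grad_estimator dotpZl scalerN; ring. Qed.

Section OneAgent.
Variables (L Lb : R) (F : 'rV[R]_d -> R) (G : 'rV[R]_d -> 'rV[R]_d) (h : R) (x : 'rV[R]_d).
Hypothesis FG : smooth_pair L Lb F G.

Let Fh (u : 'rV[R]_d) : R := F (x + h *: u).
Let FGh := smooth_pair_affine x h FG.

Lemma displaced_has_mean v : has_mean mu (fun z => F (x + h *: on_sphere z) * dotp (on_sphere z) v).
Proof. by have [] := sphere_mean_has_mean mu v FGh. Qed.

Let measurable_dotp_cst (v : 'rV[R]_d) : measurable_fun setT (fun z : 'rV[R]_d => dotp z v).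
Proof. by apply: measurable_dotp; [exact: measurable_id|exact: measurable_cst]. Qed.

Let measurable_Fh v : measurable_fun setT (fun z : 'rV[R]_d => Fh z * dotp z v).
Proof.
apply: measurable_funM; last exact: measurable_dotp_cst.
exact: (continuous_measurable_rV (smooth_pair_continuous FGh)).
Qed.

Lemma linear_has_mean (v : 'rV[R]_d) : has_mean mu (fun z => dotp (on_sphere z) v).
Proof.
apply: (@has_mean_sphere _ _ mu (fun z => dotp z v) (1 * enorm v)) => // y y1.
exact: dotp_sphere_le.
Qed.

Lemma linear_sphere_mean (v : 'rV[R]_d) : smean (fun z => dotp z v) = 0.
Proof.
apply: (@sphere_mean_odd _ _ _ mu_uniform (fun z => dotp z v) (1 * enorm v)) => // [y y1|y].
  exact: dotp_sphere_le.
exact: dotpNl.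
Qed.

(** Antipodal symmetry: the backward evaluation contributes as much to the mean as the forward
    one. *)
Lemma displaced_opp v :
  has_mean mu (fun z => F (x + h *: (- on_sphere z)) * dotp (on_sphere z) v) /\
  smean (fun z => F (x + h *: (- z)) * dotp z v) = - smean (fun z => F (x + h *: z) * dotp z v).
Proof.
have [M [M0 FM]] := smooth_pair_bound FGh.
have bd y : enorm y <= 1 -> `|Fh y * dotp y v| <= M * (1 * enorm v).
  by move=> y1; rewrite normrM ler_pM ?(FM y y1).1// dotp_sphere_le.
have Q1 : (- 1%:M : 'M[R]_d) *m (- 1%:M)^T = 1%:M.
  by rewrite linearN/= trmx1 mulNmx mulmxN opprK mulmx1.
have hm : has_mean mu (fun z => F (x + h *: (- on_sphere z)) * dotp (on_sphere z) v).
  apply: (@has_mean_sphere _ _ mu (fun z => F (x + h *: (- z)) * dotp z v) (M * (1 * enorm v))) => [|y y1].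
    have := measurableT_comp (measurable_Fh v) (measurable_mulmxr (- 1%:M)).
    have -> : (fun z => F (x + h *: (- z)) * dotp z v) = (fun z => - 1 * (Fh (z *m (- 1%:M)) * dotp (z *m (- 1%:M)) v)).
      by apply/funext => z; rewrite mulmxN mulmx1 dotpNl mulrN mulN1r opprK.
    by move=> m; apply: measurable_funM => //; exact: measurable_cst.
  have := bd (- y); rewrite enormN => /(_ y1).
  by rewrite dotpNl mulrN normrN.
split=> //.
have := sphere_mean_rotation mu_uniform Q1 (measurable_Fh v) bd.
have -> : \int[mu]_z (Fh (on_sphere z *m (- 1%:M)) * dotp (on_sphere z *m (- 1%:M)) v) =
    \int[mu]_z (- 1 * (F (x + h *: (- on_sphere z)) * dotp (on_sphere z) v)).
  by apply: eq_Rintegral => z _; rewrite mulmxN mulmx1 dotpNl mulrN mulN1r.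
by rewrite RintZ// mulN1r => <-; rewrite opprK.
Qed.

(** For frozen noise values a and b, the noise term is linear in z and has mean 0; the two equal
    evaluations turn d / (2h) into d / h. *)
Lemma estimator_sphere_mean (a b : R) v : h != 0 ->
  has_mean mu (fun z => dotp (grad_estimator F h x (on_sphere z) a b) v) /\
  smean (fun z => dotp (grad_estimator F h x z a b) v) =
  d%:R / h * smean (fun z => F (x + h *: z) * dotp z v).
Proof.
move=> h0; have [hm1 e1] := displaced_opp v; have hm2 := displaced_has_mean v.
have hm3 := has_meanZ (d%:R / (2 * h) * (a - b)) (linear_has_mean v).
have e : (fun z => dotp (grad_estimator F h x (on_sphere z) a b) v) =
  (fun z => d%:R / (2 * h) * (F (x + h *: on_sphere z) * dotp (on_sphere z) v -
     F (x + h *: (- on_sphere z)) * dotp (on_sphere z) v) +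
    d%:R / (2 * h) * (a - b) * dotp (on_sphere z) v).
  by apply/funext => z; rewrite grad_estimator_noise -mulrBl.
have hm4 := has_meanZ (d%:R / (2 * h)) (has_meanB hm2 hm1).
split; first by rewrite e; exact: (has_meanD hm4 hm3).
rewrite e RintD// !RintZ//; [|exact: linear_has_mean|exact: has_meanB].
rewrite RintB// e1 linear_sphere_mean mulr0 addr0 opprK.
by field.
Qed.

End OneAgent.

(** In the symmetric difference the value at x cancels and the linear parts add up, so |D| <= 2 h G
    + 2 L h^2; the square of D + a - b is then split in three with factor 3. *)
Lemma estimator_sqr_le (L Lb G h a b : R) (F : 'rV[R]_d -> R) (x z : 'rV[R]_d) : 0 < h ->
  smooth_pair L Lb F (grad F) -> enorm (grad F x) <= G -> enorm z <= 1 ->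
  enorm (grad_estimator F h x z a b) ^+ 2 <=
  6 * d%:R ^+ 2 * G ^+ 2 + 6 * d%:R ^+ 2 * L ^+ 2 * h ^+ 2 +
    3 * d%:R ^+ 2 / (4 * h ^+ 2) * (a ^+ 2 + b ^+ 2).
Proof.
move=> h0 [L0 _ hF _] xG z1.
have G0 : 0 <= G := le_trans (enorm_ge0 _) xG.
set D := F (x + h *: z) - F (x - h *: z).
have hD : `|D| <= 2 * h * G + 2 * L * h ^+ 2.
  have := hF x (x + h *: z); have := hF x (x - h *: z).
  rewrite ![x + _ - x](addrAC x) subrr !add0r -scalerN !dotpZr dotpNr !enormZ enormN.
  rewrite (gtr0_norm h0).
  set g := dotp (grad F x) z => h1 h2.
  have hz : (h * enorm z) ^+ 2 <= h ^+ 2.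
    by rewrite ler_pXn2r ?nnegrE ?mulr_ge0 ?enorm_ge0 ?(ltW h0)// ler_piMr// ltW.
  have hLz := ler_wpM2l L0 hz.
  have gG : `|g| <= G 
    by apply: le_trans (norm_dotp_le _ _) _; apply: le_trans xG; rewrite ler_piMr ?enorm_ge0.
  have -> : D = (F (x + h *: z) - F x - h * g) - (F (x + h *: - z) - F x - h * - g) + 2 * h * g.
    by rewrite /D scalerN; ring.
  apply: le_trans (ler_normD _ _) _.
  have hg : `|2 * h * g| <= 2 * h * G by rewrite normrM gtr0_norm ?mulr_gt0// ler_wpM2l// mulr_ge0// ltW.
  by have := ler_normB (F (x + h *: z) - F x - h * g) (F (x + h *: - z) - F x - h * - g); lra.
have hD2 : D ^+ 2 <= 8 * h ^+ 2 * G ^+ 2 + 8 * L ^+ 2 * h ^+ 4.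
  have : D ^+ 2 <= (2 * h * G + 2 * L * h ^+ 2) ^+ 2.
    rewrite -real_normK ?num_real// ler_pXn2r ?nnegrE// addr_ge0// !mulr_ge0 ?sqr_ge0//; exact: ltW.
  have := sqr_ge0 (2 * h * G - 2 * L * h ^+ 2); nra.
have -> : grad_estimator F h x z a b = (d%:R / (2 * h) * (D + (a - b))) *: z.
  by rewrite /grad_estimator /D; congr (_ *: _); ring.
rewrite enormZ exprMn real_normK ?num_real//.
apply: (@le_trans _ _ ((d%:R / (2 * h) * (D + (a - b))) ^+ 2)).
  by rewrite ler_piMr ?sqr_ge0// exprn_ile1 ?enorm_ge0.
have h2 : (D + (a - b)) ^+ 2 <= 3 * D ^+ 2 + 3 * a ^+ 2 + 3 * b ^+ 2.
  have := sqr_ge0 (D - a); have := sqr_ge0 (D + b); have := sqr_ge0 (a + b); nra.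
have c0 : 0 <= d%:R ^+ 2 / (4 * h ^+ 2) by rewrite divr_ge0 ?sqr_ge0// mulr_ge0// sqr_ge0.
have hn0 : h != 0 by rewrite gt_eqF.
rewrite exprMn; have -> : (d%:R / (2 * h)) ^+ 2 = d%:R ^+ 2 / (4 * h ^+ 2) by field.
apply: le_trans (ler_wpM2l c0 h2) _.
have := ler_wpM2l c0 hD2.
have -> : d%:R ^+ 2 / (4 * h ^+ 2) * (8 * h ^+ 2 * G ^+ 2 + 8 * L ^+ 2 * h ^+ 4) =
   2 * d%:R ^+ 2 * G ^+ 2 + 2 * d%:R ^+ 2 * L ^+ 2 * h ^+ 2 by field.
have -> : 3 * d%:R ^+ 2 / (4 * h ^+ 2) = 3 * (d%:R ^+ 2 / (4 * h ^+ 2)) by field.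
lra.
Qed.

Section AllAgents.
Variables (alpha L Lb G K h : R) (f : 'I_n -> 'rV[R]_d -> R) (Theta : set 'rV[R]_d).
Hypothesis alpha0 : 0 < alpha.
Hypothesis K0 : 0 <= K.
Hypothesis h0 : 0 < h.
Hypothesis fdiff : forall i y, differentiable (f i) y.
Hypothesis fG : forall i, smooth_pair L Lb (f i) (grad (f i)).
Hypothesis fsc : strongly_convex alpha (average f).
Hypothesis Theta_diam : forall x y, Theta x -> Theta y -> enorm (x - y) <= K.
Hypothesis f_grad : forall i x, Theta x -> enorm (grad (f i) x) <= G.
Hypothesis Theta_convex : convex_set (Theta : set (convex_lmodType 'rV[R]_d)).

(** Each summand is a mean over its own direction, so the sum equals a single mean with one z shared
    by all agents. The common displacement u = h r z is then admissible in [consensus_grad_le] at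
    each radius r. *)
Lemma consensus_estimator_ge (x : 'I_n -> 'rV[R]_d) (a b : 'I_n -> R) xstar :
  (forall i, Theta (x i)) -> Theta xstar ->
  average f (vmean x) - average f xstar + alpha / 2 * enorm (vmean x - xstar) ^+ 2
    - (L + Lb) * h ^+ 2 - (Lb * K + G + Lb * h) * rms (fun i => x i - vmean x)
  <= n%:R^-1 * \sum_k smean (fun z => dotp (grad_estimator (f k) h (x k) z (a k) (b k)) (x k - xstar)).
Proof.
move=> tx ts; set A := (X in X <= _).
have hn0 : h != 0 by rewrite gt_eqF.
have nR0 : 0 < n%:R :> R by rewrite ltr0n.
have [L0 Lb0 _ _] := fG (Ordinal n0).
have fGh k := smooth_pair_affine (x k) h (fG k).
(* The factor n h clears 1/n and d/h; one h also comes from the gradient of u |-> f_k (x_k + h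
   u). *)
suff key : n%:R * h * A <= d%:R * \sum_k smean (fun z => f k (x k + h *: z) * dotp z (x k - xstar)).
  under eq_bigr do rewrite (estimator_sphere_mean (x _) (fG _) _ _ _ hn0).2.
  by rewrite -mulr_sumr ler_pdivlMl// [leRHS]mulrAC ler_pdivlMr// mulrAC.
apply: (sphere_ball_le mu_uniform d0 fGh) => r /andP[r0 r1].
have hmk k : has_mean mu (fun z => dotp (h *: grad (f k) (x k + h *: (r *: on_sphere z))) (x k - xstar)).
  have [M [M0 FM]] := smooth_pair_bound (fGh k).
  have [_ mG] := smooth_pair_measurable (fGh k).
  apply: (@has_mean_bounded _ _ _ _ _ (M * enorm (x k - xstar))) => [|z].
    apply: measurable_dotp; last exact: measurable_cst.
    apply: (measurableT_comp mG); apply: measurable_scalev; first exact: measurable_cst.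
    exact: measurable_on_sphere.
  apply: dotp_sphere_le; apply: (FM _ _).2; rewrite enormZ ger0_norm//.
  by rewrite mulr_ile1 ?enorm_ge0// enorm_on_sphere_le.
rewrite -Rint_sum//.
(* Adding a linear term of mean 0, namely the alpha <u, m - xstar> of [consensus_grad_le], makes the
   inequality hold pointwise in z. *)
have -> : n%:R * h * A = \int[mu]_z (n%:R * h * A +
     (n%:R * h * (alpha * (h * r))) * dotp (on_sphere z) (vmean x - xstar)).
  rewrite RintD; [|exact: has_mean_cst|exact/has_meanZ/linear_has_mean].
  by rewrite Rint_cst RintZ ?linear_sphere_mean ?mulr0 ?addr0//; exact: linear_has_mean.
apply: Rint_le => [||z].
- by apply: has_meanD; [exact: has_mean_cst|exact/has_meanZ/linear_has_mean].
- exact: has_mean_sum.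
set y := on_sphere z; have y1 : enorm y <= 1 := enorm_on_sphere_le z.
have le := consensus_grad_le n0 alpha0 K0 fdiff fG fsc Theta_diam f_grad Theta_convex (h *: (r *: y)) tx ts.
under eq_bigr do rewrite dotpZl.
rewrite -mulr_sumr; move: le; rewrite ler_pdivlMl// -(ler_pM2l h0); apply: le_trans.
have nu : enorm (h *: (r *: y)) <= h.
  rewrite !enormZ (gtr0_norm h0) (ger0_norm r0) -[leRHS]mulr1 ler_wpM2l ?(ltW h0)//.
  by rewrite mulr_ile1 ?enorm_ge0.
rewrite !dotpZl; set e := dotp y _.
have h1 : (L + Lb) * enorm (h *: (r *: y)) ^+ 2 <= (L + Lb) * h ^+ 2.
  by rewrite ler_wpM2l ?addr_ge0// ler_pXn2r ?nnegrE ?enorm_ge0 ?(ltW h0).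
have h2 : (Lb * K + G + Lb * enorm (h *: (r *: y))) * rms (fun i => x i - vmean x) <=
    (Lb * K + G + Lb * h) * rms (fun i => x i - vmean x).
  by rewrite ler_wpM2r ?rms_ge0// lerD2l ler_wpM2l.
have -> : n%:R * h * A + n%:R * h * (alpha * (h * r)) * e = h * (n%:R * (A + alpha * (h * (r * e)))).
  by ring.
rewrite ler_pM2l// ler_pM2l// /A; lra.
Qed.

End AllAgents.
End EstimatorMean.

(** * Deterministic analysis of the coupled recursions *)

Section Recursion.
Context {R : realType}.
Variables (alpha K C P rho : R) (T : nat) (V a g : nat -> R).
Hypotheses (alpha0 : 0 < alpha) (C0 : 0 <= C) (CP : C <= P).
Hypotheses (rho0 : 0 <= rho) (rho1 : rho < 1) (alphaK : alpha * K <= 2 * C).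
Hypothesis V0 : forall t, (1 <= t)%N -> (t <= T.+1)%N -> 0 <= V t.
Hypothesis aK : forall t, (1 <= t)%N -> (t <= T)%N -> 0 <= a t <= K.
Hypothesis a_rec : forall t, (1 <= t)%N -> (t <= T)%N ->
  a t.+1 <= rho * (a t + P / (alpha * t%:R)).
Hypothesis V_rec : forall t, (1 <= t)%N -> (t <= T)%N ->
  V t.+1 <= V t - V t / t%:R - 2 / (alpha * t%:R) * g t
            + 2 * C / (alpha * t%:R) * a t + 2 * P / (alpha * t%:R) ^+ 2.
Hypothesis gap : forall t, (1 <= t)%N -> (t <= T)%N -> alpha / 4 * (V t - K * a t) <= g t.

Let delta := 1 - rho.
Let delta0 : 0 < delta. Proof. by rewrite subr_gt0. Qed.
Let delta1 : delta <= 1. Proof. by rewrite lerBlDr lerDl. Qed.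
Let P0 : 0 <= P. Proof. exact: le_trans CP. Qed.

(* For [delta * t <= 2] the trivial bound [a t <= K] is used: contraction alone
   does not give the decay 1/t there. *)
Lemma deviation_bound t : (1 <= t)%N -> (t <= T)%N -> a t <= 4 * P / (alpha * delta * t%:R).
Proof.
have [hC hCP hrho hrho1 haK] : [/\ 0 <= C, C <= P, 0 <= rho, rho < 1 & alpha * K <= 2 * C] by [].
have [hd0 hd1 hP0] : [/\ 0 < delta, delta <= 1 & 0 <= P] by [].
elim: t => // t IH _ tT.
have tp : 0 < t.+1%:R :> R by rewrite ltr0n.
have den : 0 < alpha * delta * t.+1%:R by rewrite !mulr_gt0.
have [dt|dt] := leP (delta * t.+1%:R) 2.
  rewrite ler_pdivlMr//.
  have /andP[a0 ak] := aK (ltn0Sn t) tT.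
  have K0 : 0 <= K := le_trans a0 ak.
  have h1 : a t.+1 * (alpha * delta * t.+1%:R) <= K * (alpha * delta * t.+1%:R).
    by rewrite ler_wpM2r// ltW.
  (* Origin of the constant 4: the bound 2 C on alpha K times the threshold 2, followed by C <=
     P. *)
  have h2 : alpha * K * (delta * t.+1%:R) <= 2 * C * 2.
    by rewrite ler_pM// ?mulr_ge0// ltW.
  by lra.
(* The recursion is never started at t = 0: there delta <= 1 excludes delta * 1 > 2. *)
have [t0|t0] := posnP t.
  by move: dt; rewrite t0 mulr1 => dt; exfalso; have := delta1; move: dt; lra.
have tT' : (t <= T)%N by exact: ltnW.
have t0R : 0 < t%:R :> R by rewrite ltr0n.
apply: le_trans (a_rec t0 tT') _.
apply: (@le_trans _ _ (rho * (4 * P / (alpha * delta * t%:R) + P / (alpha * t%:R)))).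
  by rewrite ler_wpM2l// lerD2r IH.
rewrite ler_pdivlMr//.
have -> : rho * (4 * P / (alpha * delta * t%:R) + P / (alpha * t%:R)) * (alpha * delta * t.+1%:R)
   = P * (rho * (4 + delta) * t.+1%:R / t%:R).
  by field; rewrite !gt_eqF.
rewrite mulrC ler_wpM2r// ler_pdivrMr//.
(* The claim (1 - delta)(4 + delta)(t + 1) <= 4 t amounts to 4 <= (3 delta + delta^2)(t + 1), which
   follows from delta (t + 1) > 2. *)
have -> : rho = 1 - delta by rewrite /delta; ring.
have e : t.+1%:R = t%:R + 1 :> R by rewrite -natr1.
rewrite e in dt *.
have := sqr_ge0 delta; nra.
Qed.

(** [12 * C] is the total coefficient 3 C of the deviation times the 4 of [deviation_bound]; the 2
    is the variance term. *)
Let b := (12 * C + 2) * P / (alpha ^+ 2 * delta).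
Let b0 : 0 <= b.
Proof.
apply: divr_ge0; first by rewrite mulr_ge0// addr_ge0// mulr_ge0.
by rewrite mulr_ge0 ?sqr_ge0 ?(ltW delta0).
Qed.

(** By [gap], the term (2 / alpha) g_t is worth V_t / 2 up to a multiple of a_t, which lowers the
    coefficient from t - 1 to t - 3/2. *)
Lemma lyapunov_step t : (1 <= t)%N -> (t <= T)%N ->
  t%:R * V t.+1 <= (t%:R - 3 / 2) * V t + b / t%:R.
Proof.
have [hC hCP hrho hrho1 haK] : [/\ 0 <= C, C <= P, 0 <= rho, rho < 1 & alpha * K <= 2 * C] by [].
have [hd0 hd1 hP0] : [/\ 0 < delta, delta <= 1 & 0 <= P] by [].
move=> t1 tT; have t0R : 0 < t%:R :> R by rewrite ltr0n.
have n1 : t%:R != 0 :> R by rewrite gt_eqF.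
have n2 : alpha != 0 by rewrite gt_eqF.
have n3 : delta != 0 by rewrite gt_eqF.
have /andP[a0 ak] := aK t1 tT.
have h1 := ler_wpM2l (ltW t0R) (V_rec t1 tT).
have e1 : t%:R * (V t - V t / t%:R - 2 / (alpha * t%:R) * g t
            + 2 * C / (alpha * t%:R) * a t + 2 * P / (alpha * t%:R) ^+ 2) =
   (t%:R - 1) * V t - 2 / alpha * g t + 2 * C / alpha * a t + 2 * P / (alpha ^+ 2 * t%:R).
  by field; rewrite n1 n2.
rewrite e1 in h1.
have h2 : V t / 2 - K / 2 * a t <= 2 / alpha * g t.
  have c0 : 0 <= 2 / alpha by rewrite divr_ge0// ltW.
  have := ler_wpM2l c0 (gap t1 tT).
  by have -> : 2 / alpha * (alpha / 4 * (V t - K * a t)) = V t / 2 - K / 2 * a t by field.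
have hK : K / 2 <= C / alpha by rewrite ler_pdivlMr//; lra.
have h3 : (K / 2 + 2 * C / alpha) * a t <= 3 * C / alpha * (4 * P / (alpha * delta * t%:R)).
  have K0 : 0 <= K := le_trans a0 ak.
  have q0 : 0 <= 2 * C / alpha by rewrite divr_ge0 ?mulr_ge0// ltW.
  apply: ler_pM => //; [by lra|by lra|exact: deviation_bound].
have h4 : 2 * P / (alpha ^+ 2 * t%:R) <= 2 * P / (alpha ^+ 2 * delta * t%:R).
  rewrite ler_wpM2l ?mulr_ge0// lef_pV2 ?posrE ?mulr_gt0 ?exprn_gt0//.
  by rewrite ler_pM2r// ler_piMr ?sqr_ge0.
have e2 : b / t%:R = 3 * C / alpha * (4 * P / (alpha * delta * t%:R)) + 2 * P / (alpha ^+ 2 * delta * t%:R).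
  by rewrite /b; field; rewrite n1 n2 n3.
rewrite e2; lra.
Qed.

(** The factor 1 - 1/(2t) applied to the bound 2 b frees exactly b / t, which pays for the error of
    the next round. *)
Lemma lyapunov_bound t : (t <= T)%N -> t%:R * V t.+1 <= 2 * b.
Proof.
elim: t => [|t IH] tT; first by rewrite mul0r mulr_ge0.
have {}IH := IH (ltnW tT).
apply: le_trans (lyapunov_step (ltn0Sn t) tT) _.
have v0 : 0 <= V t.+1 by apply: V0 => //; exact: ltnW.
(* In the first round the coefficient 1 - 3/2 is negative, so the initial distance drops out. *)
have [t0|t0] := posnP t.
  by rewrite t0 in v0 *; rewrite divr1; have := b0; lra.
have t0R : 0 < t%:R :> R by rewrite ltr0n.
have e : t.+1%:R = t%:R + 1 :> R by rewrite -natr1.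
have h1 : (t%:R - 2^-1) * V t.+1 <= 2 * b - b / t%:R.
  have -> : (t%:R - 2^-1) * V t.+1 = (1 - (2 * t%:R)^-1) * (t%:R * V t.+1).
    by field; rewrite gt_eqF.
  have -> : 2 * b - b / t%:R = (1 - (2 * t%:R)^-1) * (2 * b) by field; rewrite gt_eqF.
  rewrite ler_wpM2l// subr_ge0 invf_le1 ?mulr_gt0//.
  have : 1 <= t%:R :> R by rewrite ler1n.
  lra.
have h2 : b / t.+1%:R <= b / t%:R.
  by rewrite ler_wpM2l// lef_pV2 ?posrE ?ltr0n// ler_nat.
move: h2; rewrite e => h2; lra.
Qed.

(** Multiplying the recursion for V by alpha t / 2 makes it telescope, because t (1 - 1/t) = t - 1.
    The error terms, bounded by multiples of 1/t, are replaced by their bounds at t = m + 1. *)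
Lemma gap_sum_le m N : (m <= N)%N -> (N <= T)%N ->
  \sum_(m.+1 <= t < N.+1) g t <= alpha / 2 * (m%:R * V m.+1 - N%:R * V N.+1) +
    (N%:R - m%:R) * ((4 * C + 1) * P / (alpha * delta * m.+1%:R)).
Proof.
set e := (4 * C + 1) * P / _.
elim: N => [|N IH] mN NT.
  by move: mN; rewrite leqn0 => /eqP ->; rewrite big_geq// !subrr mul0r mulr0 addr0.
have [mN1|mN1] := eqVneq m N.+1.
  by rewrite -mN1 big_geq// !subrr mul0r mulr0 addr0.
have {}mN : (m <= N)%N by rewrite -ltnS ltn_neqAle mN1.
have {}IH := IH mN (ltnW NT).
rewrite big_nat_recr //=.
apply: le_trans (lerD IH (lexx _)) _.
have tp : 0 < N.+1%:R :> R by rewrite ltr0n.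
have n1 : N.+1%:R != 0 :> R by rewrite gt_eqF.
have n2 : alpha != 0 by rewrite gt_eqF.
have c0 : 0 <= alpha * N.+1%:R / 2 by rewrite divr_ge0// mulr_ge0// ltW.
have h1 := ler_wpM2l c0 (V_rec (ltn0Sn N) NT).
have e1 : alpha * N.+1%:R / 2 * (V N.+1 - V N.+1 / N.+1%:R - 2 / (alpha * N.+1%:R) * g N.+1
            + 2 * C / (alpha * N.+1%:R) * a N.+1 + 2 * P / (alpha * N.+1%:R) ^+ 2) =
   alpha / 2 * ((N.+1%:R - 1) * V N.+1) - g N.+1 + C * a N.+1 + P / (alpha * N.+1%:R).
  by move: n1; move: (N.+1%:R) => M n1; field; rewrite n2 n1.
rewrite e1 in h1.
have mle : m.+1%:R <= N.+1%:R :> R by rewrite ler_nat.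
have mp : 0 < m.+1%:R :> R by rewrite ltr0n.
have h2 : C * a N.+1 <= C * (4 * P / (alpha * delta * m.+1%:R)).
  rewrite ler_wpM2l//; apply: le_trans (deviation_bound (ltn0Sn N) NT) _.
  by rewrite ler_wpM2l ?mulr_ge0// lef_pV2 ?posrE ?mulr_gt0// ler_pM2l// mulr_gt0.
have h3 : P / (alpha * N.+1%:R) <= P / (alpha * delta * m.+1%:R).
  rewrite ler_wpM2l// lef_pV2 ?posrE ?mulr_gt0// -mulrA ler_pM2l//.
  by apply: le_trans mle; rewrite ler_piMl// ltW.
have e2 : e = C * (4 * P / (alpha * delta * m.+1%:R)) + P / (alpha * delta * m.+1%:R).
  by rewrite /e; ring.
have e3 : N.+1%:R = N%:R + 1 :> R by rewrite -natr1.
rewrite e3 in h1 *.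
have : C * a N.+1 + P / (alpha * (N%:R + 1)) <= e by rewrite -e3 e2 lerD.
move: h1; rewrite addrK; lra.
Qed.

(** Both T - m and m + 1 are at least T / 2. Hence 24 C + 4 from alpha b and 8 C + 2 from the error
    terms, adding up to 32 C + 6. *)
Lemma tail_gap_bound m : (1 <= T)%N -> (2 * m < T)%N -> (T <= 2 * m.+1)%N ->
  (T%:R - m%:R)^-1 * \sum_(m.+1 <= t < T.+1) g t <=
  (32 * C + 6) * P / ((1 - rho) * alpha * T%:R).
Proof.
move=> T1 mT Tm.
have mT' : (m < T)%N by apply: leq_ltn_trans mT; rewrite leq_pmull.
have T0 : 0 < T%:R :> R by rewrite ltr0n.
have hm : T%:R / 2 <= T%:R - m%:R :> R.
  have : 2 * m%:R <= T%:R :> R by rewrite -natrM ler_nat ltnW.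
  lra.
have hm1 : T%:R / 2 <= m.+1%:R :> R.
  have : T%:R <= 2 * m.+1%:R :> R by rewrite -natrM ler_nat.
  lra.
have p0 : 0 < T%:R - m%:R :> R by apply: lt_le_trans hm; rewrite divr_gt0.
have n2 : alpha != 0 by rewrite gt_eqF.
have n3 : delta != 0 by rewrite gt_eqF.
have nT : T%:R != 0 :> R by rewrite gt_eqF.
rewrite mulrC ler_pdivrMr//.
apply: le_trans (gap_sum_le (ltnW mT') (leqnn T)) _.
have h1 : alpha / 2 * (m%:R * V m.+1 - T%:R * V T.+1) <= alpha * b.
  have v0 : 0 <= T%:R * V T.+1 by rewrite mulr_ge0 ?V0.
  have a2 : 0 <= alpha / 2 by rewrite divr_ge0// ltW.
  have := lyapunov_bound (ltnW mT') => h.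
  have : alpha / 2 * (m%:R * V m.+1 - T%:R * V T.+1) <= alpha / 2 * (2 * b) by rewrite ler_wpM2l//; lra.
  by move=> h'; apply: le_trans h' _; rewrite le_eqVlt; apply/orP; left; apply/eqP; field.
have c0 : 0 <= (4 * C + 1) * P by rewrite mulr_ge0// addr_ge0// mulr_ge0.
have h2 : (4 * C + 1) * P / (alpha * delta * m.+1%:R) <= (4 * C + 1) * P / (alpha * delta * (T%:R / 2)).
  by rewrite ler_wpM2l// lef_pV2 ?posrE ?mulr_gt0 ?divr_gt0// ler_pM2l// mulr_gt0.
have h3 := ler_wpM2l (ltW p0) h2.
have h4 : alpha * b <= (T%:R - m%:R) * (alpha * b / (T%:R / 2)).
  rewrite [leRHS]mulrA ler_pdivlMr ?divr_gt0// [leLHS]mulrC.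
  by apply: ler_wpM2r => //; rewrite mulr_ge0 ?(ltW alpha0).
apply: le_trans (lerD (le_trans h1 h4) h3) _.
rewrite -mulrDr mulrC ler_pM2r// -/delta le_eqVlt; apply/orP; left; apply/eqP.
by rewrite /b; field; rewrite n2 n3 nT.
Qed.

End Recursion.

(** * Size of the perturbation parameter *)

Section Schedule.
Context {R : realType}.
Variables (d T t : nat) (L sigma alpha : R).
Hypotheses (d0 : (0 < d)%N) (t0 : (0 < t)%N) (tT : (t <= T)%N).
Hypotheses (L0 : 0 < L) (sigma0 : 0 < sigma) (alpha0 : 0 < alpha).

(** The Q of the overview: divided by alpha T it is the bracket of the theorem. It involves T rather
    than t, so one bound serves all rounds. *)
Definition rate_scale : R := d%:R ^+ 2 + d%:R * Num.sqrt (alpha * T%:R).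

Let h : R := @perturbation R d L sigma alpha t.
Let den : R := 2 * L * alpha * t%:R + 9 * L ^+ 2 * d%:R ^+ 2.

Let dR : 0 < d%:R :> R. Proof. by rewrite ltr0n. Qed.
Let tR : 0 < t%:R :> R. Proof. by rewrite ltr0n. Qed.
Let L_ge0 : 0 <= L. Proof. exact: ltW. Qed.
Let sigma_ge0 : 0 <= sigma. Proof. exact: ltW. Qed.
Let alpha_ge0 : 0 <= alpha. Proof. exact: ltW. Qed.
Let den0 : 0 < den. Proof. by rewrite addr_gt0// !mulr_gt0 ?exprn_gt0. Qed.

Lemma perturbation_gt0 : 0 < h.
Proof. by rewrite powR_gt0// divr_gt0// !mulr_gt0 ?exprn_gt0. Qed.

Lemma perturbation_pow4 : (h ^+ 2) ^+ 2 = 3 * d%:R ^+ 2 * sigma ^+ 2 / den.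
Proof.
rewrite -exprM -powR_mulrn ?(ltW perturbation_gt0)// -powRrM mulVf ?powRr1//.
by rewrite ltW// divr_gt0// !mulr_gt0 ?exprn_gt0.
Qed.

Lemma le_of_sqr_le (u v : R) : 0 <= u -> 0 <= v -> u ^+ 2 <= v ^+ 2 -> u <= v.
Proof. by move=> u0 v0; rewrite ler_pXn2r. Qed.

Let s0 : 0 < h ^+ 2. Proof. by rewrite exprn_gt0// perturbation_gt0. Qed.

(** Only [9 * L ^+ 2 * d%:R ^+ 2] is kept in the denominator, which cancels the dimension. *)
Lemma sqr_perturbation_le : h ^+ 2 <= sigma / L.
Proof.
apply: le_of_sqr_le; [exact: ltW|by rewrite divr_ge0// ltW|].
rewrite perturbation_pow4 ler_pdivrMr//.
have -> : (sigma / L) ^+ 2 * den = sigma ^+ 2 * (2 * alpha * t%:R / L + 9 * d%:R ^+ 2).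
  by rewrite /den; field; rewrite gt_eqF.
have q0 : 0 <= 2 * alpha * t%:R / L by rewrite divr_ge0 ?mulr_ge0.
have := mulr_ge0 (sqr_ge0 sigma) q0.
have := mulr_ge0 (sqr_ge0 sigma) (sqr_ge0 (d%:R : R)).
lra.
Qed.

Lemma perturbation_le : h <= 1 + sigma / L.
Proof.
have := sqr_perturbation_le; have := sqr_ge0 (h - 1).
have := perturbation_gt0; nra.
Qed.

Let sqr_root : Num.sqrt (alpha * T%:R) ^+ 2 = alpha * T%:R.
Proof. by rewrite sqr_sqrtr// mulr_ge0. Qed.

Let r0 : 0 <= Num.sqrt (alpha * T%:R). Proof. exact: sqrtr_ge0. Qed.

Lemma rate_scale_ge1 : 1 <= rate_scale.
Proof.
have d1 : 1 <= d%:R :> R by rewrite ler1n.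
have := mulr_ge0 (ltW dR) r0; rewrite /rate_scale; nra.
Qed.

Lemma sqr_dim_le_rate_scale : d%:R ^+ 2 <= rate_scale.
Proof. by rewrite lerDl mulr_ge0. Qed.

(** Only [2 * L * alpha * t%:R] is kept in the denominator, so the square of the left side is at
    most (3 sigma^2 / 2L) d^2 alpha t. The added 1 makes the constant at least 1, hence at most its
    own square. *)
Lemma perturbation_bias_le :
  alpha * t%:R * h ^+ 2 <= (1 + 3 * sigma ^+ 2 / (2 * L)) * rate_scale.
Proof.
set C := 1 + _.
have c0 : 0 <= 3 * sigma ^+ 2 / (2 * L) by rewrite divr_ge0 ?mulr_ge0 ?sqr_ge0.
have C1 : 1 <= C by rewrite lerDl.
have at0 : 0 <= alpha * t%:R by rewrite mulr_ge0.
apply: (@le_trans _ _ (C * (d%:R * Num.sqrt (alpha * T%:R)))); last first.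
  rewrite ler_wpM2l ?(le_trans ler01)// lerDr; exact: sqr_ge0.
apply: le_of_sqr_le; [by rewrite mulr_ge0// ltW|by rewrite !mulr_ge0 ?(le_trans ler01 C1)|].
rewrite [leLHS]exprMn perturbation_pow4 !exprMn sqr_root.
apply: (@le_trans _ _ (3 * sigma ^+ 2 / (2 * L) * (d%:R ^+ 2 * (alpha * T%:R)))); last first.
  rewrite ler_wpM2r ?mulr_ge0 ?sqr_ge0//.
  apply: (@le_trans _ _ C); first by rewrite lerDr.
  by rewrite expr2 ler_peMl// (le_trans ler01).
apply: (@le_trans _ _ (3 * sigma ^+ 2 / (2 * L) * (d%:R ^+ 2 * (alpha * t%:R)))); last first.
  by rewrite ler_wpM2l// ler_wpM2l ?sqr_ge0// ler_pM2l// ler_nat.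
rewrite [leLHS]mulrA ler_pdivrMr//.
have -> : 3 * sigma ^+ 2 / (2 * L) * (d%:R ^+ 2 * (alpha * t%:R)) * den =
   (alpha * t%:R) ^+ 2 * (3 * d%:R ^+ 2 * sigma ^+ 2) +
   3 * sigma ^+ 2 * (d%:R ^+ 2 * (alpha * t%:R)) * (9 / 2 * L * d%:R ^+ 2).
  by rewrite /den; field; rewrite gt_eqF.
rewrite exprMn lerDl !mulr_ge0 ?sqr_ge0 ?divr_ge0//.
Qed.

(** The square of d^2 / h^2 is exactly (2L / 3 sigma^2) d^2 alpha t + (3 L^2 / sigma^2) d^4, while
    Q^2 dominates d^4 + d^2 alpha T. *)
Lemma perturbation_variance_le :
  d%:R ^+ 2 / h ^+ 2 <= (1 + 2 * L / (3 * sigma ^+ 2) + 3 * L ^+ 2 / sigma ^+ 2) * rate_scale.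
Proof.
set C1 := 2 * L / _; set C2 := 3 * L ^+ 2 / _; set C := 1 + C1 + C2.
have C10 : 0 <= C1 by rewrite divr_ge0 ?mulr_ge0 ?sqr_ge0.
have C20 : 0 <= C2 by rewrite divr_ge0 ?mulr_ge0 ?sqr_ge0.
have C0 : 1 <= C by rewrite /C; lra.
have Q0 : 0 <= rate_scale := le_trans ler01 rate_scale_ge1.
apply: le_of_sqr_le.
- by rewrite divr_ge0 ?sqr_ge0// ltW.
- by rewrite mulr_ge0// (le_trans ler01).
have dn : d%:R != 0 :> R by rewrite gt_eqF.
have sn : sigma != 0 by rewrite gt_eqF.
have -> : (d%:R ^+ 2 / h ^+ 2) ^+ 2 = C1 * (d%:R ^+ 2 * (alpha * t%:R)) + C2 * d%:R ^+ 4.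
  rewrite [LHS]exprMn exprVn perturbation_pow4 /C1 /C2 /den.
  by field; rewrite dn sn gt_eqF.
apply: (@le_trans _ _ (C * (d%:R ^+ 2 * (alpha * T%:R) + d%:R ^+ 4))).
  have p1 : 0 <= d%:R ^+ 4 :> R by rewrite exprn_ge0.
  have p2 : 0 <= d%:R ^+ 2 * (alpha * t%:R) by rewrite !mulr_ge0.
  have p3 : d%:R ^+ 2 * (alpha * t%:R) <= d%:R ^+ 2 * (alpha * T%:R).
    by rewrite ler_wpM2l ?sqr_ge0// ler_pM2l// ler_nat.
  have q1 := ler_wpM2l C10 p3.
  have q2 := mulr_ge0 C20 p2; have q3 := ler_wpM2l C20 p3; have q4 := mulr_ge0 C10 p1.
  by rewrite /C; lra.
rewrite [leRHS]exprMn.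
apply: (@le_trans _ _ (C ^+ 2 * (d%:R ^+ 2 * (alpha * T%:R) + d%:R ^+ 4))).
  rewrite ler_wpM2r ?addr_ge0 ?exprn_ge0 ?mulr_ge0//.
  by rewrite expr2 ler_peMl// (le_trans ler01).
rewrite ler_wpM2l ?sqr_ge0//.
have -> : rate_scale ^+ 2 = d%:R ^+ 4 + d%:R ^+ 2 * Num.sqrt (alpha * T%:R) ^+ 2
   + 2 * d%:R ^+ 3 * Num.sqrt (alpha * T%:R) by rewrite /rate_scale; ring.
rewrite sqr_root; have p : 0 <= 2 * d%:R ^+ 3 * Num.sqrt (alpha * T%:R).
  by rewrite !mulr_ge0 ?exprn_ge0.
lra.
Qed.

End Schedule.

(** Coefficient of Q in the second moment of the estimator: smooth part, with h^2 <= sigma / L, and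
    noise part through d^2 / h^2. *)
Definition variance_const {R : realType} (L sigma G : R) : R :=
  6 * G ^+ 2 + 6 * L * sigma +
  3 / 2 * sigma ^+ 2 * (1 + 2 * L / (3 * sigma ^+ 2) + 3 * L ^+ 2 / sigma ^+ 2).

(** The first three summands bound the deviation coefficient with h <= 1 + sigma / L, [L * K] bounds
    alpha K / 2, then come bias and variance; the 1 absorbs the constant in [deviation_contraction],
    as Q >= 1. *)
Definition rate_const {R : realType} (L Lbar sigma G K : R) : R :=
  Lbar * K + G + Lbar * (1 + sigma / L) + L * K + (L + Lbar) * (1 + 3 * sigma ^+ 2 / (2 * L))
  + variance_const L sigma G + 1.

Lemma measurable_rms {R : realType} {n d : nat} {disp : measure_display}
    {S : measurableType disp} (a : 'I_n -> S -> 'rV[R]_d) :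
  (forall i, measurable_fun setT (a i)) -> measurable_fun setT (fun w => rms (fun i => a i w)).
Proof.
move=> ma; apply: measurable_funM; first exact: measurable_cst.
apply: measurable_enorm; apply: measurable_fun_rV => i.
by under eq_fun do rewrite mxE; exact: measurable_enorm.
Qed.

Lemma measurable_vmean {R : realType} {n d : nat} {disp : measure_display}
    {S : measurableType disp} (a : 'I_n -> S -> 'rV[R]_d) :
  (forall i, measurable_fun setT (a i)) -> measurable_fun setT (fun w => vmean (fun i => a i w)).
Proof.
by move=> ma; apply: measurable_scalev; [exact: measurable_cst|exact: measurable_sumv].
Qed.

Lemma measurable_grad_estimator {R : realType} {d : nat} {disp : measure_display}
    {S : measurableType disp} (F : 'rV[R]_d -> R) (h : R) (X Z : S -> 'rV[R]_d) (a b : S -> R) :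
  continuous F -> measurable_fun setT X -> measurable_fun setT Z ->
  measurable_fun setT a -> measurable_fun setT b ->
  measurable_fun setT (fun w => grad_estimator F h (X w) (Z w) (a w) (b w)).
Proof.
move=> cF mX mZ ma mb; apply: measurable_scalev => //.
have mhZ : measurable_fun setT (fun w => h *: Z w) by apply: measurable_scalev => //; exact: measurable_cst.
apply: measurable_funM; first exact: measurable_cst.
apply: measurable_funB; apply: measurable_funD => //.
  by apply: (measurable_comp_continuous cF); exact: measurable_addv.
by apply: (measurable_comp_continuous cF); exact: measurable_subv.
Qed.

(** * The iterates: measurability, integrability and bounds *)

Section Iterates.
Context {R : realType} {n d T : nat} {disp : measure_display} {Omega : measurableType disp}.
Variables (L Lbar sigma G K alpha : R) (Theta : set 'rV[R]_d).
Variables (f : 'I_n -> 'rV[R]_d -> R) (W : 'M[R]_n) (P : probability Omega R).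
Variables (zeta : 'I_n -> nat -> {RV P >-> 'rV[R]_d}) (xi xi' : 'I_n -> nat -> {RV P >-> R}).
Variables (mu : probability 'rV[R]_d R) (x : 'I_n -> nat -> Omega -> 'rV[R]_d) (xstar : 'rV[R]_d).
Hypotheses (L0 : 0 < L) (Lbar0 : 0 < Lbar) (sigma0 : 0 < sigma) (G0 : 0 < G) (K0 : 0 < K).
Hypotheses (n0 : (1 <= n)%N) (d0 : (1 <= d)%N) (alpha0 : 0 < alpha).
Hypothesis Theta_neq0 : Theta !=set0.
Hypothesis Theta_convex : convex_set (Theta : set (convex_lmodType 'rV[R]_d)).
Hypothesis Theta_compact : compact Theta.
Hypothesis Theta_diam : forall y z, Theta y -> Theta z -> enorm (y - z) <= K.
Hypothesis f_F2 : forall i, class_F2 L (f i).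
Hypothesis f_smooth : forall i, smooth2 Lbar (f i).
Hypothesis f_grad : forall i y, Theta y -> enorm (grad (f i) y) <= G.
Hypothesis f_convex : strongly_convex alpha (average f).
Hypothesis W_stochastic : doubly_stochastic W.
Hypothesis mu_uniform : uniform_on_sphere mu.
Hypothesis zeta_iid : iid mu (fun it : 'I_n * 'I_T => zeta it.1 it.2.+1).
Hypothesis x1_measurable : forall i, measurable_fun setT (x i 1%N).
Hypothesis x_iterates : dzo_iterates T Theta W f (step_size alpha)
    (@perturbation R d L sigma alpha)
    (fun i t => zeta i t) (fun i t => xi i t) (fun i t => xi' i t) x.
Hypothesis zeta_indep : forall t i, (1 <= t <= T)%N ->
  independent_sigma P (sigma_of (zeta i t))
    <<s sigma_of (xi i t) `|` sigma_of (xi' i t) `|`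
        <<s \bigcup_(k in [set: 'I_n]) sigma_of (x k t) >> >>.
Hypothesis noise_le : forall t i, (1 <= t <= T)%N ->
  ('E_P[fun w => (xi i t w ^+ 2)%R] <= (sigma ^+ 2)%:E)%E /\
  ('E_P[fun w => (xi' i t w ^+ 2)%R] <= (sigma ^+ 2)%:E)%E.
Hypothesis xstar_min : is_minimizer (average f) Theta xstar.

Local Notation h := (@perturbation R d L sigma alpha).
Local Notation eta := (@step_size R alpha).

Lemma f_differentiable i y : differentiable (f i) y.
Proof. by have [+ _] := f_F2 i; apply. Qed.

Lemma f_smooth_pair i : smooth_pair L Lbar (f i) (grad (f i)).
Proof. by apply: class_F2_smooth_pair => //; exact: ltW. Qed.

Lemma f_continuous i : continuous (f i).
Proof. exact: (smooth_pair_continuous (f_smooth_pair i)). Qed.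

Lemma iterate_in i t w : (1 <= t <= T.+1)%N -> Theta (x i t w).
Proof.
have [x1 _ xS] := x_iterates; have [W0 Wr _] := W_stochastic.
case: t => [//|[_|t /= tT]]; first exact: x1.
rewrite xS//; apply: convex_set_sum => // k.
exact: proj_in.
Qed.

Lemma measurable_iterate i t : (1 <= t <= T.+1)%N -> measurable_fun setT (x i t).
Proof.
have [_ _ xS] := x_iterates.
elim: t i => [//|[|t] IH] i /= tT; first exact: x1_measurable.
have tT' : (1 <= t.+1 <= T)%N by [].
have -> : x i t.+2 = fun w => \sum_k W i k *: Defs.proj Theta (x k t.+1 w - eta t.+1 *:
            grad_estimator (f k) (h t.+1) (x k t.+1 w) (zeta k t.+1 w)
              (xi k t.+1 w) (xi' k t.+1 w)).
  by apply/funext => w; rewrite xS.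
apply: measurable_sumv => k; apply: measurable_scalev; first exact: measurable_cst.
apply: measurable_proj => //.
have mx : measurable_fun setT (x k t.+1) by apply: IH; rewrite /= ltnW.
apply: measurable_subv => //; apply: measurable_scalev; first exact: measurable_cst.
apply: measurable_grad_estimator => //; first exact: f_continuous.
Qed.

(** On this event of probability one, all directions drawn in rounds 1 to T are unit vectors, so
    inserting [on_sphere] changes nothing. *)
Definition sphere_event : set Omega :=
  \bigcap_(it in [set it | it \in [set: 'I_n * 'I_T]%SET]) (zeta it.1 it.2.+1 @^-1` [set u | enorm u = 1]).

Lemma measurable_sphere_event : measurable sphere_event.
Proof.
apply: fin_bigcap_measurable => // it _.
rewrite -[X in measurable X]setTI; apply: measurable_funPT => //.
exact: measurable_eq1_enorm.
Qed.

Lemma sphere_event_full : P sphere_event = 1%E.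
Proof.
have [law prodlaw] := zeta_iid.
rewrite /sphere_event (prodlaw [set: 'I_n * 'I_T]%SET (fun=> [set u | enorm u = 1])); last first.
  by move=> _; exact: measurable_eq1_enorm.
apply: big1 => it _; rewrite -(mu_uniform.1) -(law it)//.
exact: measurable_eq1_enorm.
Qed.

Lemma sphere_eventP w i t : sphere_event w -> (1 <= t <= T)%N -> enorm (zeta i t w) = 1.
Proof.
move=> Dw /andP[]; case: t => // t _ tT.
by have := Dw (i, Ordinal tT); rewrite /= inE; apply.
Qed.

Lemma zeta_law i t A : (1 <= t <= T)%N -> measurable A -> P (zeta i t @^-1` A) = mu A.
Proof.
move=> /andP[]; case: t => // t _ tT mA.
by rewrite -(zeta_iid.1 (i, Ordinal tT) A mA).
Qed.


Lemma rate_const_bounds : [/\ 0 <= variance_const L sigma G, 0 <= (L + Lbar) * (1 + 3 * sigma ^+ 2 / (2 * L)),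
  0 <= Lbar * K + G + Lbar * (1 + sigma / L) & 0 <= L * K].
Proof.
have [[Lg Lbg] [[sg Gg] Kg]] := (ltW L0, ltW Lbar0, (ltW sigma0, ltW G0, ltW K0)).
have q1 : 0 <= sigma / L by rewrite divr_ge0.
have q2 : 0 <= 3 * sigma ^+ 2 / (2 * L) by rewrite divr_ge0 ?mulr_ge0 ?sqr_ge0.
have q3 : 0 <= 2 * L / (3 * sigma ^+ 2) by rewrite divr_ge0 ?mulr_ge0 ?sqr_ge0.
have q4 : 0 <= 3 * L ^+ 2 / sigma ^+ 2 by rewrite divr_ge0 ?mulr_ge0 ?sqr_ge0.
split; last by rewrite mulr_ge0.
- rewrite /variance_const.
  have p1 : 0 <= 6 * G ^+ 2 by rewrite mulr_ge0 ?sqr_ge0.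
  have p2 : 0 <= 6 * L * sigma by rewrite !mulr_ge0.
  have p3 : 0 <= 3 / 2 * sigma ^+ 2 * (1 + 2 * L / (3 * sigma ^+ 2) + 3 * L ^+ 2 / sigma ^+ 2).
    apply: mulr_ge0; first by rewrite mulr_ge0 ?sqr_ge0// divr_ge0.
    by rewrite !addr_ge0.
  by rewrite !addr_ge0.
- by rewrite mulr_ge0 ?addr_ge0.
- by rewrite !addr_ge0 ?mulr_ge0 ?addr_ge0.
Qed.

Definition lyapunov s w : R := rms (fun i => x i s w - xstar) ^+ 2.
Definition deviation s w : R := rms (fun i => x i s w - vmean (fun j => x j s w)).
Definition gap s w : R := average f (vmean (fun i => x i s w)) - average f xstar.

Lemma average_smooth_pair : smooth_pair L Lbar (average f) (grad (average f)).
Proof. exact: (smooth_pair_objective n0 f_differentiable f_smooth_pair). Qed.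

Lemma gap_bounded : exists M : R, forall y, Theta y -> `|average f y - average f xstar| <= M.
Proof.
have [L0' _ h1 _] := average_smooth_pair; have [ts _] := xstar_min.
exists (enorm (grad (average f) xstar) * K + L * K ^+ 2) => y ty.
have yK := Theta_diam ty ts.
have -> : average f y - average f xstar = (average f y - average f xstar -
    dotp (grad (average f) xstar) (y - xstar)) + dotp (grad (average f) xstar) (y - xstar).
  by rewrite subrK.
apply: le_trans (ler_normD _ _) _; rewrite addrC; apply: lerD.
  by apply: le_trans (norm_dotp_le _ _) _; rewrite ler_wpM2l ?enorm_ge0.
by apply: le_trans (h1 _ _) _; rewrite ler_wpM2l// ler_pXn2r ?nnegrE ?enorm_ge0 ?(ltW K0).
Qed.

Lemma measurable_average : measurable_fun setT (average f).
Proof. exact: (continuous_measurable_rV (smooth_pair_continuous average_smooth_pair)). Qed.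

Section Means.
Variable s : nat.
Hypothesis s1T : (1 <= s <= T.+1)%N.

Let mxs i : measurable_fun setT (x i s). Proof. exact: measurable_iterate. Qed.
Let txs i w : Theta (x i s w). Proof. exact: iterate_in. Qed.
Let txm w : Theta (vmean (fun i => x i s w)).
Proof. by apply: (vmean_in n0 Theta_convex) => i; exact: txs. Qed.

Lemma deviation_bounds w : 0 <= deviation s w <= K.
Proof.
rewrite rms_ge0 /=; apply: (rms_const_le n0); first exact: ltW.
by move=> i; exact: Theta_diam.
Qed.

Lemma deviation_has_mean : has_mean P (deviation s).
Proof.
apply: (@has_mean_bounded _ _ _ _ _ K) => [|w].
  apply: measurable_rms => i.
  by apply: measurable_subv; [exact: mxs|exact: (measurable_vmean mxs)].
by have /andP[h1 h2] := deviation_bounds w; rewrite ger0_norm.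
Qed.

Lemma lyapunov_has_mean : has_mean P (lyapunov s).
Proof.
have ts : Theta xstar by case: xstar_min.
apply: (@has_mean_bounded _ _ _ _ _ (K ^+ 2)) => [|w].
  apply: measurable_funX; apply: measurable_rms => i.
  by apply: measurable_subv; [exact: mxs|exact: measurable_cst].
rewrite ger0_norm ?sqr_ge0// ler_pXn2r ?nnegrE ?rms_ge0 ?(ltW K0)//.
by apply: (rms_const_le n0) => [|i]; [exact: ltW|exact: Theta_diam].
Qed.

Lemma gap_has_mean : has_mean P (gap s).
Proof.
have [M hM] := gap_bounded.
apply: (@has_mean_bounded _ _ _ _ _ M) => [|w]; last exact: hM.
apply: measurable_funB; last exact: measurable_cst.
exact: (measurableT_comp measurable_average (measurable_vmean mxs)).
Qed.

(** Pythagoras over the agents, with the squared deviation lowered to first order by deviation <= K: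
    the recursions involve only its mean. *)
Lemma sqr_mean_error_ge w :
  lyapunov s w - K * deviation s w <= enorm (vmean (fun i => x i s w) - xstar) ^+ 2.
Proof.
have /andP[h1 h2] := deviation_bounds w.
rewrite /lyapunov (sqr_rms_sub n0 (fun i => x i s w)) -/(deviation s w).
have : deviation s w ^+ 2 <= K * deviation s w by rewrite expr2 ler_wpM2r.
by lra.
Qed.

Lemma gap_ge w : alpha / 4 * (lyapunov s w - K * deviation s w) <= gap s w.
Proof.
apply: le_trans (strongly_convex_gap f_convex Theta_convex xstar_min (txm w)).
by rewrite ler_wpM2l ?sqr_mean_error_ge// divr_ge0// ltW.
Qed.

Lemma gap_mean_ge : alpha / 4 * (\int[P]_w lyapunov s w - K * \int[P]_w deviation s w) <=
  \int[P]_w gap s w.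
Proof.
have h1 := has_meanZ K deviation_has_mean.
have h2 := has_meanB lyapunov_has_mean h1.
rewrite -RintZ; last exact: deviation_has_mean.
rewrite -RintB//; last exact: lyapunov_has_mean.
rewrite -RintZ//; apply: Rint_le gap_ge; [exact: has_meanZ|exact: gap_has_mean].
Qed.

End Means.

(** * One round of the algorithm, in expectation *)

Section Step.
Variable t : nat.
Hypothesis t1T : (1 <= t <= T)%N.

Let t0 : (0 < t)%N. Proof. by case/andP: t1T. Qed.
Let tT : (t <= T)%N. Proof. by case/andP: t1T. Qed.
Let tT1 : (1 <= t <= T.+1)%N. Proof. by rewrite t0 ltnW. Qed.
Let tT2 : (1 <= t.+1 <= T.+1)%N. Proof. by []. Qed.

Let h0 : 0 < h t. Proof. exact: perturbation_gt0. Qed.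

Let mx i : measurable_fun setT (x i t). Proof. exact: measurable_iterate. Qed.
Let tx i w : Theta (x i t w). Proof. exact: iterate_in. Qed.
Let ts : Theta xstar. Proof. by case: xstar_min. Qed.

Lemma noise_sqr_mean (X : {RV P >-> R}) :
  ('E_P[fun w => (X w ^+ 2)%R] <= (sigma ^+ 2)%:E)%E ->
  has_mean P (fun w => X w ^+ 2) /\ \int[P]_w (X w ^+ 2) <= sigma ^+ 2.
Proof.
rewrite unlock => hX.
have mX : measurable_fun setT (fun w => X w ^+ 2) by exact: measurable_funX.
have hm : has_mean P (fun w => X w ^+ 2).
  apply/integrableP; split; first exact: (measurable_EFinP _ _).2 mX.
  apply: le_lt_trans (ltry (sigma ^+ 2)); apply: le_trans hX.
  rewrite le_eqVlt; apply/orP; left; apply/eqP; apply: eq_integral => w _ /=.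
  by rewrite ger0_norm// sqr_ge0.
split => //; rewrite -lee_fin -EFin_Rint//.
Qed.

Let noise2 k w := xi k t w ^+ 2 + xi' k t w ^+ 2.

Let noise2_mean k : has_mean P (noise2 k) /\ \int[P]_w noise2 k w <= 2 * sigma ^+ 2.
Proof.
have [/noise_sqr_mean[m1 l1] /noise_sqr_mean[m2 l2]] := noise_le k t1T.
split; first exact: has_meanD.
by rewrite RintD//; lra.
Qed.

(** The estimator fed with [on_sphere] of the sample: its bounds hold for every w, and it equals the
    algorithm's estimator on [sphere_event]. *)
Definition direction k w :=
  grad_estimator (f k) (h t) (x k t w) (on_sphere (zeta k t w)) (xi k t w) (xi' k t w).

Let measurable_direction k : measurable_fun setT (direction k).
Proof.
apply: measurable_grad_estimator => //; first exact: f_continuous.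
exact: (measurableT_comp measurable_on_sphere).
Qed.

Let A : R := 6 * d%:R ^+ 2 * G ^+ 2 + 6 * d%:R ^+ 2 * L ^+ 2 * h t ^+ 2.
Let c : R := 3 * d%:R ^+ 2 / (4 * h t ^+ 2).

Let A0 : 0 <= A.
Proof.
have [Gge [Lge hge]] := (ltW G0, (ltW L0, ltW h0)).
by apply: addr_ge0; rewrite !mulr_ge0 ?sqr_ge0.
Qed.
Let c0 : 0 <= c.
Proof. by apply: divr_ge0; apply: mulr_ge0 => //; exact: sqr_ge0. Qed.

Let estimator_bound k w z : enorm z <= 1 ->
  enorm (grad_estimator (f k) (h t) (x k t w) z (xi k t w) (xi' k t w)) ^+ 2 <= A + c * noise2 k w.
Proof. by move=> z1; exact: (estimator_sqr_le _ _ h0 (f_smooth_pair k) (f_grad k (tx k w)) z1). Qed.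

Let direction_bound k w : enorm (direction k w) ^+ 2 <= A + c * noise2 k w.
Proof. exact/estimator_bound/enorm_on_sphere_le. Qed.

Let bound_mean k : has_mean P (fun w => A + c * noise2 k w).
Proof. by apply: has_meanD; [exact: has_mean_cst|apply: has_meanZ; exact: (noise2_mean k).1]. Qed.

Lemma direction_sqr_mean k :
  has_mean P (fun w => enorm (direction k w) ^+ 2) /\
  \int[P]_w (enorm (direction k w) ^+ 2) <= A + c * (2 * sigma ^+ 2).
Proof.
have hm : has_mean P (fun w => enorm (direction k w) ^+ 2).
  apply: (has_mean_le _ (bound_mean k)) => [|w].
    by apply: measurable_funX; exact: measurable_enorm.
  by rewrite ger0_norm ?sqr_ge0.
split => //; apply: (le_trans (Rint_le hm (bound_mean k) (direction_bound k))).
rewrite RintD ?Rint_cst ?RintZ ?lerD2l ?ler_wpM2l//; [exact: (noise2_mean k).2|exact: (noise2_mean k).1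
  |exact: has_mean_cst|by apply: has_meanZ; exact: (noise2_mean k).1].
Qed.

Let S k := g_sigma_algebraType (sigma_of (xi k t) `|` sigma_of (xi' k t) `|`
        <<s \bigcup_(k in [set: 'I_n]) sigma_of (x k t) >>).

Let sigma_of_measurable (disp2 : measure_display) (V : measurableType disp2) (X : Omega -> V) :
  measurable_fun setT X -> forall B, sigma_of X B -> measurable B.
Proof. by move=> mX _ [B mB <-]; exact: mX. Qed.

Let C_measurable k B : (sigma_of (xi k t) `|` sigma_of (xi' k t) `|`
        <<s \bigcup_(k in [set: 'I_n]) sigma_of (x k t) >>) B -> measurable B.
Proof.
case=> [[|]|]; [by apply: sigma_of_measurable; exact: measurable_funPT
  |by apply: sigma_of_measurable; exact: measurable_funPT|].
move: B; apply: smallest_sub; first exact: sigma_algebra_measurable.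
by move=> B [j _]; exact: (sigma_of_measurable (mx j)).
Qed.

Let xiS k : measurable_fun setT (xi k t : S k -> R).
Proof. by move=> _ B mB; apply: sub_sigma_algebra; left; left; exists B. Qed.

Let xi'S k : measurable_fun setT (xi' k t : S k -> R).
Proof. by move=> _ B mB; apply: sub_sigma_algebra; left; right; exists B. Qed.

Let xS k : measurable_fun setT (x k t : S k -> 'rV[R]_d).
Proof.
move=> _ B mB; apply: sub_sigma_algebra; right; apply: sub_sigma_algebra.
by exists k => //; exists B.
Qed.

(** The inner product with the sampled direction freed as z. The remaining dependence on w passes
    through the iterate and the two noises of agent k, all measurable for [S k]. *)
Let H k (z : 'rV[R]_d) (w : Omega) := dotp
  (grad_estimator (f k) (h t) (x k t w) (on_sphere z) (xi k t w) (xi' k t w)) (x k t w - xstar).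

Let measurable_H k : measurable_fun setT (fun p : 'rV[R]_d * S k => H k p.1 p.2).
Proof.
have m2 (disp2 : measure_display) (V : measurableType disp2) (X : S k -> V) : measurable_fun setT X ->
    measurable_fun setT (fun p : 'rV[R]_d * S k => X p.2).
  by move=> mX; exact: (measurableT_comp mX measurable_snd).
apply: measurable_dotp; last by apply: measurable_subv; [exact: m2|exact: measurable_cst].
apply: measurable_grad_estimator; [exact: f_continuous|exact: m2| |exact: m2|exact: m2].
exact: (measurableT_comp measurable_on_sphere measurable_fst).
Qed.

(** Dominates [H] uniformly in z through e <= 1 + e^2, so second moments of the noise suffice. *)
Let HB k w := K * (1 + (A + c * noise2 k w)).

Let HB_mean k : has_mean P (HB k).
Proof. by apply: has_meanZ; apply: has_meanD => //; exact: has_mean_cst. Qed.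

Let H_le k z w : `|H k z w| <= HB k w.
Proof.
apply: le_trans (norm_dotp_le _ _) _; rewrite mulrC.
apply: ler_pM; rewrite ?enorm_ge0//; first exact: Theta_diam.
have := estimator_bound k w (enorm_on_sphere_le z).
set e := enorm _; have := sqr_ge0 (e - 1); have : 0 <= e := enorm_ge0 _.
by nra.
Qed.

Lemma direction_dotp_mean k :
  has_mean P (fun w => dotp (direction k w) (x k t w - xstar)).
Proof.
have e := independent_has_mean (zeta k t) (C_measurable (k := k)) (H := H k) (measurable_H (k := k)) (B := HB k) (H_le k) (HB_mean k).
exact: e.
Qed.

Let zeta_t_law k B : measurable B -> P (zeta k t @^-1` B) = mu B.
Proof. by move=> mB; exact: zeta_law. Qed.

Let Hbar_mean k : has_mean P (fun w => \int[mu]_z H k z w).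
Proof.
have e := independent_mean_has_mean (C_measurable (k := k)) (zeta_t_law k) (zeta_indep (i := k) t1T)
  (H := H k) (measurable_H (k := k)) (B := HB k) (H_le k) (HB_mean k).
exact: e.
Qed.

Lemma direction_dotp_Rint k :
  \int[P]_w dotp (direction k w) (x k t w - xstar) = \int[P]_w (\int[mu]_z H k z w).
Proof.
have e := Rint_independent (C_measurable (k := k)) (zeta_t_law k) (zeta_indep (i := k) t1T)
  (H := H k) (measurable_H (k := k)) (B := HB k) (H_le k) (HB_mean k).
exact: e.
Qed.


Let sqr_rms_direction w :
  rms (fun k => direction k w) ^+ 2 = n%:R^-1 * \sum_k enorm (direction k w) ^+ 2.
Proof. exact: sqr_rms. Qed.

Lemma rms_direction_mean :
  has_mean P (fun w => rms (fun k => direction k w) ^+ 2) /\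
  \int[P]_w (rms (fun k => direction k w) ^+ 2) <= A + c * (2 * sigma ^+ 2).
Proof.
have e : (fun w => rms (fun k => direction k w) ^+ 2) =
    (fun w => n%:R^-1 * \sum_k enorm (direction k w) ^+ 2).
  by apply/funext => w; exact: sqr_rms_direction.
rewrite e.
have hm k := (direction_sqr_mean k).1.
split; first by exact: (has_meanZ _ (has_mean_sum _ hm)).
rewrite (RintZ _ (has_mean_sum _ hm)) Rint_sum// ler_pdivrMl ?ltr0n//.
apply: (@le_trans _ _ (\sum_(k < n) (A + c * (2 * sigma ^+ 2)))).
  by apply: ler_sum => k _; exact: (direction_sqr_mean k).2.
by rewrite sumr_const card_ord -[leLHS]mulr_natl.
Qed.

Let z k w := Defs.proj Theta (x k t w - eta t *: direction k w).

Let iterate_gossip w : sphere_event w -> forall i, x i t.+1 w = gossip W (fun k => z k w) i.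
Proof.
move=> Dw i; have [_ _ xS'] := x_iterates; rewrite xS'//.
by apply: eq_bigr => k _; rewrite /z /direction on_sphereE// (sphere_eventP k Dw).
Qed.

Let eta0 : 0 <= eta t.
Proof. by rewrite /step_size invr_ge0 mulr_ge0// ltW. Qed.

(** Neither mixing nor projection increases the distance to xstar, a point of [Theta]; the rest is
    the expansion of the square of the unprojected step. *)
Lemma lyapunov_descent w : sphere_event w ->
  lyapunov t.+1 w <= lyapunov t w
    - 2 * eta t * (n%:R^-1 * \sum_k dotp (direction k w) (x k t w - xstar))
    + eta t ^+ 2 * rms (fun k => direction k w) ^+ 2.
Proof.
move=> Dw; rewrite /lyapunov.
have -> : (fun i => x i t.+1 w - xstar) = (fun i => gossip W (fun k => z k w) i - xstar).
  by apply/funext => i; rewrite iterate_gossip.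
have h1 := rms_gossip_sub_le W_stochastic (fun k => z k w) xstar.
have h2 : rms (fun k => z k w - xstar) <= rms (fun k => x k t w - eta t *: direction k w - xstar).
  by apply: rms_le => k; exact: proj_dist_le.
have h3 : rms (fun i => gossip W (fun k => z k w) i - xstar) ^+ 2 <=
    rms (fun k => x k t w - eta t *: direction k w - xstar) ^+ 2.
  by rewrite ler_pXn2r ?nnegrE ?rms_ge0// (le_trans h1).
apply: le_trans h3 _; rewrite !sqr_rms.
have e k : enorm (x k t w - eta t *: direction k w - xstar) ^+ 2 =
  (enorm (x k t w - xstar) ^+ 2 - 2 * eta t * dotp (direction k w) (x k t w - xstar))
   + eta t ^+ 2 * enorm (direction k w) ^+ 2.
  rewrite addrAC (sqr_enormB (x k t w - xstar)) dotpZr (dotpC _ (direction k w)) enormZ exprMn.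
  by rewrite real_normK ?num_real//; ring.
under eq_bigr do rewrite e.
rewrite big_split sumrB /= -!mulr_sumr le_eqVlt; apply/orP; left; apply/eqP; ring.
Qed.

(** Mixing contracts the spread of the projected points around their mean, which is at most their
    spread around the old mean. Each projected step has length at most eta |direction|, since the
    starting point lies in [Theta]. *)
Lemma deviation_contraction w : sphere_event w ->
  deviation t.+1 w <= mixing_rate W *
    (deviation t w + eta t / 2 * (1 + rms (fun k => direction k w) ^+ 2)).
Proof.
move=> Dw; rewrite /deviation.
have e : (fun i => x i t.+1 w) = gossip W (fun k => z k w).
  by apply/funext => i; exact: iterate_gossip.
have -> : (fun i => x i t.+1 w - vmean (fun j => x j t.+1 w)) =
    (fun i => gossip W (fun k => z k w) i - vmean (fun k => z k w)).
  by rewrite e vmean_gossip//; apply/funext => i; rewrite -e.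
apply: le_trans (rms_gossip_sub_vmean n0 W_stochastic _) _.
rewrite ler_wpM2l ?spectral_norm_ge0//.
set m := vmean (fun i => x i t w).
apply: le_trans (rms_sub_vmean_le n0 _ m) _.
have -> : (fun i => z i w - m) = (fun i => (x i t w - m) + (z i w - x i t w)).
  by apply/funext => i; rewrite [RHS]addrC addrA subrK.
apply: le_trans (rmsD _ _) _; rewrite lerD2l.
apply: (@le_trans _ _ (rms (fun k => eta t *: direction k w))).
  apply: rms_le => k.
  apply: le_trans (proj_dist_le Theta_convex Theta_compact Theta_neq0 _ (tx k w)) _.
  by rewrite addrAC subrr add0r enormN.
(* The bound r <= (1 + r^2) / 2 trades the first power of [rms] for the second moment, the quantity
   already controlled. *)
apply: le_of_sqr_le; first exact: rms_ge0.
  by rewrite mulr_ge0 ?divr_ge0// addr_ge0// sqr_ge0.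
have -> : rms (fun k => eta t *: direction k w) ^+ 2 = eta t ^+ 2 * rms (fun k => direction k w) ^+ 2.
  rewrite !sqr_rms mulrCA; congr (_ * _); rewrite mulr_sumr; apply: eq_bigr => k _.
  by rewrite enormZ exprMn real_normK ?num_real.
have := mulr_ge0 (sqr_ge0 (eta t)) (sqr_ge0 (rms (fun k => direction k w) ^+ 2 - 1)).
set r := rms _ ^+ 2; set q := eta t; nra.
Qed.


Let Q : R := rate_scale d T alpha.
Let C : R := rate_const L Lbar sigma G K.

Let Q1 : 1 <= Q. Proof. exact: rate_scale_ge1. Qed.

Lemma variance_le : A + c * (2 * sigma ^+ 2) <= variance_const L sigma G * Q.
Proof.
have sL := sqr_perturbation_le d0 t0 L0 sigma0 alpha0.
have v := perturbation_variance_le d0 t0 tT L0 sigma0 alpha0.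
have dQ : d%:R ^+ 2 <= Q := sqr_dim_le_rate_scale d T alpha.
have hn : h t != 0 by rewrite gt_eqF.
have Ln : L != 0 by rewrite gt_eqF.
have e1 : c * (2 * sigma ^+ 2) = 3 / 2 * sigma ^+ 2 * (d%:R ^+ 2 / h t ^+ 2) by rewrite /c; field.
have p : 0 <= 3 / 2 * sigma ^+ 2 by rewrite mulr_ge0 ?sqr_ge0// divr_ge0.
have i1 := ler_wpM2l p v; rewrite -e1 in i1.
have p2 : 0 <= 6 * d%:R ^+ 2 * L ^+ 2 by apply: mulr_ge0; [apply: mulr_ge0 => //|]; exact: sqr_ge0.
have i2 := ler_wpM2l p2 sL.
have e2 : 6 * d%:R ^+ 2 * L ^+ 2 * (sigma / L) = d%:R ^+ 2 * (6 * L * sigma) by field.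
rewrite e2 in i2.
have p3 : 0 <= 6 * G ^+ 2 + 6 * L * sigma.
  have [Lg sg] := (ltW L0, ltW sigma0).
  by apply: addr_ge0; apply: mulr_ge0 => //; [exact: sqr_ge0|exact: mulr_ge0].
have i3 := ler_wpM2r p3 dQ.
rewrite /A /variance_const -/Q; rewrite -/Q in i1; lra.
Qed.

Let lower w := gap t w + alpha / 2 * (lyapunov t w - K * deviation t w)
  - (L + Lbar) * h t ^+ 2 - (Lbar * K + G + Lbar * h t) * deviation t w.

Lemma lower_le w : lower w <= n%:R^-1 * \sum_k \int[mu]_y H k y w.
Proof.
have le := consensus_estimator_ge mu_uniform n0 d0 alpha0 (ltW K0) h0 f_differentiable
  f_smooth_pair f_convex Theta_diam f_grad Theta_convex
  (x := fun i => x i t w) (fun k => xi k t w) (fun k => xi' k t w) (fun i => tx i w) ts.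
apply: le_trans le; rewrite /lower /gap.
have a2 : 0 <= alpha / 2 by rewrite divr_ge0// ltW.
have := ler_wpM2l a2 (sqr_mean_error_ge tT1 w).
rewrite -/(deviation t w); lra.
Qed.

Let means := (lyapunov_has_mean tT1, (deviation_has_mean tT1, gap_has_mean tT1)).

Lemma lower_mean : has_mean P lower /\ \int[P]_w lower w =
  \int[P]_w gap t w + alpha / 2 * (\int[P]_w lyapunov t w - K * \int[P]_w deviation t w)
  - (L + Lbar) * h t ^+ 2 - (Lbar * K + G + Lbar * h t) * \int[P]_w deviation t w.
Proof.
have [mV [mD mg]] := means.
have m1 := has_meanZ K mD.
have m2 := has_meanB mV m1.
have m3 := has_meanZ (alpha / 2) m2.
have m4 := has_meanD mg m3.
have m5 := has_mean_cst P ((L + Lbar) * h t ^+ 2).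
have m6 := has_meanB m4 m5.
have m7 := has_meanZ (Lbar * K + G + Lbar * h t) mD.
split; first exact: (has_meanB m6 m7).
by rewrite (RintB m6 m7) (RintB m4 m5) (RintD mg m3) (RintZ _ m2) (RintB mV m1)
  (RintZ _ mD) (RintZ _ mD) Rint_cst.
Qed.

(** The direction of each agent is integrated out separately; the averaged inner products are then
    compared with [lower] for each w. *)
Lemma inner_mean_ge :
  \int[P]_w lower w <= \int[P]_w (n%:R^-1 * \sum_k dotp (direction k w) (x k t w - xstar)).
Proof.
have hm k := direction_dotp_mean k.
rewrite (RintZ _ (has_mean_sum _ hm)) (Rint_sum _ hm).
under eq_bigr do rewrite direction_dotp_Rint.
rewrite -(Rint_sum _ Hbar_mean) -(RintZ _ (has_mean_sum _ Hbar_mean)).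
apply: Rint_le lower_le; first exact: lower_mean.1.
exact: (has_meanZ _ (has_mean_sum _ Hbar_mean)).
Qed.

Lemma lyapunov_mean_descent : \int[P]_w lyapunov t.+1 w <=
  \int[P]_w lyapunov t w - (\int[P]_w lyapunov t w) / t%:R
  - 2 / (alpha * t%:R) * \int[P]_w gap t w
  + 2 * C / (alpha * t%:R) * \int[P]_w deviation t w + 2 * (C * Q) / (alpha * t%:R) ^+ 2.
Proof.
have [mV [mD mg]] := means.
have hm k := direction_dotp_mean k.
have mi := has_meanZ n%:R^-1 (has_mean_sum (index_enum 'I_n) hm).
have mi2 := has_meanZ (2 * eta t) mi.
have [mr lr] := rms_direction_mean.
have mr2 := has_meanZ (eta t ^+ 2) mr.
have mB := has_meanB mV mi2.
have := Rint_le_full measurable_sphere_event sphere_event_full (lyapunov_has_mean tT2)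
  (has_meanD mB mr2) lyapunov_descent.
rewrite (RintD mB mr2) (RintB mV mi2) (RintZ _ mi) (RintZ _ mr).
have := inner_mean_ge; rewrite lower_mean.2.
have [q1 q2 q3 q4] := rate_const_bounds.
have a0 : 0 <= \int[P]_w deviation t w.
  by apply: Rintegral_ge0 => w _; case/andP: (deviation_bounds tT1 w).
have hb := perturbation_bias_le d0 t0 tT L0 sigma0 alpha0.
have hl := perturbation_le d0 t0 L0 sigma0 alpha0.
have aL : alpha <= 2 * L := strongly_convex_le f_convex average_smooth_pair d0.
have vl := le_trans lr variance_le.
have tR : 0 < t%:R :> R by rewrite ltr0n.
move: a0 vl; move: (\int[P]_w lyapunov t.+1 w) (\int[P]_w lyapunov t w) (\int[P]_w gap t w)
  (\int[P]_w deviation t w) (\int[P]_w (n%:R^-1 * _)) (\int[P]_w (rms _ ^+ 2)).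
move=> V' V g a X Y a0 Yle Xge Vle.
have e0 : 0 < eta t by rewrite /step_size invr_gt0 mulr_gt0.
(* With this step size, twice eta times the strong convexity term alpha / 2 is exactly the 1/t of
   the recursion. *)
have ea : eta t * alpha = t%:R^-1 by rewrite /step_size; field; rewrite !gt_eqF.
have -> : V / t%:R = eta t * alpha * V by rewrite ea mulrC.
have -> : 2 / (alpha * t%:R) = 2 * eta t by [].
have -> : 2 * C / (alpha * t%:R) = 2 * C * eta t by [].
have -> : 2 * (C * Q) / (alpha * t%:R) ^+ 2 = 2 * (C * Q) * eta t ^+ 2.
  by rewrite /step_size exprVn.
(* The bias is O(Q eta); after multiplication by the step size it has the order Q eta^2 of the
   variance term. *)
have hb' : h t ^+ 2 <= (1 + 3 * sigma ^+ 2 / (2 * L)) * Q * eta t.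
  rewrite /step_size ler_pdivlMr ?mulr_gt0// mulrC; exact: hb.
have i1 := ler_wpM2l (ltW e0) Xge.
have i2 := ler_wpM2l (sqr_ge0 (eta t)) Yle.
have i3 := ler_wpM2l (addr_ge0 (ltW L0) (ltW Lbar0)) hb'.
have i3' := ler_wpM2l (ltW e0) i3.
have i4 : (Lbar * K + G + Lbar * h t + alpha / 2 * K) * a <= C * a.
  rewrite ler_wpM2r//.
  have j1 := ler_wpM2l (ltW Lbar0) hl.
  have j2 := ler_wpM2r (ltW K0) aL.
  by rewrite /C /rate_const; lra.
have i4' := ler_wpM2l (ltW e0) i4.
have Qe : 0 <= Q * eta t ^+ 2 by rewrite mulr_ge0 ?sqr_ge0// (le_trans ler01).
have i5 : ((L + Lbar) * (1 + 3 * sigma ^+ 2 / (2 * L)) + variance_const L sigma G) * (Q * eta t ^+ 2)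
    <= C * (Q * eta t ^+ 2).
  rewrite ler_wpM2r// /C /rate_const; lra.
have i6 := mulr_ge0 q1 Qe.
have i7 := mulr_ge0 q2 Qe.
move: i1 i2 i3' i4' i5 i6 i7 Vle.
move: (variance_const L sigma G) (1 + 3 * sigma ^+ 2 / (2 * L)) => vc bc.
move=> i1 i2 i3' i4' i5 i6 i7 Vle; lra.
Qed.

Lemma deviation_mean_contraction : \int[P]_w deviation t.+1 w <=
  mixing_rate W * (\int[P]_w deviation t w + C * Q / (alpha * t%:R)).
Proof.
have [mV [mD mg]] := means.
have [mr lr] := rms_direction_mean.
have m1 := has_meanD (has_mean_cst P 1) mr.
have m2 := has_meanZ (eta t / 2) m1.
have m3 := has_meanD mD m2.
have := Rint_le_full measurable_sphere_event sphere_event_full (deviation_has_mean tT2)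
  (has_meanZ (mixing_rate W) m3) deviation_contraction.
rewrite (RintZ _ m3) (RintD mD m2) (RintZ _ m1) (RintD (has_mean_cst P 1) mr) Rint_cst => le.
apply: le_trans le _; rewrite ler_wpM2l ?spectral_norm_ge0// lerD2l.
have [q1 q2 q3 q4] := rate_const_bounds.
have vl := le_trans lr variance_le.
rewrite (mulrC (C * Q)) -mulrA -/(eta t) ler_wpM2l//.
apply: (@le_trans _ _ (2^-1 * (1 + variance_const L sigma G * Q))).
  by rewrite ler_wpM2l ?invr_ge0// lerD2l.
have p : 0 <= (C - variance_const L sigma G - 1) * Q.
  apply: mulr_ge0; last exact: le_trans Q1.
  by rewrite /C /rate_const; lra.
have q := mulr_ge0 q1 (le_trans ler01 Q1).
have := Q1; lra.
Qed.

End Step.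


(** By [strict_floorP], m < T/2 <= m + 1. The strict floor is nonnegative for T >= 1, so taking
    [absz] loses nothing. *)
Lemma strict_floor_half (m := `|strict_floor (T%:R / 2 : R)|%N) : (1 <= T)%N ->
  (2 * m < T)%N /\ (T <= 2 * m.+1)%N.
Proof.
move=> T1.
have s0 : 0 <= strict_floor (T%:R / 2 : R).
  by rewrite -strict_floorP mulr0z divr_gt0 ?ltr0n.
have mE : (m%:Z = strict_floor (T%:R / 2 : R))%R by rewrite /m gez0_abs.
have h1 : m%:R < T%:R / 2 :> R by rewrite -[m%:R]/(m%:Z%:~R) strict_floorP -mE.
have h2 : ~~ (m.+1%:R < T%:R / 2 :> R).
  by rewrite -[m.+1%:R]/(m.+1%:Z%:~R) strict_floorP -mE lez_nat ltnn.
split.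
  by rewrite -(ltr_nat R) natrM; lra.
by rewrite -(ler_nat R) natrM; rewrite -leNgt in h2; lra.
Qed.

(** * Averaging the gap over the last half of the rounds *)

Section TailAverage.
Hypothesis T1 : (1 <= T)%N.
Hypothesis rho1 : mixing_rate W < 1.

Let m := `|strict_floor (T%:R / 2 : R)|%N.
Let C : R := rate_const L Lbar sigma G K.
Let Q : R := rate_scale d T alpha.

Let mT : (2 * m < T)%N. Proof. by case: (strict_floor_half T1). Qed.
Let Tm : (T <= 2 * m.+1)%N. Proof. by case: (strict_floor_half T1). Qed.
Let mltT : (m < T)%N. Proof. by apply: leq_ltn_trans mT; rewrite leq_pmull. Qed.

Let weight_sum : \sum_(m.+1 <= t < T.+1) (T%:R - m%:R)^-1 = 1 :> R.
Proof.
rewrite big_const_nat iter_addr_0 subSS -[LHS]mulr_natr natrB ?(ltnW mltT)//.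
by rewrite mulVf// subr_eq0 eqr_nat gtn_eqF.
Qed.

Let weight_ge0 : 0 <= (T%:R - m%:R)^-1 :> R.
Proof. by rewrite invr_ge0 subr_ge0 ler_nat ltnW. Qed.

(** Iterates are controlled only for rounds 1 to T + 1. Clamping the index changes no term of the
    sum, and lets facts required of every index hold for all t. *)
Let tail_sum w : tail_average T (agent_mean x) w =
  \sum_(m.+1 <= t < T.+1) (T%:R - m%:R)^-1 *: vmean (fun i => x i (minn T.+1 (maxn 1 t)) w).
Proof.
rewrite /tail_average scaler_sumr; apply: eq_big_nat => t /andP[h1 h2].
have -> : minn T.+1 (maxn 1 t) = t.
  by rewrite (maxn_idPr (leq_trans _ h1))//; apply/minn_idPr; exact: ltnW.
by [].
Qed.

Let clamp_range t : (1 <= minn T.+1 (maxn 1 t) <= T.+1)%N.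
Proof. by rewrite geq_minl leq_min leq_maxl. Qed.

Lemma tail_average_in w : Theta (tail_average T (agent_mean x) w).
Proof.
rewrite tail_sum; apply: convex_set_sum => // t.
by apply: (vmean_in n0 Theta_convex) => i; exact: (iterate_in _ _ (clamp_range t)).
Qed.

Lemma measurable_tail_average : measurable_fun setT (tail_average T (agent_mean x)).
Proof.
have -> : tail_average T (agent_mean x) = (fun w =>
  \sum_(m.+1 <= t < T.+1) (T%:R - m%:R)^-1 *: vmean (fun i => x i (minn T.+1 (maxn 1 t)) w)).
  by apply/funext => w; exact: tail_sum.
apply: measurable_sumv => t; apply: measurable_scalev; first exact: measurable_cst.
by apply: measurable_vmean => i; apply: measurable_iterate; exact: clamp_range.
Qed.

Lemma tail_gap_le w : average f (tail_average T (agent_mean x) w) - average f xstar <=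
  \sum_(m.+1 <= t < T.+1) (T%:R - m%:R)^-1 * gap t w.
Proof.
rewrite tail_sum.
have le := strongly_convex_jensen alpha0 f_convex
  (fun t => vmean (fun i => x i (minn T.+1 (maxn 1 t)) w)) (fun=> weight_ge0) weight_sum.
rewrite lerBlDr; apply: le_trans le _.
have e : average f xstar = \sum_(m.+1 <= t < T.+1) (T%:R - m%:R)^-1 * average f xstar.
  by rewrite -mulr_suml weight_sum mul1r.
apply: (@le_trans _ _ (\sum_(m.+1 <= t < T.+1) (T%:R - m%:R)^-1 * gap t w +
  \sum_(m.+1 <= t < T.+1) (T%:R - m%:R)^-1 * average f xstar)); last by rewrite -e.
rewrite le_eqVlt; apply/orP; left; apply/eqP; apply: etrans; last exact: big_split.
apply: eq_big_nat => t /andP[h1 h2].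
have -> : minn T.+1 (maxn 1 t) = t.
  by rewrite (maxn_idPr (leq_trans _ h1))//; apply/minn_idPr; exact: ltnW.
by rewrite /gap /= mulrBr subrK.
Qed.

Lemma tail_mean_bound :
  has_mean P (fun w => average f (tail_average T (agent_mean x) w) - average f xstar) /\
  \int[P]_w (average f (tail_average T (agent_mean x) w) - average f xstar) <=
  (32 * C + 6) * (C * Q) / ((1 - mixing_rate W) * alpha * T%:R).
Proof.
have hm : has_mean P (fun w => average f (tail_average T (agent_mean x) w) - average f xstar).
  have [M hM] := gap_bounded.
  apply: (@has_mean_bounded _ _ _ _ _ M) => [|w]; last exact/hM/tail_average_in.
  apply: measurable_funB; last exact: measurable_cst.
  exact: (measurableT_comp measurable_average measurable_tail_average).
split => //.
pose g t w := gap (minn T.+1 (maxn 1 t)) w.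
have hg t : has_mean P (g t) by apply: gap_has_mean; exact: clamp_range.
have hs := has_mean_sum (index_iota m.+1 T.+1) (fun t => has_meanZ (T%:R - m%:R)^-1 (hg t)).
have le w : average f (tail_average T (agent_mean x) w) - average f xstar <=
    \sum_(m.+1 <= t < T.+1) (T%:R - m%:R)^-1 * g t w.
  apply: le_trans (tail_gap_le w) _; rewrite le_eqVlt; apply/orP; left; apply/eqP.
  apply: eq_big_nat => t /andP[h1 h2]; rewrite /g.
  by rewrite (maxn_idPr (leq_trans _ h1))// (minn_idPr (ltnW h2)).
apply: le_trans (Rint_le hm hs le) _.
rewrite (Rint_sum _ (fun t => has_meanZ (T%:R - m%:R)^-1 (hg t))).
have -> : \sum_(m.+1 <= t < T.+1) \int[P]_w ((T%:R - m%:R)^-1 * g t w) =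
    (T%:R - m%:R)^-1 * \sum_(m.+1 <= t < T.+1) \int[P]_w gap t w.
  rewrite mulr_sumr; apply: eq_big_nat => t /andP[h1 h2].
  rewrite (RintZ _ (hg t)) /g.
  by rewrite (maxn_idPr (leq_trans _ h1))// (minn_idPr (ltnW h2)).
have [c1 c2 c3 c4] := rate_const_bounds.
have C0 : 0 <= C by rewrite /C /rate_const; lra.
have Q1 : 1 <= Q by exact: rate_scale_ge1.
have CP : C <= C * Q by rewrite ler_peMr.
have aL : alpha <= 2 * L := strongly_convex_le f_convex average_smooth_pair d0.
have aK : alpha * K <= 2 * C.
  by have := ler_wpM2r (ltW K0) aL; rewrite /C /rate_const; lra.
apply: (tail_gap_bound alpha0 C0 CP (spectral_norm_ge0 _) rho1 aK
  (V := fun t => \int[P]_w lyapunov t w) (a := fun t => \int[P]_w deviation t w)) => //.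
- by move=> t _ _; apply: Rintegral_ge0 => w _; exact: sqr_ge0.
- move=> t h1 h2; have r : (1 <= t <= T.+1)%N by rewrite h1 ltnW.
  apply/andP; split.
    by apply: Rintegral_ge0 => w _; case/andP: (deviation_bounds r w).
  have := Rint_le (deviation_has_mean r) (has_mean_cst P K) (fun w => (andP (deviation_bounds r w)).2).
  by rewrite Rint_cst.
- by move=> t h1 h2; apply: deviation_mean_contraction; rewrite h1.
- by move=> t h1 h2; apply: lyapunov_mean_descent; rewrite h1.
- by move=> t h1 h2; apply: gap_mean_ge; rewrite h1 ltnW.
Qed.

End TailAverage.
End Iterates.

Theorem theorem7 (R : realType) (L Lbar sigma G K : R) :
  0 < L -> 0 < Lbar -> 0 < sigma -> 0 < G -> 0 < K ->
  exists B : R, 0 < B /\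
  forall (n d T : nat) (alpha : R)
    (Theta : set 'rV[R]_d) (f : 'I_n -> 'rV[R]_d -> R) (W : 'M[R]_n),
  (1 <= n)%N -> (1 <= d)%N -> (1 <= T)%N -> 0 < alpha ->
  Theta !=set0 -> convex_set (Theta : set (convex_lmodType 'rV[R]_d)) ->
  compact Theta -> (diam Theta <= K%:E)%E ->
  (forall i, class_F2 L (f i)) ->
  (forall i, smooth2 Lbar (f i)) ->
  (forall i x, Theta x -> enorm (grad (f i) x) <= G) ->
  strongly_convex alpha (average f) ->
  W^T = W -> doubly_stochastic W -> mixing_rate W < 1 ->
  forall (disp : measure_display) (Omega : measurableType disp)
    (P : probability Omega R)
    (zeta : 'I_n -> nat -> {RV P >-> 'rV[R]_d})
    (xi xi' : 'I_n -> nat -> {RV P >-> R})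
    (mu : probability 'rV[R]_d R)
    (x : 'I_n -> nat -> Omega -> 'rV[R]_d) (xstar : 'rV[R]_d),
  uniform_on_sphere mu ->
  iid mu (fun it : 'I_n * 'I_T => zeta it.1 it.2.+1) ->
  (forall i, measurable_fun setT (x i 1%N)) ->
  dzo_iterates T Theta W f (step_size alpha)
    (@perturbation R d L sigma alpha)
    (fun i t => zeta i t) (fun i t => xi i t) (fun i t => xi' i t) x ->
  (forall t i, (1 <= t <= T)%N ->
     independent_sigma P (sigma_of (zeta i t))
       <<s sigma_of (xi i t) `|` sigma_of (xi' i t) `|`
           <<s \bigcup_(k in [set: 'I_n]) sigma_of (x k t) >> >>) ->
  (forall t i, (1 <= t <= T)%N ->
     ('E_P[fun w => (xi i t w ^+ 2)%R] <= (sigma ^+ 2)%:E)%E /\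
     ('E_P[fun w => (xi' i t w ^+ 2)%R] <= (sigma ^+ 2)%:E)%E) ->
  is_minimizer (average f) Theta xstar ->
  ('E_P[fun w => (average f (tail_average T (agent_mean x) w)
                  - average f xstar)%R]
   <= (B / (1 - mixing_rate W) *
       (d%:R / Num.sqrt (alpha * T%:R) + d%:R ^+ 2 / (alpha * T%:R)))%:E)%E.
Proof.
move=> L0 Lbar0 sigma0 G0 K0.
pose C : R := rate_const L Lbar sigma G K.
have C0 : 0 < C.
  have [c1 c2 c3 c4] := rate_const_bounds L0 Lbar0 sigma0 G0 K0.
  by rewrite /C /rate_const; lra.
(* The bound of [tail_gap_bound] with P = C Q, where Q / (alpha T) is left to become the rate. *)
exists ((32 * C + 6) * C); split.
  by apply: mulr_gt0 => //; apply: addr_gt0 => //; exact: mulr_gt0.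
move=> n d T alpha Theta f W n0 d0 T1 alpha0 Theta0 Theta_convex Theta_compact Theta_diam
  fF2 fsmooth fgrad fsc _ Wst rho1 disp Omega P zeta xi xi' mu x xstar mu_unif zeta_iid
  mx1 iter indep noise xmin.
have diamK y z : Theta y -> Theta z -> enorm (y - z) <= K by exact: diam_le.
have [hm le] := tail_mean_bound L0 Lbar0 sigma0 G0 K0 n0 d0 alpha0 Theta0 Theta_convex
  Theta_compact diamK fF2 fsmooth fgrad fsc Wst mu_unif zeta_iid mx1 iter indep noise xmin T1 rho1.
rewrite unlock (EFin_Rint hm) lee_fin; apply: le_trans le _; rewrite -/C.
have T0 : 0 < T%:R :> R by rewrite ltr0n.
have aT : 0 < alpha * T%:R by rewrite mulr_gt0.
have s0 : 0 < Num.sqrt (alpha * T%:R) by rewrite sqrtr_gt0.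
have r0 : 0 < 1 - mixing_rate W by rewrite subr_gt0.
have e : alpha * T%:R = Num.sqrt (alpha * T%:R) ^+ 2 by rewrite sqr_sqrtr// ltW.
(* With s the square root of alpha T, the identity (d^2 + d s) / s^2 = d / s + d^2 / s^2 makes the
   two sides equal. *)
rewrite /rate_scale -(mulrA _ alpha) [X in _ / (_ * X)]e [X in _ + _ / X]e.
move: s0 r0; move: (Num.sqrt _) (1 - mixing_rate W) => s r s0 r0.
rewrite le_eqVlt; apply/orP; left; apply/eqP; field.
by rewrite !gt_eqF.
Qed.
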